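(* Let $f$, the partition $J_1,\dots,J_N$, $X=\prod_jX_j$, $X_T=\prod_jX_{j,T}$ (compact basic semialgebraic sets each including a ball constraint $R^2-\|x\|^2\ge0$) be as in the setting of the context, with acyclic sparsity graph having leafs $x_{i_1},\dots,x_{i_l}$, and let $R_T$ be the ROA. For $k\in\mathbb{N}$ let $S^{(k)}=\{x\in X: w^r_k(x_{I_r})\ge1,\ r=1,\dots,l\}$ be the decoupled SDP outer approximation (context), and let $Y^{(k)}=\{x\in X:\sum_{r=1}^l\tilde w^r(x_{I_r})\ge l\}$ where $(\tilde w^r,\tilde v^r)_{r=1,\dots,l}$ is an optimal point of the degree-$k$ sparse SDP tightening (context) of the sparse LP. Then $S^{(k)}\cap Y^{(k)}\supset R_T$ and $\lambda\big((S^{(k)}\cap Y^{(k)})\,\Delta\,R_T\big)\to0$ as $k\to\infty$, and the largest sum-of-squares multiplier occurring acts on $\omega$ (state) variables, $\omega=\max_i\sum_{x_j\in\mathbf{P}(x_i)}n_j$.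
   Context: Setting: $f:\mathbb{R}^n\to\mathbb{R}^n$ polynomial; blocks $x_j=(x_i)_{i\in J_j}\in\mathbb{R}^{n_j}$. Sparsity graph: edge $(x_i,x_j)$ if $f_j$ depends on $x_i$; past $\mathbf{P}(x_j)$ = $x_j$ and all nodes with a directed path to $x_j$; leaf = node without successor. $I_r$ indexes the blocks of $\mathbf{P}(x_{i_r})$, $X_{I_r}=\prod_{j\in I_r}X_j\subset\mathbb{R}^{n_r}$, $f_{I_r}$ the corresponding components of $f$, $\mathcal{L}_rv=\partial_tv+\nabla_{x_{I_r}}v\cdot f_{I_r}$. ROA: $R_T=\{x_0\in X$: solution stays in $X$ on $[0,T]$, $x(T)\in X_T\}$. Decoupled SDP: for each $r$, $w^r_k$ is optimal for the degree-$k$ SOS tightening of $\inf\int_{X_{I_r}}w\,d\lambda$ s.t. $\mathcal{L}_rv\le0$ on $[0,T]\times X_{I_r}$, $v(T,\cdot)\ge0$ on $\prod_{j\in I_r}X_{j,T}$, $w\ge0$ and $w\ge v(0,\cdot)+1$ on $X_{I_r}$, where each constraint ''$h\ge0$ on $K=\{p_1\ge0,\dots,p_m\ge0\}$'' is replaced by $h=\sigma_0+\sum_j\sigma_jp_j$ (plus $\sigma\,t(T-t)$ for constraints on $[0,T]\times K$) with SOS $\sigma$'s and all degrees $\le k$. Sparse LP: $\inf\sum_r\int_{X_{I_r}}w^r\,d\lambda$ over $v^r\in C^1([0,T]\times\mathbb{R}^{n_r})$, $w^r\in C(X_{I_r})$ s.t. $\sum_r\mathcal{L}_rv^r(t,x_{I_r})\le0$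 on $[0,T]\times X$, $\sum_rv^r(T,x_{I_r})\ge0$ on $X_T$, $\sum_rw^r(x_{I_r})\ge0$ on $X$, $\sum_r(w^r(x_{I_r})-v^r(0,x_{I_r}))\ge l$ on $X$. Its degree-$k$ sparse SDP tightening restricts to polynomials of degree $\le k$ and replaces each nonnegativity constraint by a certificate that is a sum over $r$ of terms $\sigma^r_0+\sum_j\sigma^r_jg^r_j$, where the SOS polynomials $\sigma^r$ depend only on the variables $x_{I_r}$ (and $t$) and the $g^r_j$ are the polynomials defining the factors $X_j$, $j\in I_r$ (resp. $X_{j,T}$, and $t(T-t)$). $\lambda$ is Lebesgue measure, $\Delta$ symmetric difference. *)

(* Defs.v *)
From HB Require Import structures.
From mathcomp Require Import all_boot all_order all_algebra.
From mathcomp Require Import mpoly.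
From mathcomp Require Import all_classical all_reals all_analysis.
Set Implicit Arguments. Unset Strict Implicit. Unset Printing Implicit Defensive.
Import Order.TTheory GRing.Theory Num.Theory.
Import numFieldNormedType.Exports.
Local Open Scope classical_set_scope.
Local Open Scope ring_scope.

Section Sparse.
Variables (R : realType) (n : nat).

(* Polynomials in the n state variables x_0..x_{n-1} (indices [xv i]) and
   the time variable t (index [tv] = ord_max). *)
Local Notation SPoly := (mpoly.mpoly n.+1 R).
Definition xv (i : 'I_n) : 'I_n.+1 := widen_ord (leqnSn n) i.
Definition tv : 'I_n.+1 := ord_max.
Definition Xv (j : 'I_n.+1) : SPoly := mpoly.mpolyX R (mpoly.mnm1 j).
Definition Cst (c : R) : SPoly := mpoly.mpolyC n.+1 c.

Definition pt (t : R) (x : 'I_n -> R) : 'I_n.+1 -> R :=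
  fun j => if unlift tv j is Some i then x i else t.
Definition ev (p : SPoly) (t : R) (x : 'I_n -> R) : R := mpoly.meval (pt t x) p.

Definition depb (p : SPoly) (j : 'I_n.+1) : bool :=
  has (fun m => (0 < tnth (mpoly.multinom_val m) j)%N) (mpoly.msupp p).
Definition dep_only (S : {set 'I_n.+1}) (p : SPoly) : Prop :=
  forall j, j \notin S -> ~~ depb p j.
Definition deg_le (k : nat) (p : SPoly) : Prop :=
  all (fun m => (mpoly.mdeg m <= k)%N) (mpoly.msupp p).

Definition sos (S : {set 'I_n.+1}) (p : SPoly) : Prop :=
  exists qs : seq SPoly, (forall i, (i < size qs)%N -> dep_only S (nth 0 qs i)) /\
    p = \sum_(q <- qs) q ^+ 2.

Definition qmod (k : nat) (S : {set 'I_n.+1}) (gens : seq SPoly) (h : SPoly) :=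
  exists (s0 : SPoly) (s : 'I_(size gens) -> SPoly),
    [/\ sos S s0, deg_le k s0,
        (forall i, sos S (s i) /\ deg_le k (s i * nth 0 gens i)) &
        h = s0 + \sum_(i < size gens) s i * nth 0 gens i].

Definition sqmod (l k : nat) (S : 'I_l -> {set 'I_n.+1}) (G : 'I_l -> seq SPoly)
    (h : SPoly) :=
  exists hr : 'I_l -> SPoly, (forall r, qmod k (S r) (G r) (hr r)) /\
    h = \sum_(r < l) hr r.

Definition vat (c : R) (v : SPoly) : SPoly :=
  mpoly.comp_mpoly [tuple (if i == tv then Cst c else Xv i) | i < n.+1] v.

Definition tTpoly (T : R) : SPoly := Xv tv * (Cst T - Xv tv).

Definition Svars (V : {set 'I_n}) : {set 'I_n.+1} := xv @: V.
Definition Stvars (V : {set 'I_n}) : {set 'I_n.+1} := tv |: Svars V.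

(* Lebesgue integration over R^n realised as iterated integrals with respect
   to the Lebesgue measure on R over the coordinates listed in s *)
Definition upd (x : 'I_n -> R) (i : 'I_n) (t : R) : 'I_n -> R :=
  fun j => if j == i then t else x j.
Fixpoint iint (s : seq 'I_n) (g : ('I_n -> R) -> \bar R) (x : 'I_n -> R)
    : \bar R :=
  if s is i :: s' then (\int[@lebesgue_measure R]_t iint s' g (upd x i t))%E
  else g x.
Definition Leb (A : set ('I_n -> R)) : \bar R :=
  iint (enum 'I_n) (fun x => (\1_A x)%:E) (fun _ => 0).
(* int_{A} w dlambda over the coordinates V (A a cylinder over those coords) *)
Definition intOn (V : {set 'I_n}) (A : set ('I_n -> R)) (w : SPoly) : \bar R :=
  iint (enum V) (fun x => (\1_A x * ev w 0 x)%:E) (fun _ => 0).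

Variables (N : nat) (blk : 'I_n -> 'I_N).
Definition Jset (j : 'I_N) : {set 'I_n} := [set i | blk i == j].
Definition Vr (B : {set 'I_N}) : {set 'I_n} := [set i | blk i \in B].

Variable f : 'I_n -> SPoly.
Definition E : rel 'I_N := fun a b =>
  (a != b) && [exists i, exists j, [&& blk i == a, blk j == b & depb (f j) (xv i)]].
Definition past (b : 'I_N) : {set 'I_N} := [set a | connect E a b].
Definition leaf (a : 'I_N) : bool := [forall b, ~~ E a b].
Definition acyclic : Prop := forall a b, E a b -> ~~ connect E b a.
Definition omega : nat := \max_(b : 'I_N) #|Vr (past b)|.

Definition Lie (V : {set 'I_n}) (v : SPoly) : SPoly :=
  mpoly.mderiv tv v + \sum_(i in V) mpoly.mderiv (xv i) v * f i.

Variables (gs gsT : 'I_N -> seq SPoly) (T : R).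
Definition gensOf (g : 'I_N -> seq SPoly) (B : {set 'I_N}) : seq SPoly :=
  flatten [seq g j | j <- enum B].
(* X_B = prod_{j in B} X_j, as a cylinder set in R^n *)
Definition XB (g : 'I_N -> seq SPoly) (B : {set 'I_N}) : set ('I_n -> R) :=
  [set x | forall j, j \in B -> forall p, p \in g j -> 0 <= ev p 0 x].
Definition Xset := XB gs [set: 'I_N]%SET.
Definition XTset := XB gsT [set: 'I_N]%SET.

Definition is_sol (x0 : 'I_n -> R) (phi : R -> 'I_n -> R) : Prop :=
  [/\ phi 0 = x0,
      (forall i, {within `[0, T], continuous (fun s : R => phi s i : R)}) &
      (forall t, 0 < t < T -> forall i,
          is_derive t 1 (fun s => phi s i) (ev (f i) 0 (phi t)))].
Definition ROA : set ('I_n -> R) :=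
  [set x0 | Xset x0 /\ exists phi, is_sol x0 phi /\
     (forall t, 0 <= t <= T -> Xset (phi t)) /\ XTset (phi T)].

Definition feas_dec (k : nat) (B : {set 'I_N}) (v w : SPoly) : Prop :=
  let V := Vr B in
  [/\ deg_le k v, deg_le k w, dep_only (Stvars V) v & dep_only (Svars V) w] /\
  [/\ qmod k (Stvars V) (tTpoly T :: gensOf gs B) (- Lie V v),
      qmod k (Svars V) (gensOf gsT B) (vat T v),
      qmod k (Svars V) (gensOf gs B) w &
      qmod k (Svars V) (gensOf gs B) (w - vat 0 v - 1)].
Definition opt_dec (k : nat) (B : {set 'I_N}) (v w : SPoly) : Prop :=
  feas_dec k B v w /\
  forall v' w', feas_dec k B v' w' ->
    (intOn (Vr B) (XB gs B) w <= intOn (Vr B) (XB gs B) w')%E.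

Definition feas_sp (l k : nat) (Bs : 'I_l -> {set 'I_N}) (v w : 'I_l -> SPoly)
    : Prop :=
  [/\ (forall r, [/\ deg_le k (v r), deg_le k (w r),
         dep_only (Stvars (Vr (Bs r))) (v r) & dep_only (Svars (Vr (Bs r))) (w r)]),
      sqmod k (fun r => Stvars (Vr (Bs r))) (fun r => tTpoly T :: gensOf gs (Bs r))
            (- \sum_(r < l) Lie (Vr (Bs r)) (v r)),
      sqmod k (fun r => Svars (Vr (Bs r))) (fun r => gensOf gsT (Bs r))
            (\sum_(r < l) vat T (v r)),
      sqmod k (fun r => Svars (Vr (Bs r))) (fun r => gensOf gs (Bs r))
            (\sum_(r < l) w r) &
      sqmod k (fun r => Svars (Vr (Bs r))) (fun r => gensOf gs (Bs r))
            (\sum_(r < l) (w r - vat 0 (v r)) - l%:R)].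
Definition sp_obj (l : nat) (Bs : 'I_l -> {set 'I_N}) (w : 'I_l -> SPoly) : \bar R :=
  (\sum_(r < l) intOn (Vr (Bs r)) (XB gs (Bs r)) (w r))%E.
Definition opt_sp (l k : nat) (Bs : 'I_l -> {set 'I_N}) (v w : 'I_l -> SPoly) : Prop :=
  feas_sp k Bs v w /\
  forall v' w', feas_sp k Bs v' w' -> (sp_obj Bs w <= sp_obj Bs w')%E.

End Sparse.

Notation SPoly R n := (mpoly.mpoly n.+1 R).

Definition ball_con (R : realType) (n N : nat) (blk : 'I_n -> 'I_N) (j : 'I_N) (rho : R)
  : SPoly R n :=
  Cst n (rho ^+ 2) - \sum_(i in Jset blk j) Xv R (xv i) ^+ 2.

(* Main.v *)
(* Membership of [RT] in [S k] and [Y k] is the usual argument: a feasible [v] is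
   nonincreasing along solutions.  For the convergence only [S k] is needed.  By
   acyclicity the pasts of the leafs cover all blocks, and each past is an autonomous
   subsystem, so a point of [X] outside [RT] starts a trajectory which for some leaf
   [r] leaves [X_{I_r}] or misses its target.  Instead of LP duality one constructs the
   dual certificate directly: on a box around such a point, a polynomial [v] that is
   minus a bump around that single trajectory (approximated by polynomial Picard
   iterates) is very negative at time 0, and strictly satisfies all other constraints.
   Finitely many boxes exhaust the bad set up to small measure, and the sum of their
   [v]'s is strictly feasible, hence feasible for the degree-[k] tightening for large
   [k] by Putinar's Positivstellensatz, which is proved via maximal quadratic modules.
   Comparing the optimal [w_k] with this certificate bounds the measure of the bad
   points where [1 <= w_k]. *)
Require Import Defs.
From HB Require Import structures.
From mathcomp Require Import all_boot all_order all_algebra.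
From mathcomp Require Import mpoly.
From mathcomp Require Import all_classical all_reals all_analysis.
From mathcomp Require Import measurable_realfun.
From mathcomp Require Import ring lra.
Set Implicit Arguments.
Unset Strict Implicit.
Unset Printing Implicit Defensive.
Import Order.TTheory GRing.Theory Num.Theory.
Import numFieldNormedType.Exports.
Local Open Scope classical_set_scope.
Local Open Scope ring_scope.

(** * An Archimedean Positivstellensatz *)

(** The obstacle is that [v] must be a polynomial with strict inequalities on whole compact sets,
    whereas a trajectory is not polynomial and may cease to exist once it leaves [X]. Clamping the
    arguments of [f] gives a bounded, globally Lipschitz field that agrees with [f] on the
    constraint sets, hence curves on all of [0, T]. Each comes with polynomial curves that nearly
    solve the same equation, and these enter [v]. A margin linear in [t] pays for all approximation
    errors and leaves the strictness that Putinar asks for. The curve is built once in the full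
    state space, before a past is chosen. If it respects the constraints and targets of every leaf
    past, it is therefore a single solution of the whole system and its starting point lies in
    [ROA]. A certificate that is deep on one bad box can be kept below any prescribed positive bound
    elsewhere. This is why certificates add up. Boxes with rational data then turn the bad set into
    a countable union, measurable by construction, while [ROA] itself enters only through
    inclusions. *)

Section QuadraticModules.
Variables (R : realType) (A : comNzRingType) (c : {rmorphism R -> A}).

Let mem_eq (M : set A) x y : M x -> x = y -> M y.
Proof. by move=> ? <-. Qed.

Definition qmodule (M : set A) : Prop :=
  [/\ M 1, (forall a b, M a -> M b -> M (a + b)) &
      (forall a b, M b -> M (a ^+ 2 * b))].

(** Impredicative form: a property holds for all sums of squares once it defines a quadratic module,
    which is the induction used in [sumsq_mul]. *)
Definition sumsq : set A := [set s | forall M, qmodule M -> M s].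

Lemma qmodule0 M : qmodule M -> M 0.
Proof. by case=> M1 _ /(_ 0 1 M1); rewrite expr0n mul0r. Qed.

Lemma qmodule_sqr M a : qmodule M -> M (a ^+ 2).
Proof. by case=> M1 _ /(_ a 1 M1); rewrite mulr1. Qed.

Lemma qmodule_scale M r a : qmodule M -> 0 <= r -> M a -> M (c r * a).
Proof.
move=> [_ _ MM] r0 Ma; rewrite -(sqr_sqrtr r0) rmorphXn; exact: MM.
Qed.

Lemma qmodule_cst M r : qmodule M -> 0 <= r -> M (c r).
Proof. by move=> qM r0; rewrite -(mulr1 (c r)); apply: qmodule_scale => //; case: qM. Qed.

Lemma sumsq_mul M s a : qmodule M -> sumsq s -> M a -> M (s * a).
Proof.
move=> [M1 MD MM] ss Ma.
apply: (ss [set s | M (s * a)]); split => /=; first by rewrite mul1r.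
- by move=> x y Mx My; rewrite mulrDl; exact: MD.
- by move=> x y My; rewrite -mulrA; exact: MM.
Qed.

Lemma sumsq_qmodule : qmodule sumsq.
Proof.
split=> [M [] //|a b sa sb M qM|a b sb M qM].
  by have [_ MD _] := qM; apply: (MD); [exact: sa|exact: sb].
by have [_ _ MM] := qM; apply: (MM); exact: sb.
Qed.

Lemma qmodule_adjoin M a : qmodule M ->
  qmodule [set x | exists m s, [/\ M m, sumsq s & x = m + s * a]].
Proof.
move=> qM; have [M1 MD MM] := qM; have [s1 sD sM] := sumsq_qmodule.
split=> [|x y [m [s [Mm ss ->]]] [m' [s' [Mm' ss' ->]]]|x y [m [s [Mm ss ->]]]].
- by exists 1, 0; split=> //; [exact: qmodule0 sumsq_qmodule|rewrite mul0r addr0].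
- exists (m + m'), (s + s'); split; [exact: MD|exact: sD|by ring].
- exists (x ^+ 2 * m), (x ^+ 2 * s); split; [exact: MM|exact: sM|by ring].
Qed.

Lemma maximal_qmodule M : qmodule M -> ~ M (-1) ->
  exists Q, [/\ qmodule Q, M `<=` Q, ~ Q (-1) &
    forall Q', qmodule Q' -> Q `<=` Q' -> ~ Q' (-1) -> Q' `<=` Q].
Proof.
move=> qM M1.
(* The union of the empty chain is [set0]; with [M] built into [P], it satisfies [P] too. *)
pose P (E : set A) := qmodule (M `|` E) /\ ~ (M `|` E) (-1).
have [F FP totF|E [[qE E1] Emax]] := @Zorn_bigcup A P.
  have sub E : F E -> M `|` E `<=` M `|` \bigcup_(X in F) X.
    by move=> FE x [Mx|Ex]; [left|right; exists E].
  have mem1 x : (M `|` \bigcup_(X in F) X) x -> M x \/ exists2 E, F E & (M `|` E) x.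
    by case=> [Mx|[E FE Ex]]; [left|right; exists E => //; right].
  have mem2 x y : (M `|` \bigcup_(X in F) X) x -> (M `|` \bigcup_(X in F) X) y ->
      exists E, [/\ qmodule (M `|` E), M `|` E `<=` M `|` \bigcup_(X in F) X,
                    (M `|` E) x & (M `|` E) y].
    move=> /mem1[Mx|[E FE Ex]] /mem1[My|[E' FE' Ey]].
    - by exists set0; rewrite setU0; split => // z; left.
    - by exists E'; split=> //; [case: (FP _ FE')|exact: sub|left].
    - by exists E; split=> //; [case: (FP _ FE)|exact: sub|left].
    - have [EE|EE] := totF _ _ FE FE'.
      + exists E'; split=> //; [by case: (FP _ FE')|exact: sub|].
        by case: Ex => [|/EE]; [left|right].
      + exists E; split=> //; [by case: (FP _ FE)|exact: sub|].
        by case: Ey => [|/EE]; [left|right].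
  split; last first.
    by case/mem1 => // -[E /FP[_ E1]].
  split; first by left; case: qM.
  - by move=> a b /mem2/[apply] -[E [[_ ED _] sE Ea Eb]]; apply: (sE); exact: ED.
  - by move=> a b Mb; have [E [[_ _ EM] sE _ Eb]] := mem2 _ _ Mb Mb; apply: (sE); exact: EM.
exists (M `|` E); split => // Q' qQ' sQ Q'1.
have MQ' : M `|` Q' = Q' by apply/setUidPr => x Mx; apply: sQ; left.
apply: contrapT => nQ; apply: (Emax Q'); last by rewrite /P MQ'.
split; last by move=> /(_ _)-sQE; apply: nQ => x /sQE; right.
by move=> x Ex; apply: sQ; right.
Qed.

(** * The real point defined by a maximal Archimedean quadratic module *)

Section MaximalQuadraticModule.
Variable Q : set A.
Hypotheses (qQ : qmodule Q) (Qn1 : ~ Q (-1)).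
Hypothesis Qmax :
  forall Q', qmodule Q' -> Q `<=` Q' -> ~ Q' (-1) -> Q' `<=` Q.
Hypothesis Qarch : forall a, exists N, Q (c N - a).

(** Polarization: 4ab = (a + 1)^2 b + (a - 1)^2 (-b). *)
Lemma qmodule_support_ideal a b : Q b -> Q (- b) -> Q (a * b).
Proof.
move=> Qb QNb; have [_ QD QM] := qQ.
have h4 : c 4^-1 * 4 = 1.
  by rewrite -(rmorph_nat c 4) -rmorphM mulVf ?rmorph1 // pnatr_eq0.
have -> : a * b = c 4^-1 * ((a + 1) ^+ 2 * b + (a - 1) ^+ 2 * - b).
  by transitivity (c 4^-1 * 4 * (a * b)); [rewrite h4 mul1r|ring].
by apply: qmodule_scale => //; apply: (QD); apply: (QM).
Qed.

(** Otherwise maximality gives -1 = m1 + t1 a = m2 - t2 a. Eliminating [a] puts -t1 in [Q], so t1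
    lies in the support, which is an ideal; then t1 a and hence -1 are in [Q]. *)
Lemma maximal_qmodule_total a : Q a \/ Q (- a).
Proof.
have [Q1 QD QM] := qQ; have [s1 _ _] := sumsq_qmodule.
have adj b : ~ Q b -> exists m s, [/\ Q m, sumsq s & -1 = m + s * b].
  move=> nQb; apply: contrapT => n1; apply: nQb.
  apply: (Qmax (qmodule_adjoin b qQ)) => //.
  - by move=> x Qx; exists x, 0; split=> //; [exact: qmodule0 sumsq_qmodule|rewrite mul0r addr0].
  - by exists 0, 1; split => //; [exact: qmodule0|rewrite add0r mul1r].
apply: contrapT => /not_orP[/adj[m1 [t1 [Qm1 st1 e1]]] /adj[m2 [t2 [Qm2 st2 e2]]]].
have Qt1 : Q t1 by exact: st1.
have QNt1 : Q (- t1).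
  have -> : - t1 = t2 * 1 + t2 * m1 + t1 * m2.
    have E1 : t1 * a = - 1 - m1 by rewrite e1; ring.
    have E2 : t2 * a = m2 + 1 by move/eqP: e2; rewrite eq_sym -subr_eq0 => /eqP e2; rewrite -[RHS](subr0) -e2; ring.
    have E3 : t2 * (t1 * a) = t1 * (t2 * a) by ring.
    move: E3; rewrite E1 E2 => E3.
    transitivity (- t1 + (t1 * (m2 + 1) - t2 * (- 1 - m1))); last by ring.
    by rewrite -E3 subrr addr0.
  by apply: (QD); [apply: (QD)|]; apply: sumsq_mul.
apply: Qn1; rewrite e1; apply: (QD) => //.
by rewrite mulrC; exact: qmodule_support_ideal.
Qed.

(** Standard part of [a] in the order defined by [Q]: equality up to every positive real. The map
    from [a] to [x] becomes the homomorphism to the reals that plays the role of a point. *)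
Definition near_val a x :=
  forall e : R, 0 < e -> Q (a - c x + c e) /\ Q (c x - a + c e).

Lemma qmodule_cst_ge0 r : Q (c r) -> 0 <= r.
Proof.
move=> Qr; rewrite leNgt; apply/negP => r0; apply: Qn1.
have -> : -1 = c (- r^-1) * c r.
  by rewrite -rmorphM mulNr mulVf ?rmorphN1 // lt_eqF.
by apply: qmodule_scale => //; rewrite oppr_ge0 invr_le0 ltW.
Qed.

(** A Dedekind cut: [Qarch] for [- a] and [a] makes the set of [r] with [a - c r] in [Q] nonempty
    and bounded above, and totality gives the reverse membership for every real above its
    supremum. *)
Lemma near_val_exists a : exists x, near_val a x.
Proof.
have [_ QD QM] := qQ.
pose S := [set r | Q (a - c r)].
have supS : has_sup S.
  have [N QN] := Qarch a; have [N' QN'] := Qarch (- a); split.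
    by exists (- N'); rewrite /S /= rmorphN; apply: mem_eq QN' _; ring.
  exists N => r /= Qr; rewrite -subr_ge0; apply: qmodule_cst_ge0.
  by rewrite rmorphB; have := QD _ _ QN Qr; move=> /mem_eq; apply; ring.
exists (sup S) => e e0; split.
  have [r Sr rS] := sup_adherent e0 supS.
  have -> : a - c (sup S) + c e = (a - c r) + c (r - (sup S - e)).
    by rewrite !rmorphB; ring.
  by apply: (QD) => //; apply: qmodule_cst => //; rewrite subr_ge0 ltW.
have [|] := maximal_qmodule_total (a - c (sup S + e)).
  by move=> /(sup_upper_bound supS); lra.
by move=> /mem_eq; apply; rewrite rmorphD; ring.
Qed.

Lemma near_val_ge0 a x : Q a -> near_val a x -> 0 <= x.
Proof.
have [_ QD _] := qQ; move=> Qa nax; rewrite leNgt; apply/negP => x0.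
have /nax[_] : 0 < - x / 2 by rewrite divr_gt0 // oppr_gt0.
move=> /QD/(_ Qa); rewrite addrAC subrK -rmorphD => /qmodule_cst_ge0; lra.
Qed.

Lemma near_valD a b x y : near_val a x -> near_val b y -> near_val (a + b) (x + y).
Proof.
have [_ QD _] := qQ.
move=> na nb e e0; have e2 : 0 < e / 2 by rewrite divr_gt0.
have [a1 a2] := na _ e2; have [b1 b2] := nb _ e2.
have -> : c e = c (e / 2) + c (e / 2) by rewrite -rmorphD -splitr.
rewrite rmorphD; split.
  by have := QD _ _ a1 b1; move=> /mem_eq; apply; ring.
by have := QD _ _ a2 b2; move=> /mem_eq; apply; ring.
Qed.

Lemma near_valN a x : near_val a x -> near_val (- a) (- x).
Proof.
move=> na e /na[e1 e2]; rewrite rmorphN; split; [move: e2|move: e1]; move=> /mem_eq; apply; ring.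
Qed.

Lemma near_val_cst r : near_val (c r) r.
Proof.
by move=> e e0; rewrite subrr add0r; split; apply: qmodule_cst => //; exact: ltW.
Qed.

Lemma near_val_pscale r a x : 0 < r -> near_val a x -> near_val (c r * a) (r * x).
Proof.
move=> r0 na e e0.
have [e1 e2] := na _ (divr_gt0 e0 r0).
have ce : c r * c (e / r) = c e by rewrite -rmorphM mulrC divfK // gt_eqF.
by split; [move/(qmodule_scale qQ (ltW r0)): e1|move/(qmodule_scale qQ (ltW r0)): e2];
  move=> /mem_eq; apply; rewrite (rmorphM c r x) -ce; ring.
Qed.

Lemma near_val_scale r a x : near_val a x -> near_val (c r * a) (r * x).
Proof.
move=> na; have [r0|r0|->] := ltgtP r 0; last 2 first.
- exact: near_val_pscale.
- by rewrite rmorph0 !mul0r -(rmorph0 c); exact: near_val_cst.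
have nr : 0 < - r by rewrite oppr_gt0.
have := near_valN (near_val_pscale nr na).
by rewrite rmorphN !mulNr !opprK.
Qed.

(** With d = sqrt e, the identity 2d (d^2 - a^2) = (a - d)^2 (a + d) + (a + d)^2 (d - a) writes the
    difference with members of [Q] and square weights. *)
Lemma near_val_sqr0 a : near_val a 0 -> near_val (a ^+ 2) 0.
Proof.
have [_ QD QM] := qQ.
move=> na e e0; rewrite rmorph0 subr0 sub0r; split.
  by apply: (QD); [exact: qmodule_sqr|apply: qmodule_cst => //; exact: ltW].
pose d := Num.sqrt e; have d0 : 0 < d by rewrite sqrtr_gt0.
have ed : c e = c d ^+ 2 by rewrite -rmorphXn sqr_sqrtr ?ltW.
have [a1 a2] := na d d0; rewrite rmorph0 subr0 in a1; rewrite rmorph0 sub0r in a2.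
have d2 : c (2 * d)^-1 * (c d *+ 2) = 1.
  rewrite -rmorphMn -rmorphM -(mulr_natl d 2) mulVf ?rmorph1 //.
  by rewrite mulf_neq0 // ?gt_eqF // ltr0n.
have -> : - a ^+ 2 + c e =
    c (2 * d)^-1 * ((a - c d) ^+ 2 * (a + c d) + (a + c d) ^+ 2 * (- a + c d)).
  transitivity (c (2 * d)^-1 * (c d *+ 2) * (- a ^+ 2 + c e)); first by rewrite d2 mul1r.
  by rewrite ed; ring.
apply: qmodule_scale => //; first by rewrite invr_ge0 mulr_ge0 // ltW.
by apply: (QD); apply: (QM).
Qed.

Lemma near_val0M a b : near_val a 0 -> near_val b 0 -> near_val (a * b) 0.
Proof.
move=> na nb.
have h4 : c 4^-1 * 4 = 1.
  by rewrite -(rmorph_nat c 4) -rmorphM mulVf ?rmorph1 // pnatr_eq0.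
have -> : a * b = c 4^-1 * ((a + b) ^+ 2 - (a - b) ^+ 2).
  by transitivity (c 4^-1 * 4 * (a * b)); [rewrite h4 mul1r|ring].
rewrite -(mulr0 4^-1); apply: near_val_scale; rewrite -(subr0 0).
apply: near_valD; last apply: near_valN; apply: near_val_sqr0.
  by rewrite -(addr0 0); exact: near_valD.
by rewrite -(subr0 0); apply: near_valD => //; exact: near_valN.
Qed.

(** Subtracting the values leaves a product of two infinitesimals, which polarization reduces to the
    square case. *)
Lemma near_valM a b x y : near_val a x -> near_val b y -> near_val (a * b) (x * y).
Proof.
move=> na nb.
have na0 : near_val (a - c x) 0.
  by rewrite -(subrr x); apply: near_valD => //; apply: near_valN; exact: near_val_cst.
have nb0 : near_val (b - c y) 0.
  by rewrite -(subrr y); apply: near_valD => //; apply: near_valN; exact: near_val_cst.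
have -> : a * b = (a - c x) * (b - c y) + c x * b + c y * (a - c x) by ring.
have -> : x * y = 0 + x * y + y * 0 by ring.
apply: near_valD; last exact: near_val_scale.
by apply: near_valD; [exact: near_val0M|exact: near_val_scale].
Qed.

Lemma near_val_unique a x y : near_val a x -> near_val a y -> x = y.
Proof.
have [_ QD _] := qQ.
have le u v : near_val a u -> near_val a v -> u <= v.
  move=> nu nv; apply/ler_addgt0Pr => e e0.
  have e2 : 0 < e / 2 by rewrite divr_gt0.
  have [u1 _] := nu _ e2; have [_ v2] := nv _ e2.
  have := QD _ _ u1 v2.
  have -> : a - c u + c (e / 2) + (c v - a + c (e / 2)) = c (v + (e / 2 + e / 2) - u).
    by rewrite !(rmorphD, rmorphB); ring.
  by move=> /qmodule_cst_ge0; rewrite -splitr subr_ge0.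
by move=> nx ny; apply/eqP; rewrite eq_le !le.
Qed.

End MaximalQuadraticModule.

(* A maximal quadratic module [Q] extending [M - sumsq * f] would yield a point
   where [f <= 0]; so [p * f = 1 + q] for some [p] in [sumsq] and [q] in [M].
   The set of [r >= 0] with [f + r] in [M] is then stable under subtracting [k^-2]:
   [k^2 (f + r) - 1 = (k-p)^2 (f+r) + 2k (pf - 1) + r p (2k - p) + (2k - 1 - p^2 f)]. *)
Theorem archimedean_positivstellensatz (M : set A) f :
  qmodule M -> (forall a, exists N, M (c N - a)) ->
  (forall h : A -> R, (forall a b, h (a + b) = h a + h b) ->
     (forall a b, h (a * b) = h a * h b) -> (forall r, h (c r) = r) ->
     (forall m, M m -> 0 <= h m) -> 0 < h f) ->
  M f.
Proof.
move=> qM March Mpos; have [M1 MD MM] := qM.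
have [p [q [sp Mq pf]]] : exists p q, [/\ sumsq p, M q & p * f = 1 + q].
  have qM' := qmodule_adjoin (- f) qM.
  apply: contrapT => npq.
  have [|Q [qQ sQ Qn1 Qmax]] := maximal_qmodule qM'.
    move=> [q [p [Mq sp e]]]; apply: npq; exists p, q; split=> //.
    by move/eqP: e; rewrite -subr_eq0 => /eqP e; rewrite -[RHS]addr0 -e; ring.
  have MQ : M `<=` Q.
    move=> x Mx; apply: sQ; exists x, 0; split=> //; last by rewrite mul0r addr0.
    exact: qmodule0 sumsq_qmodule.
  have Qarch a : exists N, Q (c N - a) by have [N MN] := March a; exists N; exact: MQ.
  have [h hP] := choice (near_val_exists qQ Qn1 Qmax Qarch).
  have uni := near_val_unique qQ Qn1.
  have hf : 0 < h f.
    apply: Mpos => [a b|a b|r|m /MQ Qm].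
    - by apply: uni (hP _) _; exact: near_valD.
    - by apply: uni (hP _) _; exact: near_valM.
    - by apply: uni (hP _) _; exact: near_val_cst.
    - exact: near_val_ge0 Qm _.
  have QNf : Q (- f).
    apply: sQ; exists 0, 1; split; [exact: qmodule0| |by rewrite add0r mul1r].
    by case: sumsq_qmodule.
  by have := near_val_ge0 qQ Qn1 QNf (near_valN (hP f)); rewrite oppr_ge0 leNgt hf.
have [N1 MN1] := March p; have [N2 MN2] := March (p ^+ 2 * f).
have Mup a r s : r <= s -> M (c r - a) -> M (c s - a).
  move=> rs /MD/(_ (qmodule_cst qM _))-/(_ (s - r)); rewrite subr_ge0 => /(_ rs).
  by move=> /mem_eq; apply; rewrite rmorphB; ring.
(* Large enough to put both 2k - p and 2k - 1 - p^2 f in [M]. *)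
pose k := 1 + `|N1| + `|N2|.
have k1 : 1 <= k by rewrite /k -addrA lerDl addr_ge0.
have Mk1 : M (c (2 * k) - p).
  by apply: Mup MN1; have := (ler_norm N1, normr_ge0 N1, normr_ge0 N2); rewrite /k => -[[]]; lra.
have Mk2 : M (c (2 * k - 1) - p ^+ 2 * f).
  by apply: Mup MN2; have := (ler_norm N2, normr_ge0 N2, normr_ge0 N1); rewrite /k => -[[]]; lra.
have k0 : 0 < k by apply: lt_le_trans k1.
have step r : 0 <= r -> M (f + c r) -> M (f + c (r - k ^- 2)).
  move=> r0 Mr.
  have kk : c (k ^- 2) * c k ^+ 2 = 1.
    by rewrite -rmorphXn -rmorphM mulVf ?rmorph1 // expf_neq0 // gt_eqF.
  have -> : f + c (r - k ^- 2) = c (k ^- 2) *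
      ((c k - p) ^+ 2 * (f + c r) + c (2 * k) * (p * f - 1)
       + c r * (p * (c (2 * k) - p)) + (c (2 * k - 1) - p ^+ 2 * f)).
    transitivity (c (k ^- 2) * c k ^+ 2 * (f + c r) - c (k ^- 2)).
      by rewrite kk mul1r rmorphB; ring.
    by rewrite !(rmorphM, rmorphB, rmorph1, rmorph_nat); ring.
  apply: qmodule_scale => //; first by rewrite invr_ge0 exprn_ge0 // ltW.
  apply: (MD) => //; apply: (MD); last first.
    by apply: qmodule_scale => //; exact: sumsq_mul.
  apply: (MD); first exact: MM.
  apply: qmodule_scale => //; first by rewrite mulr_ge0 // ltW.
  by rewrite pf addrAC subrr add0r.
have [r0 Mr0] := March (- f); rewrite opprK addrC in Mr0.
have desc (m : nat) : M f \/ M (f + c (r0 - m%:R * k ^- 2)).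
  elim: m => [|m [Mf|IH]]; [by rewrite mul0r subr0; right|by left|].
  have [rm|rm] := leP 0 (r0 - m%:R * k ^- 2).
    right; rewrite -natr1 mulrDl mul1r opprD addrA; exact: step.
  left; suff : M (c 0 - - f) by rewrite rmorph0 sub0r opprK.
  by apply: Mup (ltW rm) _; rewrite opprK addrC.
(* Each descent lowers the offset by k^-2, so at least r0 k^2 of them make it nonpositive. *)
have [//|Mm] := desc (Num.bound `|r0 * k ^+ 2|).
suff : M (c 0 - - f) by rewrite rmorph0 sub0r opprK.
apply: (Mup _ (r0 - (Num.bound `|r0 * k ^+ 2|)%:R * k ^- 2)); last by rewrite opprK addrC.
rewrite subr_le0 ler_pdivlMr ?exprn_gt0 //.
exact: le_trans (ler_norm _) (ltW (archi_boundP (normr_ge0 _))).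
Qed.

End QuadraticModules.

(** * Sparse polynomials and Putinar certificates *)

Section SparsePolynomials.
Variables (R : realType) (n : nat).
Implicit Types (p q h g : SPoly R n) (gens : seq (SPoly R n)) (S : {set 'I_n.+1}) (t : R) (x : 'I_n -> R).

(** Induction over ring generators instead of monomials: evaluation, dependence, derivatives and
    measurability are all compatible with sums and products. *)
Lemma spoly_ind (P : SPoly R n -> Prop) :
  (forall c, P (Cst n c)) -> (forall j, P (Xv R j)) ->
  (forall p q, P p -> P q -> P (p + q)) ->
  (forall p q, P p -> P q -> P (p * q)) -> forall p, P p.
Proof.
move=> PC PX PD PM; elim/mpoly.mpolyind => [|c m p _ _ Pp].
  by rewrite -(mpoly.mpolyC0 n.+1 R); exact: PC.
apply: (PD) => //; rewrite -mpoly.mul_mpolyC; apply: (PM); first exact: PC.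
have P1 : P 1 by rewrite -(mpoly.mpolyC1 n.+1 R); exact: PC.
rewrite mpoly.mpolyXE_id; apply: big_ind => // j _.
elim: (fun_of_multinom _ _) => [|k IH]; first by rewrite expr0.
by rewrite exprS; apply: (PM) => //; exact: PX.
Qed.

Lemma evD p q t x : ev (p + q) t x = ev p t x + ev q t x.
Proof. exact: mpoly.mevalD. Qed.
Lemma evM p q t x : ev (p * q) t x = ev p t x * ev q t x.
Proof. exact: mpoly.mevalM. Qed.
Lemma evN p t x : ev (- p) t x = - ev p t x.
Proof. exact: mpoly.mevalN. Qed.
Lemma evB p q t x : ev (p - q) t x = ev p t x - ev q t x.
Proof. exact: mpoly.mevalB. Qed.
Lemma evX p k t x : ev (p ^+ k) t x = ev p t x ^+ k.
Proof. by rewrite /ev rmorphXn. Qed.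
Lemma evC c t x : ev (Cst n c) t x = c.
Proof. exact: mpoly.mevalC. Qed.
Lemma ev1 t x : ev (1 : SPoly R n) t x = 1.
Proof. exact: mpoly.meval1. Qed.
Lemma ev_tv t x : ev (Xv R (tv n)) t x = t.
Proof. by rewrite /ev mpoly.mevalXU /pt unlift_none. Qed.
Lemma ev_xv i t x : ev (Xv R (xv i)) t x = x i.
Proof.
rewrite /ev mpoly.mevalXU /pt.
have -> : xv i = lift (tv n) i.
  by apply: val_inj => /=; rewrite /bump leqNgt ltn_ord.
by rewrite liftK.
Qed.
Lemma ev_sum I (r : seq I) (P : pred I) (F : I -> SPoly R n) t x :
  ev (\sum_(i <- r | P i) F i) t x = \sum_(i <- r | P i) ev (F i) t x.
Proof. exact: raddf_sum. Qed.

Lemma ord_tvxvP (j : 'I_n.+1) : j = tv n \/ exists i, j = xv i.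
Proof.
have [->|jt] := eqVneq j (tv n); first by left.
right; have jn : (j < n)%N.
  by rewrite ltn_neqAle -ltnS ltn_ord andbT; apply: contra jt => /eqP jt; apply/eqP/val_inj.
by exists (Ordinal jn); apply: val_inj.
Qed.

Lemma tv_xv i : (xv i == tv n) = false.
Proof. by apply/negbTE; rewrite -val_eqE /= ltn_eqF. Qed.

Lemma xv_inj : injective (@xv n).
Proof. by move=> i j /(congr1 val) /= ij; apply: val_inj. Qed.

Lemma depbD p q j : depb (p + q) j -> depb p j || depb q j.
Proof.
move=> /hasP[m /mpoly.msuppD_le]; rewrite mem_cat => /orP[mp|mq] m0.
  by apply/orP; left; apply/hasP; exists m.
by apply/orP; right; apply/hasP; exists m.
Qed.

Lemma depbM p q j : depb (p * q) j -> depb p j || depb q j.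
Proof.
move=> /hasP[m /mpoly.msuppM_le /allpairsP[[m1 m2] /= [mp mq ->]]].
have -> : tnth (multinom_val (m1 + m2)%MM) j = (m1 j + m2 j)%N by rewrite -mpoly.mnmDE.
rewrite addn_gt0 => /orP[h|h]; apply/orP; [left|right]; apply/hasP.
  by exists m1.
by exists m2.
Qed.

Lemma dep_onlyD S p q : dep_only S p -> dep_only S q -> dep_only S (p + q).
Proof.
move=> dp dq j jS; apply/negP => /depbD.
by rewrite (negbTE (dp _ jS)) (negbTE (dq _ jS)).
Qed.

Lemma dep_onlyM S p q : dep_only S p -> dep_only S q -> dep_only S (p * q).
Proof.
move=> dp dq j jS; apply/negP => /depbM.
by rewrite (negbTE (dp _ jS)) (negbTE (dq _ jS)).
Qed.

Lemma dep_onlyC S (c : R) : dep_only S (Cst n c).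
Proof.
move=> j _; apply/negP => /hasP[m]; rewrite mpoly.msuppC; case: ifP => // _.
by rewrite inE => /eqP ->; rewrite -/(fun_of_multinom _ _) mpoly.mnm0E.
Qed.

Lemma dep_onlyXv S j : j \in S -> dep_only S (Xv R j).
Proof.
move=> jS k kS; apply/negP => /hasP[m]; rewrite mpoly.msuppX inE => /eqP ->.
rewrite -/(fun_of_multinom _ _) mpoly.mnm1E; case: eqP => // jk _.
by rewrite -jk jS in kS.
Qed.

Lemma dep_only0 S : dep_only S (0 : SPoly R n).
Proof. by rewrite -(mpoly.mpolyC0 n.+1 R); exact: dep_onlyC. Qed.

Lemma dep_only1 S : dep_only S (1 : SPoly R n).
Proof. by rewrite -(mpoly.mpolyC1 n.+1 R); exact: dep_onlyC. Qed.

Lemma dep_onlyN S p : dep_only S p -> dep_only S (- p).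
Proof.
move=> dp; rewrite -mulN1r; apply: dep_onlyM => //.
by rewrite -(mpoly.mpolyC1 n.+1 R) -mpoly.mpolyCN; exact: dep_onlyC.
Qed.

Lemma dep_onlyB S p q : dep_only S p -> dep_only S q -> dep_only S (p - q).
Proof. by move=> dp dq; apply: dep_onlyD => //; exact: dep_onlyN. Qed.

Lemma dep_onlyX S p k : dep_only S p -> dep_only S (p ^+ k).
Proof.
move=> dp; elim: k => [|k IH]; first by rewrite expr0; exact: dep_only1.
by rewrite exprS; exact: dep_onlyM.
Qed.

Lemma dep_only_sum S I (r : seq I) (P : pred I) (F : I -> SPoly R n) :
  (forall i, P i -> dep_only S (F i)) -> dep_only S (\sum_(i <- r | P i) F i).
Proof. by move=> dF; apply: big_ind => //; [exact: dep_only0|exact: dep_onlyD]. Qed.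

Lemma dep_only_sub S S' p : S \subset S' -> dep_only S p -> dep_only S' p.
Proof. by move=> sS dp j jS; apply: dp; apply: contra jS; exact: (fintype.subsetP sS). Qed.

(** Setting the variables outside [S] to 0 is a ring morphism that fixes exactly the polynomials in
    [S]. A statement about these is proved for [proj S p] by induction on an arbitrary [p], since
    [dep_only] is not inherited by the summands of a polynomial. *)
Definition proj S p : SPoly R n :=
  mpoly.comp_mpoly [tuple (if j \in S then Xv R j else 0) | j < n.+1] p.

Lemma projD S p q : proj S (p + q) = proj S p + proj S q.
Proof. exact: raddfD. Qed.
Lemma projM S p q : proj S (p * q) = proj S p * proj S q.
Proof. exact: rmorphM. Qed.
Lemma projX S p k : proj S (p ^+ k) = proj S p ^+ k.
Proof. exact: rmorphXn. Qed.
Lemma projN S p : proj S (- p) = - proj S p.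
Proof. exact: raddfN. Qed.
Lemma projXv S j : proj S (Xv R j) = if j \in S then Xv R j else 0.
Proof. by rewrite /proj mpoly.comp_mpolyXU -tnth_nth tnth_mktuple. Qed.

Lemma proj_id S p : dep_only S p -> proj S p = p.
Proof.
move=> dp; rewrite /proj mpoly.comp_mpolyE [RHS]mpoly.mpolyE.
apply: eq_big_seq => m mp; congr (_ *: _); rewrite mpoly.mpolyXE_id.
apply: eq_bigr => j _; rewrite tnth_mktuple; case: ifPn => // jS.
suff -> : m j = 0%N by rewrite !expr0.
apply/eqP; rewrite -leqn0 leqNgt; apply: contra (dp j jS) => mj.
by apply/hasP; exists m.
Qed.

Lemma dep_only_proj S p : dep_only S (proj S p).
Proof.
elim/spoly_ind: p => [c|j|p q dp dq|p q dp dq].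
- by rewrite /proj mpoly.comp_mpolyC; exact: dep_onlyC.
- by rewrite projXv; case: ifPn => [|_]; [exact: dep_onlyXv|exact: dep_only0].
- by rewrite projD; exact: dep_onlyD.
- by rewrite projM; exact: dep_onlyM.
Qed.

Lemma meval_proj S p z :
  mpoly.meval z (proj S p) = mpoly.meval (fun j => if j \in S then z j else 0) p.
Proof.
rewrite /proj mpoly.comp_mpoly_meval; apply: mpoly.meval_eq => j.
by rewrite tnth_mktuple; case: ifP => _; [exact: mpoly.mevalXU|exact: mpoly.meval0].
Qed.

Lemma deg_le_msize p : deg_le (mpoly.msize p) p.
Proof. by apply/allP => m /mpoly.msize_mdeg_lt /ltnW. Qed.

Lemma deg_le_mono k k' p : (k <= k')%N -> deg_le k p -> deg_le k' p.
Proof. by move=> kk /allP dp; apply/allP => m /dp /leq_trans; apply. Qed.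

Lemma deg_leD k p q : deg_le k p -> deg_le k q -> deg_le k (p + q).
Proof.
move=> /allP dp /allP dq; apply/allP => m /mpoly.msuppD_le.
by rewrite mem_cat => /orP[/dp|/dq].
Qed.

Lemma deg_le0 k : deg_le k (0 : SPoly R n).
Proof. by rewrite /deg_le mpoly.msupp0. Qed.

Lemma sosD S p q : sos S p -> sos S q -> sos S (p + q).
Proof.
move=> [ps [dp ->]] [qs [dq ->]]; exists (ps ++ qs); split; last by rewrite big_cat.
move=> i; rewrite size_cat nth_cat; case: (ltnP i (size ps)) => [ip _|pi ipq]; first exact: dp.
by apply: dq; rewrite ltn_subLR.
Qed.

Lemma sos0 S : sos S (0 : SPoly R n).
Proof. by exists [::]; split => //; rewrite big_nil. Qed.

Lemma sos_sqr S p : dep_only S p -> sos S (p ^+ 2).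
Proof.
by move=> dp; exists [:: p]; split; [case|rewrite big_seq1].
Qed.

Lemma qmod_mono k k' S gens h : (k <= k')%N -> qmod k S gens h -> qmod k' S gens h.
Proof.
move=> kk [s0 [s [ss0 ds0 ss ->]]]; exists s0, s; split=> //.
  exact: deg_le_mono ds0.
by move=> i; have [? ?] := ss i; split=> //; exact: deg_le_mono kk _.
Qed.

Lemma qmodD k S gens h h' :
  qmod k S gens h -> qmod k S gens h' -> qmod k S gens (h + h').
Proof.
move=> [s0 [s [ss0 ds0 ss ->]]] [s0' [s' [ss0' ds0' ss' ->]]].
exists (s0 + s0'), (fun i => s i + s' i); split.
- exact: sosD.
- exact: deg_leD.
- move=> i; have [? ?] := ss i; have [? ?] := ss' i; split; first exact: sosD.
  by rewrite mulrDl; exact: deg_leD.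
- under [in RHS]eq_bigr do rewrite mulrDl.
  by rewrite big_split /= addrACA.
Qed.

(** The quadratic module without degree bounds and with squares in all variables. Lists of single
    terms are easy to manipulate; [qmod] groups them by generator. *)
Inductive qgen (gens : seq (SPoly R n)) : SPoly R n -> Prop :=
| qgen0 : qgen gens 0
| qgen_sqr p h : qgen gens h -> qgen gens (p ^+ 2 + h)
| qgen_mul p g h : g \in gens -> qgen gens h -> qgen gens (p ^+ 2 * g + h).

Lemma qgenD gens h h' : qgen gens h -> qgen gens h' -> qgen gens (h + h').
Proof.
move=> qh qh'; elim: qh => [|p g _ IH|p g k gg _ IH]; first by rewrite add0r.
  by rewrite -addrA; exact: qgen_sqr.
by rewrite -addrA; exact: qgen_mul.
Qed.

Lemma qgen_qmodule gens : qmodule (qgen gens).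
Proof.
split=> [|h h'|a h qh]; first by rewrite -(expr1n _ 2) -[_ ^+ 2]addr0; apply: qgen_sqr; exact: qgen0.
  exact: qgenD.
elim: qh => [|p g _ IH|p g k gg _ IH]; first by rewrite mulr0; exact: qgen0.
  by rewrite mulrDr -exprMn; exact: qgen_sqr.
by rewrite mulrDr mulrA -exprMn; exact: qgen_mul.
Qed.

Lemma qgen_mem gens g : g \in gens -> qgen gens g.
Proof.
move=> gg; rewrite -[g]mul1r -(expr1n _ 2) -[_ * g]addr0.
by apply: qgen_mul => //; exact: qgen0.
Qed.

Lemma qgen_sub gens gens' h : {subset gens <= gens'} -> qgen gens h -> qgen gens' h.
Proof.
move=> sub; elim=> [|p g _ IH|p g k gg _ IH]; first exact: qgen0.
  exact: qgen_sqr.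
by apply: qgen_mul => //; exact: sub.
Qed.

(** The morphism [proj S] turns a certificate in all variables into one in [S]. It consists of
    finitely many terms, so a common degree bound exists. *)
Lemma qgen_proj_qmod S gens gens' h :
  (forall g, g \in gens -> dep_only S g) -> (forall g, g \in gens' -> proj S g = 0) ->
  qgen (gens ++ gens') h -> exists k, qmod k S gens (proj S h).
Proof.
move=> dgens pgens'.
elim=> [|p g _ [k IH]|p g h' gg _ [k IH]].
- exists 0%N; rewrite /proj raddf0; exists 0, (fun=> 0); split.
  + exact: sos0. + exact: deg_le0.
  + by move=> i; split; [exact: sos0|rewrite mul0r; exact: deg_le0].
  + by rewrite big1 ?addr0 // => i _; rewrite mul0r.
- rewrite projD projX.
  exists (maxn k (mpoly.msize (proj S p ^+ 2))); apply: qmodD; last first.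
    by apply: qmod_mono IH; exact: leq_maxl.
  exists (proj S p ^+ 2), (fun=> 0); split.
  + by apply: sos_sqr; exact: dep_only_proj.
  + by apply: deg_le_mono (deg_le_msize _); exact: leq_maxr.
  + by move=> i; split; [exact: sos0|rewrite mul0r; exact: deg_le0].
  + by rewrite big1 ?addr0 // => i _; rewrite mul0r.
- rewrite projD projM projX.
  move: gg; rewrite mem_cat => /orP[gg|/pgens' ->]; last first.
    by rewrite mulr0 add0r; exists k.
  rewrite (proj_id (dgens _ gg)).
  exists (maxn k (mpoly.msize (proj S p ^+ 2 * g))); apply: qmodD; last first.
    by apply: qmod_mono IH; exact: leq_maxl.
  have ig : (index g gens < size gens)%N by rewrite index_mem.
  exists 0, (fun i => if i == Ordinal ig then proj S p ^+ 2 else 0); split.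
  + exact: sos0. + exact: deg_le0.
  + move=> i; case: eqP => [->|_].
      split; first by apply: sos_sqr; exact: dep_only_proj.
      by rewrite /= nth_index //; apply: deg_le_mono (deg_le_msize _); exact: leq_maxr.
    by split; [exact: sos0|rewrite mul0r; exact: deg_le0].
  + rewrite (bigD1 (Ordinal ig)) //= eqxx nth_index // big1 ?addr0 ?add0r // => i /negPf ->.
    by rewrite mul0r.
Qed.

(* The values of the variables outside [S] are forced to [0] by the additional
   generators [- X_j ^ 2], which vanish under [proj S]. *)
Theorem putinar S gens h :
  (forall g, g \in gens -> dep_only S g) -> dep_only S h ->
  (forall j, j \in S -> exists N, qgen gens (Cst n N - Xv R j ^+ 2)) ->
  (forall z, (forall j, j \notin S -> z j = 0) ->
     (forall g, g \in gens -> 0 <= mpoly.meval z g) -> 0 < mpoly.meval z h) ->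
  exists k, qmod k S gens h.
Proof.
move=> dgens dh arch pos.
pose gens' := [seq - Xv R j ^+ 2 | j <- enum (~: S)].
rewrite -(proj_id dh); apply: (@qgen_proj_qmod _ _ gens') => //.
  move=> g /mapP[j]; rewrite mem_enum inE => /negbTE jS ->.
  by rewrite projN projX projXv jS expr0n oppr0.
have qM := qgen_qmodule (gens ++ gens').
have [M1 MD MM] := qM.
have Mc r : 0 <= r -> qgen (gens ++ gens') (Cst n r).
  exact: (@qmodule_cst _ _ (mpoly.mpolyC n.+1 (R:=R))).
have Msc r a : 0 <= r -> qgen (gens ++ gens') a -> qgen (gens ++ gens') (Cst n r * a).
  exact: (@qmodule_scale _ _ (mpoly.mpolyC n.+1 (R:=R))).
have CD a b : Cst n (a + b) = Cst n a + Cst n b :> SPoly R n by exact: mpoly.mpolyCD.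
have CM a b : Cst n (a * b) = Cst n a * Cst n b :> SPoly R n by exact: mpoly.mpolyCM.
have C1 : Cst n 1 = 1 :> SPoly R n by exact: mpoly.mpolyC1.
(* The Archimedean property spreads from the variables to all polynomials when stated as a bound on
   squares, a form stable under sums and products. *)
have bnd a : exists2 N, 0 <= N & qgen (gens ++ gens') (Cst n N - a ^+ 2).
  elim/spoly_ind: a => [c|j|p q [N N0 Mp] [N' N'0 Mq]|p q [N N0 Mp] [N' N'0 Mq]].
  - exists (c ^+ 2); first exact: sqr_ge0.
    rewrite expr2 CM -expr2 subrr; exact: qmodule0.
  - have [jS|jS] := boolP (j \in S).
      have [N MN] := arch _ jS; exists `|N| => //.
      have -> : Cst n `|N| - Xv R j ^+ 2 = Cst n (`|N| - N) + (Cst n N - Xv R j ^+ 2).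
        by rewrite addrA -CD subrK.
      apply: (MD); first by apply: Mc; rewrite subr_ge0 ler_norm.
      by apply: qgen_sub MN => g; rewrite mem_cat => ->.
    exists 0 => //; rewrite /Cst mpoly.mpolyC0 add0r; apply: qgen_mem.
    by rewrite mem_cat; apply/orP; right; apply/mapP; exists j => //; rewrite mem_enum inE.
  - exists (2 * N + 2 * N'); first by rewrite addr_ge0 // mulr_ge0.
    have C2 : Cst n 2 = 2 :> SPoly R n by rewrite -[2]/(1 + 1) CD C1.
    have -> : Cst n (2 * N + 2 * N') - (p + q) ^+ 2 = Cst n 2 * (Cst n N - p ^+ 2) +
        Cst n 2 * (Cst n N' - q ^+ 2) + (p - q) ^+ 2.
      by rewrite CD !CM C2; ring.
    by apply: (MD); [apply: (MD); apply: Msc|exact: qmodule_sqr].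
  - exists (N * N'); first exact: mulr_ge0.
    have -> : Cst n (N * N') - (p * q) ^+ 2 =
        Cst n N * (Cst n N' - q ^+ 2) + q ^+ 2 * (Cst n N - p ^+ 2) by rewrite CM; ring.
    by apply: (MD); [exact: Msc|exact: MM].
apply: (@archimedean_positivstellensatz _ _ (mpoly.mpolyC n.+1 (R:=R)) (qgen (gens ++ gens'))) => //.
  (* From squares to first powers: N + 1/4 - a = (N - a^2) + (a - 1/2)^2. *)
  move=> a; have [N N0 MN] := bnd a; exists (N + 4^-1).
  have -> : mpoly.mpolyC n.+1 (N + 4^-1) - a =
      (Cst n N - a ^+ 2) + (a - Cst n 2^-1) ^+ 2 :> SPoly R n.
    rewrite -/(Cst n _) CD.
    have -> : (4^-1 : R) = 2^-1 * 2^-1 by rewrite -invfM -natrM.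
    have h2 : 2 * Cst n 2^-1 = 1 :> SPoly R n.
      by rewrite mulr2n mulrDl mul1r -CD -C1; congr (Cst n _); lra.
    by rewrite CM; transitivity (Cst n N + Cst n 2^-1 * Cst n 2^-1 - (2 * Cst n 2^-1) * a);
      [rewrite h2 mul1r|ring].
  by apply: (MD) => //; exact: qmodule_sqr.
move=> f fD fM fC fpos.
(* A ring homomorphism fixing the constants is evaluation at the images of the variables. *)
have fE p : f p = mpoly.meval (fun j => f (Xv R j)) p.
  elim/spoly_ind: p => [c|j|p q fp fq|p q fp fq].
  - by rewrite [RHS]mpoly.mevalC -[RHS]fC.
  - by rewrite [RHS]mpoly.mevalXU.
  - by rewrite fD fp fq mpoly.mevalD.
  - by rewrite fM fp fq mpoly.mevalM.
rewrite fE; apply: pos => [j jS|g gg].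
  have f0 : f 0 = 0 by rewrite -(mpoly.mpolyC0 n.+1 R) fC.
  have fN : f (- Xv R j ^+ 2) = - (f (Xv R j)) ^+ 2.
    apply/eqP; rewrite -addr_eq0 [f _ ^+ 2]expr2 -fM -fD; apply/eqP.
    by rewrite -[X in _ = X]f0 -[_ * Xv R j]expr2 addNr.
  have : 0 <= f (- Xv R j ^+ 2).
    apply: fpos; apply: qgen_mem.
    by rewrite mem_cat; apply/orP; right; apply/mapP; exists j => //; rewrite mem_enum inE.
  rewrite fN oppr_ge0 => h0; apply/eqP; rewrite -sqrf_eq0 eq_le h0.
  exact: sqr_ge0.
by rewrite -fE; apply: fpos; apply: qgen_mem; rewrite mem_cat gg.
Qed.

End SparsePolynomials.

(** * Uniform polynomial approximation *)

Section UnivariatePolynomials.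
Variable R : realType.
Implicit Types (P Q : {poly R}) (a b c e s t C K : R).

Lemma horner_bounded P C : exists2 B, 0 <= B & forall t, `|t| <= C -> `|P.[t]| <= B.
Proof.
elim/poly_ind: P => [|P c [B B0 HB]].
  by exists 0 => // t _; rewrite horner0 normr0.
exists (B * `|C| + `|c|); first by rewrite addr_ge0 ?mulr_ge0.
move=> t tC; rewrite !hornerE; apply: le_trans (ler_normD _ _) _.
rewrite normrM lerD2r ler_pM //; first exact: HB.
exact: le_trans tC (ler_norm _).
Qed.

Lemma poly_mvt P a b c K : a <= b ->
  (forall u, a <= u <= b -> `|P^`().[u] - c| <= K) ->
  `|P.[b] - P.[a] - c * (b - a)| <= K * (b - a).
Proof.
move=> ab HK.
have [|u] := @MVT_segment R (horner P) (horner P^`()) a b ab.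
  by apply: continuous_subspaceT; exact: continuous_horner.
rewrite in_itv /= => uab ->.
rewrite -mulrBl normrM (ger0_norm (x := b - a)) ?subr_ge0 //.
by rewrite ler_wpM2r ?subr_ge0 // HK.
Qed.

Lemma poly_homo P a b : a <= b -> (forall u, a <= u <= b -> 0 <= P^`().[u]) ->
  P.[a] <= P.[b].
Proof.
move=> ab HP.
have [|u] := @MVT_segment R (horner P) (horner P^`()) a b ab.
  by apply: continuous_subspaceT; exact: continuous_horner.
rewrite in_itv /= => uab; rewrite -subr_ge0 => ->.
by rewrite mulr_ge0 ?subr_ge0 // HP.
Qed.

(** [Q + P] and [Q - P] are nondecreasing. This takes the place of integrating a differential
    inequality in the Picard estimate. *)
Lemma poly_comparison P Q a t : a <= t ->
  (forall u, a <= u <= t -> `|P^`().[u]| <= Q^`().[u]) -> `|P.[a]| <= Q.[a] ->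
  `|P.[t]| <= Q.[t].
Proof.
move=> at_ HPQ; rewrite !ler_norml => /andP[Pa1 Pa2].
have [h1 h2] : (Q + P).[a] <= (Q + P).[t] /\ (Q - P).[a] <= (Q - P).[t].
  split; apply: poly_homo => // u /HPQ; rewrite ler_norml => /andP[? ?].
    by rewrite derivD hornerD; lra.
  by rewrite derivB hornerD hornerN; lra.
by move: h1 h2; rewrite !hornerE => h1 h2; apply/andP; split; lra.
Qed.

Definition primitive P : {poly R} := \poly_(i < (size P).+1) (P`_i.-1 / i%:R).

Lemma deriv_primitive P : (primitive P)^`() = P.
Proof.
apply/polyP => i; rewrite coef_deriv coef_poly /= ltnS.
have [iP|iP] := ltnP i (size P); last by rewrite mul0rn nth_default.
by rewrite -[LHS]mulr_natr divfK // pnatr_eq0.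
Qed.

Lemma primitive0 P : (primitive P).[0] = 0.
Proof. by rewrite horner_coef0 coef_poly /= invr0 mulr0. Qed.

Lemma expr2N_small K e : 0 < e -> exists m : nat, K * 2 ^- m <= e.
Proof.
move=> e0; exists (Num.bound `|K / e|).
rewrite ler_pdivrMr ?exprn_gt0 // mulrC -ler_pdivrMr //.
apply: le_trans (ler_norm _) _; apply: le_trans (ltW (archi_boundP (normr_ge0 _))) _.
by rewrite -natrX ler_nat ltnW // ltn_expl.
Qed.

(* Newton-like iteration for the square root of ['X ^+ 2]: with [u = `|s|] and
   error [e = u - p.[s]] it maps [e] to [e * (1 - u + e / 2) <= e * (1 - e / 2)]. *)
Fixpoint abs_iter (k : nat) : {poly R} :=
  if k is k'.+1 then abs_iter k' + 2^-1 *: ('X ^+ 2 - abs_iter k' ^+ 2) else 0.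

Lemma abs_iterP k s : `|s| <= 1 -> 0 <= `|s| - (abs_iter k).[s] <= 2 / (k + 2)%:R.
Proof.
move=> s1; have sq : s ^+ 2 = `|s| ^+ 2 by rewrite real_normK // num_real.
have u0 := normr_ge0 s.
suff : 0 <= (abs_iter k).[s] /\ 0 <= `|s| - (abs_iter k).[s] <= 2 / (k + 2)%:R by case.
elim: k => [|k [p0 /andP[e0 e1]]].
  rewrite /= horner0 subr0 add0n divff ?pnatr_eq0 //; split=> //.
  by rewrite u0.
rewrite /= !hornerE sq; set p := (abs_iter k).[s] in p0 e0 e1 *; set u := `|s| in s1 u0 e0 e1 *.
have pu : p <= u by rewrite -subr_ge0.
have u2p2 : 0 <= u ^+ 2 - p ^+ 2 by rewrite subr_ge0 lerXn2r // nnegrE.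
split; first by rewrite addr_ge0 // mulr_ge0 // invr_ge0.
have -> : u - (p + 2^-1 * (u ^+ 2 - p ^+ 2)) = (u - p) * (1 - (u + p) / 2) by field.
apply/andP; split; first by apply: mulr_ge0 => //; lra.
set a := 2 / (k + 2)%:R in e1.
(* The error bound e (1 - e / 2) is monotone in e only up to e = 1. *)
have a1 : a <= 1.
  by rewrite ler_pdivrMr ?ltr0n ?addn_gt0 ?orbT // mul1r (ler_nat R 2) leq_addl.
have /le_trans -> // : (u - p) * (1 - (u + p) / 2) <= a * (1 - a / 2) by nra.
rewrite /a; have k0 : 0 <= k%:R :> R by [].
rewrite natrD natrD -natr1.
have -> : 2 / (k%:R + 2) * (1 - 2 / (k%:R + 2) / 2) = 2 * (k%:R + 1) / (k%:R + 2) ^+ 2 :> R.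
  by field; rewrite -natrD pnatr_eq0 addn2.
rewrite ler_pdivlMr; last lra.
rewrite mulrAC ler_pdivrMr; last by rewrite exprn_gt0 //; lra.
nra.
Qed.

Lemma abs_approx C e : 0 < e ->
  exists P, forall s, `|s| <= C -> `| `|s| - P.[s]| <= e.
Proof.
move=> e0; pose D := `|C| + 1; have D0 : 0 < D by rewrite /D; have := normr_ge0 C; lra.
have [k Hk] : exists k : nat, 2 * D / e <= k%:R.
  by exists (Num.bound `|2 * D / e|); apply: le_trans (ler_norm _) (ltW (archi_boundP (normr_ge0 _))).
exists (D *: (abs_iter k \Po (D^-1 *: 'X))) => s sC.
rewrite !hornerE horner_comp !hornerE.
have sD : `|D^-1 * s| <= 1.
  rewrite normrM gtr0_norm ?invr_gt0 // mulrC ler_pdivrMr // mul1r.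
  by apply: le_trans sC _; rewrite /D; have := ler_norm C; lra.
have /andP[h0 h1] := abs_iterP k sD.
have -> : `|s| = D * `|D^-1 * s|.
  by rewrite normrM (gtr0_norm (x := D^-1)) ?invr_gt0 // mulrA divff ?mul1r // gt_eqF.
rewrite -mulrBr normrM (gtr0_norm D0) (ger0_norm h0).
apply: le_trans (ler_wpM2l (ltW D0) h1) _.
rewrite mulrA ler_pdivrMr ?ltr0n ?addn2 // (mulrC D) (mulrC e) -ler_pdivrMr //.
by apply: le_trans Hk _; rewrite ler_nat; do 2 apply: leqW.
Qed.

(** * The positive part and its square *)

Definition pospart s : R := (s + `|s|) / 2.

Lemma pospart_ge0 s : 0 <= pospart s.
Proof. by rewrite /pospart; have := lerNnormlW (lexx `|s|); lra. Qed.

Lemma pospart_le0 s : s <= 0 -> pospart s = 0.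
Proof. by move=> s0; rewrite /pospart ler0_norm // subrr mul0r. Qed.

Lemma pospart_pos s : 0 <= s -> pospart s = s.
Proof. by move=> s0; rewrite /pospart ger0_norm //; field. Qed.

Lemma pospart_ge s : s <= pospart s.
Proof. by rewrite /pospart; have := ler_norm s; lra. Qed.

(** The shift by [e / 2] keeps [P] strictly above the positive part: this makes the constraints on
    [w] strict in [separated_feasible] and gives primitives with nonnegative derivative. *)
Lemma pospart_approx C e : 0 < e -> exists P, forall s, `|s| <= C ->
  pospart s < P.[s] <= pospart s + e.
Proof.
move=> e0; have e2 : 0 < e / 2 by rewrite divr_gt0.
have [P HP] := abs_approx C e2.
exists (2^-1 *: ('X + P) + (e / 2)%:P) => s /HP.
by rewrite !hornerE /pospart ler_norml => /andP[]; lra.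
Qed.

(** Taking [q] as a primitive of twice an upper approximation of the positive part controls q'
    together with [q]. The Lie derivative of the barrier contains q', which must be nonnegative and
    must be small at negative arguments. *)
Lemma pospart_sqr_approx C e : 0 <= C -> 0 < e -> exists q, forall s, `|s| <= C ->
  [/\ 0 <= q^`().[s] <= 2 * pospart s + e, pospart s ^+ 2 <= q.[s] &
      q.[s] <= pospart s ^+ 2 + e].
Proof.
(* [P] is accurate to [d / 2], hence q' to [d], and integrating over [-C, C] costs at most 2Cd. *)
move=> C0 e0; pose d := e / (1 + 2 * C); have C1 : 0 < 1 + 2 * C by lra.
have d0 : 0 < d by rewrite divr_gt0.
have dC : d * (1 + 2 * C) = e by rewrite divfK // gt_eqF.
have [P HP] := pospart_approx C (divr_gt0 d0 (ltr0n _ 2)).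
pose q := primitive (2 *: P) - ((primitive (2 *: P)).[- C])%:P.
have qC : q.[- C] = 0 by rewrite !hornerE subrr.
have q' : q^`() = 2 *: P by rewrite derivB derivC subr0 deriv_primitive.
clearbody q.
exists q => s sC; move: (sC); rewrite ler_norml => /andP[s1 s2].
have HP' u : - C <= u <= s -> pospart u < P.[u] <= pospart u + d / 2.
  by move=> /andP[u1 u2]; apply: HP; rewrite ler_norml u1 (le_trans u2).
split.
- rewrite q' hornerZ; have := HP _ sC; have := pospart_ge0 s.
  have : d <= e by rewrite -dC mulrDr mulr1 lerDl; apply: mulr_ge0; [exact: ltW|exact: mulr_ge0].
  by move=> ? ? /andP[? ?]; apply/andP; split; lra.
- have [s0|s0] := leP s 0.
    rewrite pospart_le0 // expr0n /= mulr0n -[X in X <= _]qC; apply: poly_homo => // u /HP'.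
    by rewrite q' hornerZ; have := pospart_ge0 u; move=> ? /andP[? ?]; lra.
  rewrite (pospart_pos (ltW s0)).
  have : (q - 'X ^+ 2).[0] <= (q - 'X ^+ 2).[s].
    apply: poly_homo => [|u /andP[u0 us]]; first exact: ltW.
    have /HP' : - C <= u <= s by rewrite us andbT; lra.
    rewrite derivB q' derivXn !hornerE pospart_pos // => /andP[h _].
    by lra.
  rewrite !hornerE expr0n /= subr0.
  have : q.[- C] <= q.[0].
    apply: poly_homo => [|u /andP[u0 u1]]; first lra.
    have /HP' : - C <= u <= s by rewrite u0 (le_trans u1) // ltW.
    by rewrite q' hornerZ; have := pospart_ge0 u; move=> ? /andP[? ?]; lra.
  rewrite qC; lra.
- have qneg u : - C <= u <= s -> u <= 0 -> q.[u] <= d * C.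
    move=> /andP[Cu us] u0; have : q.[u] <= (d *: ('X + C%:P)).[u].
      rewrite -subr_ge0 -hornerN -hornerD.
      have <- : (d *: ('X + C%:P) - q).[- C] = 0 by rewrite !hornerE qC addNr mulr0 subr0.
      apply: poly_homo => // v /andP[Cv vu]; rewrite derivB derivZ derivD derivX derivC q' !hornerE.
      have /HP' : - C <= v <= s by rewrite Cv (le_trans vu).
      by rewrite pospart_le0 ?(le_trans vu) // => /andP[_]; lra.
    rewrite !hornerE => /le_trans; apply; apply: ler_wpM2l; [exact: ltW|lra].
  have dC2 : d * C + d * C <= e by rewrite -dC; lra.
  have dC0 : 0 <= d * C by rewrite mulr_ge0 // ltW.
  have [s0|s0] := leP s 0.
    rewrite pospart_le0 // expr0n /= mulr0n add0r.
    apply: le_trans (qneg s _ s0) _; [by rewrite s1 lexx|lra].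
  rewrite (pospart_pos (ltW s0)).
  have : ('X ^+ 2 + d *: 'X - q).[0] <= ('X ^+ 2 + d *: 'X - q).[s].
    apply: poly_homo => [|u /andP[u0 us]]; first exact: ltW.
    have /HP' : - C <= u <= s by rewrite us andbT; lra.
    rewrite derivB derivD derivZ derivX q' derivXn !hornerE (pospart_pos u0) => /andP[_].
    lra.
  have q0 : q.[0] <= d * C by apply: qneg => //; rewrite (ltW s0) andbT; lra.
  have : d * s <= d * C by apply: ler_wpM2l => //; exact: ltW.
  rewrite !hornerE expr0n /= mulr0n; lra.
Qed.

(** Stands in for continuity in time: the class contains the polynomials and is closed under sums,
    products and absolute values, hence under clamping. *)
Definition papprox a b (g : R -> R) :=
  forall e, 0 < e -> exists P, forall t, a <= t <= b -> `|g t - P.[t]| <= e.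

Lemma papprox_horner a b P : papprox a b (horner P).
Proof. by move=> e e0; exists P => t _; rewrite subrr normr0 ltW. Qed.

Lemma papprox_bounded a b g : papprox a b g ->
  exists2 B, 0 <= B & forall t, a <= t <= b -> `|g t| <= B.
Proof.
move=> /(_ 1 ltr01)[P HP]; have [B B0 HB] := horner_bounded P (`|a| + `|b|).
exists (1 + B); first lra.
move=> t tab; rewrite -(subrK P.[t] (g t)).
apply: le_trans (ler_normD _ _) _; apply: lerD; first exact: HP.
apply: HB; case/andP: tab => at_ tb; rewrite ler_norml; apply/andP.
have := (lerNnormlW (lexx `|a|), ler_norm b, normr_ge0 a, normr_ge0 b).
by move=> [[[]]]; split; lra.
Qed.

Lemma papproxD a b g h : papprox a b g -> papprox a b h -> papprox a b (fun t => g t + h t).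
Proof.
move=> ag ah e e0; have e2 : 0 < e / 2 by rewrite divr_gt0.
have [P HP] := ag _ e2; have [Q HQ] := ah _ e2.
exists (P + Q) => t tab; rewrite hornerD opprD addrACA (splitr e).
by apply: le_trans (ler_normD _ _) _; rewrite lerD // ?HP ?HQ.
Qed.

Lemma papproxM a b g h : papprox a b g -> papprox a b h -> papprox a b (fun t => g t * h t).
Proof.
move=> ag ah e e0.
have [B B0 HB] := papprox_bounded ag; have [D D0 HD] := papprox_bounded ah.
pose d := Num.min 1 (e / (B + D + 1)).
have S0 : 0 < B + D + 1 by lra.
have d0 : 0 < d by rewrite lt_min ltr01 divr_gt0.
have d1 : d <= 1 by rewrite ge_min lexx.
have de : d * (B + D + 1) <= e by rewrite -ler_pdivlMr // ge_min lexx orbT.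
have [P HP] := ag _ d0; have [Q HQ] := ah _ d0.
exists (P * Q) => t tab; rewrite hornerM.
have -> : g t * h t - P.[t] * Q.[t] = (g t - P.[t]) * h t + g t * (h t - Q.[t])
    - (g t - P.[t]) * (h t - Q.[t]) by ring.
have hD : `|(g t - P.[t]) * h t| <= d * D by rewrite normrM ler_pM ?HP ?HD.
have hB : `|g t * (h t - Q.[t])| <= B * d by rewrite normrM ler_pM ?HQ ?HB.
have h1 : `|(g t - P.[t]) * (h t - Q.[t])| <= d * 1.
  by rewrite normrM ler_pM ?HP // (le_trans (HQ _ tab)).
apply: le_trans de; apply: le_trans (ler_normB _ _) _.
apply: le_trans (lerD (ler_normD _ _) (lexx _)) _; lra.
Qed.

Lemma papprox_norm a b g : papprox a b g -> papprox a b (fun t => `|g t|).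
Proof.
move=> ag e e0; have [B B0 HB] := papprox_bounded ag.
have e2 : 0 < e / 2 by rewrite divr_gt0.
have [P HP] := abs_approx (B + e) e2; have [Q HQ] := ag _ e2.
exists (P \Po Q) => t tab; rewrite horner_comp.
have -> : `|g t| - P.[Q.[t]] = (`|g t| - `|Q.[t]|) + (`|Q.[t]| - P.[Q.[t]]) by ring.
rewrite (splitr e); apply: le_trans (ler_normD _ _) _; apply: lerD.
  by apply: le_trans (ler_dist_dist _ _) _; exact: HQ.
apply: HP; rewrite -(subrK (g t) Q.[t]); apply: le_trans (ler_normD _ _) _.
have := HQ _ tab; have := HB _ tab; rewrite distrC; lra.
Qed.

(** Truncation to [-r, r], written with absolute values so that [papprox_norm] applies and the
    Lipschitz constant 1 is visible. *)
Definition clamp (r x : R) : R := (`|x + r| - `|x - r|) / 2.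

Lemma clamp_norm r x : 0 <= r -> `|clamp r x| <= r.
Proof.
move=> r0; rewrite normrM (ger0_norm (x := 2^-1)) // ler_pdivrMr //.
apply: le_trans (ler_dist_dist _ _) _.
by have -> : x + r - (x - r) = r * 2 by [ring]; rewrite ger0_norm // mulr_ge0.
Qed.

Lemma clamp_id r x : `|x| <= r -> clamp r x = x.
Proof.
rewrite ler_norml => /andP[x1 x2]; rewrite /clamp ger0_norm; last lra.
by rewrite ler0_norm; [field|lra].
Qed.

Lemma clamp_lip r x y : `|clamp r x - clamp r y| <= `|x - y|.
Proof.
rewrite /clamp -mulrBl normrM (ger0_norm (x := 2^-1)) // ler_pdivrMr //.
have -> : `|x + r| - `|x - r| - (`|y + r| - `|y - r|) =
  (`|x + r| - `|y + r|) - (`|x - r| - `|y - r|) by ring.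
apply: le_trans (ler_normB _ _) _; rewrite mulr_natr mulr2n; apply: lerD.
  by apply: le_trans (ler_dist_dist _ _) _; rewrite opprD addrACA subrr addr0.
by apply: le_trans (ler_dist_dist _ _) _; rewrite opprB addrA subrK.
Qed.

Lemma papprox_clamp a b r g : papprox a b g -> papprox a b (fun t => clamp r (g t)).
Proof.
move=> ag; have ac (c : R) : papprox a b (fun=> c).
  by move=> e e0; exists c%:P => t _; rewrite hornerC subrr normr0 ltW.
apply: papproxM => //; apply: papproxD; first exact/papprox_norm/papproxD.
move=> e /(papprox_norm (papproxD ag (ac (- r))))[P HP]; exists (- P) => t /HP.
by rewrite hornerN -opprD normrN.
Qed.

End UnivariatePolynomials.

(** * Polynomial Picard iteration *)

(** The intervals of radius 2D 2^-m around [u m] are nested; the limit is the supremum of their left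
    ends. *)
Lemma geometric_limit (R : realType) (u : nat -> R) (D : R) :
  (forall m, `|u m.+1 - u m| <= D * 2 ^- m) ->
  exists l, forall m, `|u m - l| <= 2 * D * 2 ^- m.
Proof.
move=> Hu; have D0 : 0 <= D.
  by have := le_trans (normr_ge0 _) (Hu 0%N); rewrite expr0 invr1 mulr1.
have half m : 2 ^- m.+1 = 2 ^- m / 2 :> R by rewrite exprS invfM mulrC.
pose a m := u m - 2 * D * 2 ^- m; pose b m := u m + 2 * D * 2 ^- m.
have ha : {homo a : m k / (m <= k)%N >-> m <= k}.
  apply: homo_leq => [//|y x z|m]; first exact: le_trans.
  by rewrite /a half; have := Hu m; rewrite ler_norml => /andP[]; lra.
have hb : {homo b : m k / (m <= k)%N >-> k <= m}.
  apply: (homo_leq (r := fun x y => y <= x)) => [x //|y x z xy yz|m].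
    exact: le_trans yz xy.
  by rewrite /b half; have := Hu m; rewrite ler_norml => /andP[]; lra.
have ab m k : a m <= b k.
  apply: le_trans (ha _ _ (leq_maxl m k)) _; apply: le_trans (hb _ _ (leq_maxr m k)).
  rewrite /a /b lerD2l; apply: le_trans (_ : 0 <= _); rewrite ?oppr_le0 ?mulr_ge0 //.
have supa : has_sup (range a).
  by split; [exists (a 0%N); exists 0%N|exists (b 0%N) => _ [m _ <-]].
exists (sup (range a)) => m.
have am : a m <= sup (range a) by apply: (sup_upper_bound supa); exists m.
have bm : sup (range a) <= b m by apply: ge_sup; [by case: supa|move=> _ [k _ <-]].
by rewrite ler_norml; apply/andP; move: am bm; rewrite /a /b; split; lra.
Qed.

Section Picard.
Variables (R : realType) (n : nat) (T : R) (F : 'I_n -> ('I_n -> R) -> R) (L M : R).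
Hypothesis T0 : 0 <= T.
Hypothesis L0 : 0 <= L.
Hypothesis F_lip : forall i x y, `|F i x - F i y| <= L * \sum_j `|x j - y j|.
Hypothesis F_bounded : forall i x, `|F i x| <= M.
Hypothesis F_approx : forall (psi : 'I_n -> {poly R}) i,
  papprox 0 T (fun t => F i (fun j => (psi j).[t])).

(** A curve with polynomial companions that start exactly at [x0] and nearly solve the equation. The
    companions give the regularity of [phi] in the limit and are the material from which the
    polynomial barrier is made. *)
Definition approx_sol (x0 : 'I_n -> R) (phi : R -> 'I_n -> R) :=
  forall e, 0 < e -> exists psi : 'I_n -> {poly R}, forall i,
    (psi i).[0] = x0 i /\ forall t, 0 <= t <= T ->
      `|(psi i).[t] - phi t i| <= e /\
      `|(psi i)^`().[t] - F i (fun j => (psi j).[t])| <= e.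

Lemma F_lip_sup i x y d : (forall j, `|x j - y j| <= d) ->
  `|F i x - F i y| <= L * (n%:R * d).
Proof.
move=> xy; apply: le_trans (F_lip i x y) _; apply: ler_wpM2l => //.
apply: le_trans (ler_sum _ (fun j _ => xy j)) _.
by rewrite sumr_const card_ord mulr_natl.
Qed.

(** [W] replaces the exponential weight exp (2 (L n + 1) t) by a polynomial: W' / W = k / (t + 1),
    which is at least 2 (L n + 1) on [0, T] by the choice of [k]. *)
Let k := Num.bound `|2 * (L * n%:R + 1) * (1 + T)|.
Let W : {poly R} := ('X + 1) ^+ k.

Let W_ge1 t : 0 <= t -> 1 <= W.[t].
Proof. by move=> t0; rewrite /W !hornerE exprn_ege1 // lerDr. Qed.

Let W_le t : 0 <= t <= T -> W.[t] <= W.[T].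
Proof.
move=> /andP[t0 tT]; rewrite /W !hornerE lerXn2r ?nnegrE ?lerD2r //; lra.
Qed.

Let W_deriv t : 0 <= t <= T -> 2 * (L * n%:R + 1) * W.[t] <= W^`().[t].
Proof.
move=> /andP[t0 tT].
have hk : 2 * (L * n%:R + 1) * (1 + T) <= k%:R.
  exact: le_trans (ler_norm _) (ltW (archi_boundP (normr_ge0 _))).
have Ln : 0 <= L * n%:R by rewrite mulr_ge0.
have t1 : 0 < t + 1 by lra.
have k0 : (0 < k)%N.
  by rewrite -(ltr0n R); apply: lt_le_trans hk; apply: mulr_gt0; lra.
rewrite /W deriv_exp derivD derivX derivC addr0 mul1r hornerMn !hornerE.
rewrite -[X in _ * _ ^+ X](prednK k0) exprS mulrA -[leRHS]mulr_natl.
apply: ler_wpM2r; first by rewrite exprn_ge0 // ltW.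
apply: le_trans hk; apply: ler_wpM2l; lra.
Qed.

Lemma picard_step (x0 : 'I_n -> R) (psi : 'I_n -> {poly R}) e : 0 < e ->
  exists psi' : 'I_n -> {poly R}, forall i, (psi' i).[0] = x0 i /\
    forall t, 0 <= t <= T ->
      `|(psi' i)^`().[t] - F i (fun j => (psi j).[t])| <= e.
Proof.
move=> e0.
have /choice[P HP] i := F_approx psi i e0.
exists (fun i => primitive (P i) + (x0 i)%:P) => i; split.
  by rewrite hornerD primitive0 hornerC add0r.
by move=> t tT; rewrite derivD derivC addr0 deriv_primitive distrC; exact: HP.
Qed.

Theorem picard x0 : exists phi, approx_sol x0 phi.
Proof.
have /choice[step stepP] (a : nat * ('I_n -> {poly R})) :
    exists psi' : 'I_n -> {poly R}, forall i, (psi' i).[0] = x0 i /\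
    forall t, 0 <= t <= T ->
      `|(psi' i)^`().[t] - F i (fun j => (a.2 j).[t])| <= 2 ^- a.1.
  by apply: picard_step; rewrite invr_gt0 exprn_gt0.
pose psi := fix psi m : 'I_n -> {poly R} :=
  if m is m'.+1 then step (m', psi m') else fun i => (x0 i)%:P.
have psi0 m i : (psi m i).[0] = x0 i.
  by case: m => [|m] /=; [rewrite hornerC|case: (stepP (m, psi m) i)].
have psiS m i t : 0 <= t <= T ->
    `|(psi m.+1 i)^`().[t] - F i (fun j => (psi m j).[t])| <= 2 ^- m.
  by move=> tT /=; have [_] := stepP (m, psi m) i; apply.
have half m : 2 ^- m.+1 = 2 ^- m / 2 :> R by rewrite exprS invfM mulrC.
have p0 m : 0 < 2 ^- m :> R by rewrite invr_gt0 exprn_gt0.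
(* With D >= 2 and W >= 1, the term D 2^-m W exceeds the errors 2^-m and 2^-(m+1) of two successive
   Picard steps; the 1 in L n + 1 makes room for it. *)
have [D D2 HD] : exists2 D : R, 2 <= D &
    forall i t, 0 <= t <= T -> `|(psi 1%N i).[t] - (psi 0%N i).[t]| <= D.
  have /choice[B HB] (i : 'I_n) : exists B, 0 <= B /\ forall t, `|t| <= T ->
      `|(psi 1%N i - psi 0%N i).[t]| <= B.
    by have [B B0 HB] := horner_bounded (psi 1%N i - psi 0%N i) T; exists B.
  have B0 i : 0 <= B i by case: (HB i).
  exists (2 + \sum_i B i); first by rewrite lerDl sumr_ge0.
  move=> i t /andP[t0 tT]; rewrite -hornerN -hornerD.
  have [_ /(_ t)] := HB i; rewrite ger0_norm // => /(_ tT)/le_trans; apply.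
  by rewrite (bigD1 i) //= addrCA lerDl addr_ge0 // sumr_ge0.
have Ln : 0 <= L * n%:R by rewrite mulr_ge0.
(* Contraction in the weighted norm: the Lipschitz bound multiplies by L n, and integrating against
   [W] divides by 2 (L n + 1). *)
have diff m i t : 0 <= t <= T ->
    `|(psi m.+1 i).[t] - (psi m i).[t]| <= D * 2 ^- m * W.[t].
  elim: m i t => [|m IH] i t tT.
    rewrite expr0 invr1 mulr1; apply: le_trans (HD i t tT) _.
    by rewrite ler_peMr ?W_ge1 //; [lra|case/andP: tT].
  rewrite -hornerN -hornerD -hornerZ; have /andP[t0 t1] := tT.
  apply: (poly_comparison t0) => [u /andP[u0 ut]|]; last first.
    rewrite hornerD hornerN !psi0 subrr normr0 hornerZ.
    by apply: mulr_ge0; [apply: mulr_ge0; [lra|exact: ltW]|exact: le_trans ler01 (W_ge1 _)].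
  have uT : 0 <= u <= T by rewrite u0 (le_trans ut).
  rewrite derivB derivZ hornerZ hornerD hornerN half.
  have h1 := psiS m.+1 i u uT; have h2 := psiS m i u uT.
  have h3 : `|F i (fun j => (psi m.+1 j).[u]) - F i (fun j => (psi m j).[u])|
      <= L * (n%:R * (D * 2 ^- m * W.[u])) by apply: F_lip_sup => j; exact: IH.
  have h4 := W_deriv uT; have W1 := W_ge1 u0.
  have {h4} h4 : D * 2 ^- m / 2 * (2 * (L * n%:R + 1) * W.[u]) <= D * 2 ^- m / 2 * W^`().[u].
    by apply: ler_wpM2l => //; have := p0 m; rewrite !mulr_ge0 //; lra.
  have h5 : 2 * 2 ^- m * 1 <= D * 2 ^- m * W.[u].
    by apply: ler_pM => //; apply: ler_pM => //; exact: ltW.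
  rewrite half in h1; move: h1 h2 h3 h4 h5; rewrite !ler_norml !mulrA.
  set A := F i _; set B := F i _.
  move=> /andP[? ?] /andP[? ?] /andP[? ?] ? ?; apply/andP; split; lra.
have WT0 : 1 <= W.[T] by exact: W_ge1.
have lim i t : exists l, 0 <= t <= T ->
    forall m, `|(psi m i).[t] - l| <= 2 * (D * W.[T]) * 2 ^- m.
  have [tT|/negP tT] := boolP (0 <= t <= T); last by exists 0.
  have [|l Hl] := @geometric_limit _ (fun m => (psi m i).[t]) (D * W.[T]).
    move=> m; apply: le_trans (diff m i t tT) _.
    rewrite mulrAC; apply: ler_wpM2r; [exact: ltW|apply: ler_wpM2l; [lra|exact: W_le]].
  by exists l.
have /choice[phi Hphi] (a : R * 'I_n) := lim a.2 a.1.
exists (fun t i => phi (t, i)) => e e0.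
pose K := 2 * (D * W.[T]) + 1 + L * (n%:R * (D * W.[T])).
have DW : 0 <= D * W.[T] by rewrite mulr_ge0 //; lra.
have LnDW : 0 <= L * (n%:R * (D * W.[T])) by rewrite !mulr_ge0 //; lra.
have [m Hm] := expr2N_small K e0.
(* The derivative of [psi m.+1] was made close to the field along [psi m], and the two iterates are
   close to each other. *)
exists (psi m.+1) => i; split=> // t tT; split.
  have := Hphi (t, i) tT m.+1 => /= /le_trans; apply; apply: le_trans Hm.
  rewrite half; have := p0 m; rewrite /K; nra.
have h1 := psiS m i t tT.
have h2 : `|F i (fun j => (psi m.+1 j).[t]) - F i (fun j => (psi m j).[t])|
      <= L * (n%:R * (D * W.[T] * 2 ^- m)).
  apply: F_lip_sup => j; apply: le_trans (diff m j t tT) _.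
  by rewrite mulrAC; apply: ler_wpM2r; [exact: ltW|apply: ler_wpM2l; [lra|exact: W_le]].
apply: le_trans Hm; have := p0 m; move: h1 h2; rewrite !ler_norml /K.
set A := F i _; set B := F i _; move=> /andP[? ?] /andP[? ?] ?.
have : 0 <= 2 * (D * W.[T]) * 2 ^- m by apply: mulr_ge0; [exact: mulr_ge0|exact: ltW].
by move=> ?; apply/andP; split; lra.
Qed.

(** * Regularity of the limit curve *)

Section Solution.
Variables (x0 : 'I_n -> R) (phi : R -> 'I_n -> R).
Hypothesis phi_sol : approx_sol x0 phi.

Lemma approx_sol0 : phi 0 = x0.
Proof.
apply/funext => i; apply/eqP; rewrite -subr_eq0 -normr_le0.
apply/ler_addgt0Pr => e e0; have [psi /(_ i)[p0 /(_ 0)]] := phi_sol e0.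
by rewrite lexx T0 add0r p0 distrC => /(_ isT)[].
Qed.

Lemma approx_sol_lip s t i : 0 <= s <= T -> 0 <= t <= T ->
  `|phi s i - phi t i| <= M * `|s - t|.
Proof.
wlog st : s t / s <= t.
  move=> H; have [/H//|/ltW ts] := leP s t.
  by move=> sT tT; rewrite distrC (distrC s); exact: H.
move=> sT tT; apply/ler_addgt0Pr => e e0.
pose d := e / (2 + T); have T2 : 0 < 2 + T by lra.
have d0 : 0 < d by rewrite divr_gt0.
have dT : d * (2 + T) = e by rewrite divfK // gt_eqF.
have [psi /(_ i)[_ H]] := phi_sol d0.
have [hs _] := H _ sT; have [ht _] := H _ tT.
have := @poly_mvt _ (psi i) s t 0 (M + d) st _ => mvt.
have {mvt} : `|(psi i).[t] - (psi i).[s] - 0 * (t - s)| <= (M + d) * (t - s).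
  apply: mvt => u /andP[su ut].
  have uT : 0 <= u <= T by case/andP: sT => s0 _; case/andP: tT => _ t1; rewrite (le_trans s0 su) (le_trans ut t1).
  have [_ h] := H _ uT; have h' := F_bounded i (fun j => (psi j).[u]).
  rewrite subr0; move: h h'; rewrite !ler_norml => /andP[? ?] /andP[? ?].
  by apply/andP; split; lra.
have ts0 : `|s - t| = t - s by rewrite distrC ger0_norm // subr_ge0.
have tsT : t - s <= T by case/andP: sT; case/andP: tT; lra.
have : d * (t - s) <= d * T by rewrite ler_wpM2l // ltW.
rewrite ts0 mul0r subr0; move: hs ht; rewrite !ler_norml.
move=> /andP[? ?] /andP[? ?] ? /andP[? ?]; apply/andP; split; lra.
Qed.

(** Between [s] and [t] the companions have a derivative near F (phi t), up to the variation of [F]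
    along the Lipschitz curve. The mean value inequality, with the error tending to 0, gives the
    quadratic remainder from which differentiability is read off. *)
Lemma approx_sol_taylor s t i : 0 <= s <= T -> 0 <= t <= T ->
  `|phi s i - phi t i - F i (phi t) * (s - t)| <= L * (n%:R * M) * `|s - t| ^+ 2.
Proof.
move=> sT tT; apply/ler_addgt0Pr => e e0.
pose C := 2 + (1 + L * n%:R) * T.
have Ln : 0 <= L * n%:R by rewrite mulr_ge0.
have C0 : 0 < C by rewrite /C; have : 0 <= (1 + L * n%:R) * T; [rewrite mulr_ge0 //|]; lra.
pose d := e / C; have d0 : 0 < d by rewrite divr_gt0.
have dC : d * C = e by rewrite divfK // gt_eqF.
have [psi H] := phi_sol d0.
have key u : 0 <= u <= T -> `|u - t| <= `|s - t| ->
    `|(psi i)^`().[u] - F i (phi t)| <= d * (1 + L * n%:R) + L * (n%:R * M) * `|s - t|.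
  move=> uT ust.
  have h1 : `|(psi i)^`().[u] - F i (fun j => (psi j).[u])| <= d.
    by have [_ /(_ _ uT)[]] := H i.
  have h2 : `|F i (fun j => (psi j).[u]) - F i (phi t)| <= L * (n%:R * (d + M * `|s - t|)).
    apply: F_lip_sup => j.
    have h3 : `|(psi j).[u] - phi u j| <= d by have [_ /(_ _ uT)[]] := H j.
    have h4 := approx_sol_lip j uT tT.
    have h5 : M * `|u - t| <= M * `|s - t|.
      by apply: ler_wpM2l => //; exact: le_trans (normr_ge0 _) (F_bounded j x0).
    rewrite -(subrKA (phi u j)); apply: le_trans (ler_normD _ _) _; lra.
  rewrite -(subrKA (F i (fun j => (psi j).[u]))); apply: le_trans (ler_normD _ _) _; lra.
have fin : `|(psi i).[s] - (psi i).[t] - F i (phi t) * (s - t)| <=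
    (d * (1 + L * n%:R) + L * (n%:R * M) * `|s - t|) * `|s - t|.
  have /andP[s0 s1] := sT; have /andP[t0 t1] := tT.
  have [st|ts] := leP s t.
    have -> : (psi i).[s] - (psi i).[t] - F i (phi t) * (s - t) =
      - ((psi i).[t] - (psi i).[s] - F i (phi t) * (t - s)) by ring.
    rewrite normrN [X in _ <= _ * X](_ : _ = t - s); last by rewrite distrC ger0_norm // subr_ge0.
    apply: poly_mvt => // u /andP[su ut].
    apply: key; first by rewrite (le_trans s0) // (le_trans ut).
    by rewrite distrC (distrC s) !ger0_norm ?subr_ge0 // lerD2l lerN2.
  rewrite [X in _ <= _ * X](_ : _ = s - t); last by rewrite ger0_norm // subr_ge0 ltW.
  apply: poly_mvt => [|u /andP[tu us]]; first exact: ltW.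
  apply: key; first by rewrite (le_trans t0) // (le_trans us).
  by rewrite !ger0_norm ?subr_ge0 // ?lerD2r // ltW.
have hs : `|(psi i).[s] - phi s i| <= d by have [_ /(_ _ sT)[]] := H i.
have ht : `|(psi i).[t] - phi t i| <= d by have [_ /(_ _ tT)[]] := H i.
have stT : `|s - t| <= T.
  by case/andP: sT; case/andP: tT; rewrite ler_norml => ? ? ? ?; apply/andP; split; lra.
have : d * (1 + L * n%:R) * `|s - t| <= d * (1 + L * n%:R) * T.
  by apply: ler_wpM2l => //; rewrite mulr_ge0 ?ltW //; lra.
move: fin hs ht; rewrite -dC /C expr2 mulrDl !ler_norml !mulrA.
set A := `|s - t|; move=> /andP[? ?] /andP[? ?] /andP[? ?] ?; apply/andP; split; lra.
Qed.

Lemma approx_sol_derive t i : 0 < t < T -> is_derive t 1 (phi^~ i) (F i (phi t)).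
Proof.
move=> /andP[t0 tT]; have M0 : 0 <= M by exact: le_trans (normr_ge0 _) (F_bounded i x0).
set C := L * (n%:R * M).
have C0 : 0 <= C by rewrite !mulr_ge0.
have lim : h^-1 *: (phi (h + t) i - phi t i) @[h --> (0 : R)^'] --> F i (phi t).
  apply/cvgrPdist_le => e e0.
  near=> h.
  have h0 : h != 0 by near: h; exact: nbhs_dnbhs_neq.
  have htT : 0 <= h + t <= T.
    have : `|h| < t by near: h; exact: dnbhs0_lt.
    have : `|h| < T - t by near: h; apply: dnbhs0_lt; rewrite subr_gt0.
    by rewrite !ltr_norml => /andP[? ?] /andP[? ?]; apply/andP; split; lra.
  have tTw : 0 <= t <= T by rewrite !ltW.
  have := approx_sol_taylor i htT tTw; rewrite addrK => tay.
  rewrite distrC.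
  have -> : h^-1 *: (phi (h + t) i - phi t i) - F i (phi t) =
     h^-1 * (phi (h + t) i - phi t i - F i (phi t) * h).
    by rewrite mulrBr (mulrC _ h) mulrA mulVf // mul1r.
  rewrite normrM normrV ?unitfE // ler_pdivrMl ?normr_gt0 //.
  apply: le_trans tay _; rewrite -/C expr2 mulrA [leRHS]mulrC ler_wpM2r //.
  have : `|h| <= e / (C + 1) by near: h; apply: dnbhs0_le; rewrite divr_gt0 //; lra.
  rewrite ler_pdivlMr; last lra.
  have := normr_ge0 h; rewrite -/C; nra.
apply: DeriveDef; rewrite ?/derivable /derive.
  by under eq_fun do rewrite [_%:A]mulr1; apply/cvg_ex; exists (F i (phi t)).
by under eq_fun do rewrite [_%:A]mulr1; apply: cvg_lim lim.
Unshelve. all: by end_near. Qed.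

Lemma approx_sol_continuous i : {within `[0, T], continuous (phi^~ i)}.
Proof.
(* [c] projects the line to [0, T], so the composition of [phi] with [c] is Lipschitz everywhere and
   agrees with [phi] on the interval. *)
pose c s := T / 2 + clamp (T / 2) (s - T / 2).
have T2 : 0 <= T / 2 by rewrite divr_ge0.
have cT s : 0 <= c s <= T.
  have := clamp_norm (s - T / 2) T2; rewrite /c ler_norml => /andP[? ?]; apply/andP; split; lra.
have cid s : 0 <= s <= T -> c s = s.
  by move=> /andP[? ?]; rewrite /c clamp_id ?ler_norml; [lra|apply/andP; split; lra].
have clip s t : `|c s - c t| <= `|s - t|.
  have <- : s - T / 2 - (t - T / 2) = s - t by ring.
  have -> : c s - c t = clamp (T / 2) (s - T / 2) - clamp (T / 2) (t - T / 2).
    by rewrite /c; ring.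
  exact: clamp_lip.
have M0 : 0 <= M by exact: le_trans (normr_ge0 _) (F_bounded i x0).
apply: (@subspace_eq_continuous _ _ _ (fun s => phi (c s) i)).
  by move=> s; rewrite inE /= in_itv /= => /cid ->.
apply: continuous_subspaceT => s; apply/cvgrPdist_le => e e0; near=> t.
apply: le_trans (approx_sol_lip i (cT s) (cT t)) _.
apply: le_trans (ler_wpM2l M0 (clip s t)) _.
have : `|s - t| <= e / (M + 1).
  by near: t; apply: cvgr_dist_le => //; rewrite divr_gt0 //; lra.
rewrite ler_pdivlMr; last lra.
by have := normr_ge0 (s - t); lra.
Unshelve. all: by end_near. Qed.

End Solution.

End Picard.

(** * Lie derivatives along solutions *)

Section LieCalculus.
Variables (R : realType) (n : nat).
Implicit Types (p q v s : SPoly R n) (S : {set 'I_n.+1}) (V : {set 'I_n}).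

Lemma meval_dep S p (z z' : 'I_n.+1 -> R) : dep_only S p ->
  (forall j, j \in S -> z j = z' j) -> mpoly.meval z p = mpoly.meval z' p.
Proof.
move=> dp zz'; rewrite -(proj_id dp) !meval_proj; apply: mpoly.meval_eq => j.
by case: ifPn => // /zz'.
Qed.

Lemma xv_Svars V i : (xv i \in Svars V) = (i \in V).
Proof. by rewrite /Svars mem_imset //; exact: xv_inj. Qed.

Lemma tv_Svars V : (tv n \in Svars V) = false.
Proof. by apply/negbTE/imsetP => -[i _] /eqP; rewrite eq_sym tv_xv. Qed.

Lemma xv_Stvars V i : (xv i \in Stvars V) = (i \in V).
Proof. by rewrite /Stvars !inE tv_xv xv_Svars. Qed.

Lemma tv_Stvars V : tv n \in Stvars V.
Proof. by rewrite /Stvars !inE eqxx. Qed.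

Lemma Svars_sub V : Svars V \subset Stvars V.
Proof. by rewrite /Stvars finset.subsetUr. Qed.

Lemma Svars_mono V V' : V \subset V' -> Svars V \subset Svars V'.
Proof. exact: imsetS. Qed.

Lemma Stvars_mono V V' : V \subset V' -> Stvars V \subset Stvars V'.
Proof. by move=> VV; rewrite /Stvars finset.setUS // Svars_mono. Qed.

Lemma pt_tv (t : R) (x : 'I_n -> R) : pt t x (tv n) = t.
Proof. by rewrite /pt unlift_none. Qed.

Lemma pt_xv (t : R) (x : 'I_n -> R) i : pt t x (xv i) = x i.
Proof. by have := ev_xv i t x; rewrite /ev mpoly.mevalXU. Qed.

Lemma ev_dep V p t (x y : 'I_n -> R) : dep_only (Stvars V) p ->
  (forall i, i \in V -> x i = y i) -> ev p t x = ev p t y.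
Proof.
move=> dp xy; apply: meval_dep dp _ => j.
have [->|[i ->]] := ord_tvxvP j; rewrite ?pt_tv // !pt_xv xv_Stvars; exact: xy.
Qed.

Lemma ev_dep_space V p t t' (x y : 'I_n -> R) : dep_only (Svars V) p ->
  (forall i, i \in V -> x i = y i) -> ev p t x = ev p t' y.
Proof.
move=> dp xy; apply: meval_dep dp _ => j.
by have [->|[i ->]] := ord_tvxvP j; rewrite ?tv_Svars // !pt_xv xv_Svars; exact: xy.
Qed.

Lemma mderiv_Xv i j : mpoly.mderiv i (Xv R j) = (i == j)%:R :> SPoly R n.
Proof.
rewrite mpoly.mderivX mpoly.mnm1E eq_sym; case: eqP => [->|_]; last by rewrite scale0r.
have -> : (U_(j) - U_(j) = 0 :> 'X_{1..n.+1})%MM.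
  by apply/mpoly.mnmP => k; rewrite mpoly.mnmBE subnn mpoly.mnm0E.
by rewrite mpoly.mpolyX0 scale1r.
Qed.

Lemma mderiv_dep S p j : dep_only S p -> j \notin S -> mpoly.mderiv j p = 0.
Proof.
move=> dp jS; rewrite -(proj_id dp); elim/spoly_ind: p {dp} => [c|k|p q dp dq|p q dp dq].
- by rewrite /proj mpoly.comp_mpolyC mpoly.mderivC.
- rewrite projXv; case: ifP => kS; last by rewrite mpoly.mderiv0.
  by rewrite mderiv_Xv; case: eqP => // jk; rewrite jk kS in jS.
- by rewrite projD mpoly.mderivD dp dq addr0.
- by rewrite projM mpoly.mderivM dp dq mul0r mulr0 addr0.
Qed.

Variable f : 'I_n -> SPoly R n.

Lemma LieD V p q : Lie f V (p + q) = Lie f V p + Lie f V q.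
Proof.
rewrite /Lie mpoly.mderivD [RHS]addrACA -big_split /=; congr (_ + _).
by apply: eq_bigr => i _; rewrite mpoly.mderivD mulrDl.
Qed.

Lemma LieM V p q : Lie f V (p * q) = Lie f V p * q + p * Lie f V q.
Proof.
rewrite /Lie mpoly.mderivM !(mulrDl, mulrDr) [RHS]addrACA; congr (_ + _).
rewrite mulr_suml mulr_sumr -big_split /=.
by apply: eq_bigr => i _; rewrite mpoly.mderivM; ring.
Qed.

Lemma LieC V c : Lie f V (Cst n c) = 0.
Proof.
rewrite /Lie mpoly.mderivC big1 ?addr0 // => i _.
by rewrite mpoly.mderivC mul0r.
Qed.

Lemma Lie0 V : Lie f V 0 = 0.
Proof. by rewrite -(mpoly.mpolyC0 n.+1 R) LieC. Qed.

Lemma LieN V p : Lie f V (- p) = - Lie f V p.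
Proof. by apply/eqP; rewrite -addr_eq0 -LieD addNr Lie0. Qed.

Lemma LieB V p q : Lie f V (p - q) = Lie f V p - Lie f V q.
Proof. by rewrite LieD LieN. Qed.

Lemma Lie_sum V I (r : seq I) (P : pred I) (F : I -> SPoly R n) :
  Lie f V (\sum_(i <- r | P i) F i) = \sum_(i <- r | P i) Lie f V (F i).
Proof. exact: (big_morph _ (LieD V) (Lie0 V)). Qed.

Lemma Lie_tv V : Lie f V (Xv R (tv n)) = 1.
Proof.
rewrite /Lie mderiv_Xv eqxx big1 ?addr0 // => i _.
by rewrite mderiv_Xv tv_xv mul0r.
Qed.

Lemma Lie_xv V i : i \in V -> Lie f V (Xv R (xv i)) = f i.
Proof.
move=> iV; rewrite /Lie mderiv_Xv eq_sym tv_xv add0r (bigD1 i) //=.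
rewrite mderiv_Xv eqxx mul1r big1 ?addr0 // => j /andP[_ ji].
by rewrite mderiv_Xv (inj_eq (@xv_inj n)) (negbTE ji) mul0r.
Qed.

(** This allows the Lie derivatives of certificates over different pasts to be added in the full
    state space. *)
Lemma Lie_setT V v : dep_only (Stvars V) v -> Lie f V v = Lie f [set: 'I_n]%SET v.
Proof.
move=> dv; rewrite /Lie; congr (_ + _).
rewrite [RHS](bigID (mem V)) /= [X in _ + X]big1 ?addr0.
  by apply: eq_bigl => i; rewrite inE.
by move=> i /andP[_ iV]; rewrite (mderiv_dep dv) ?mul0r // xv_Stvars.
Qed.

Lemma dep_only_mderiv S p j : dep_only S p -> dep_only S (mpoly.mderiv j p).
Proof.
move=> dp; rewrite -(proj_id dp); elim/spoly_ind: p {dp} => [c|k|p q dp dq|p q dp dq].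
- by rewrite /proj mpoly.comp_mpolyC mpoly.mderivC; exact: dep_only0.
- rewrite projXv; case: ifP => kS; last by rewrite mpoly.mderiv0; exact: dep_only0.
  by rewrite mderiv_Xv; case: eqP => _; [exact: dep_only1|exact: dep_only0].
- by rewrite projD mpoly.mderivD; exact: dep_onlyD.
- by rewrite projM mpoly.mderivM; apply: dep_onlyD; apply: dep_onlyM => //; exact: dep_only_proj.
Qed.

Lemma dep_only_Lie V v : (forall i, i \in V -> dep_only (Stvars V) (f i)) ->
  dep_only (Stvars V) v -> dep_only (Stvars V) (Lie f V v).
Proof.
move=> df dv; apply: dep_onlyD; first exact: dep_only_mderiv.
by apply: dep_only_sum => i iV; apply: dep_onlyM; [exact: dep_only_mderiv|exact: df].
Qed.

(** The composition of [q] with [s]; [Lie_emb] is its chain rule. *)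
Definition emb (q : {poly R}) s : SPoly R n := (map_poly (mpoly.mpolyC n.+1 (R:=R)) q).[s].

Lemma emb0 s : emb 0 s = 0.
Proof. by rewrite /emb rmorph0 horner0. Qed.

Lemma embMXaddC (q : {poly R}) c s : emb (q * 'X + c%:P) s = emb q s * s + Cst n c.
Proof. by rewrite /emb rmorphD rmorphM /= map_polyX map_polyC hornerMXaddC. Qed.

Lemma embD (q r : {poly R}) s : emb (q + r) s = emb q s + emb r s.
Proof. by rewrite /emb rmorphD hornerD. Qed.

Lemma embMX (q : {poly R}) s : emb (q * 'X) s = emb q s * s.
Proof. by rewrite -[q * 'X]addr0 -polyC0 embMXaddC /Cst mpoly.mpolyC0 addr0. Qed.

Lemma ev_emb (q : {poly R}) s t (x : 'I_n -> R) : ev (emb q s) t x = q.[ev s t x].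
Proof.
elim/poly_ind: q => [|q c IH]; first by rewrite emb0 horner0 /ev mpoly.meval0.
by rewrite embMXaddC hornerMXaddC evD evM evC IH.
Qed.

Lemma dep_only_emb S (q : {poly R}) s : dep_only S s -> dep_only S (emb q s).
Proof.
move=> ds; elim/poly_ind: q => [|q c IH]; first by rewrite emb0; exact: dep_only0.
by rewrite embMXaddC; apply: dep_onlyD; [exact: dep_onlyM|exact: dep_onlyC].
Qed.

Lemma Lie_emb V (q : {poly R}) s : Lie f V (emb q s) = emb q^`() s * Lie f V s.
Proof.
elim/poly_ind: q => [|q c IH]; first by rewrite emb0 deriv0 emb0 Lie0 mul0r.
by rewrite embMXaddC LieD LieM LieC IH derivMXaddC embD embMX; ring.
Qed.

(** Only the coordinates in [V] are known to be differentiable; the induction runs on [proj], which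
    removes the others from [v]. *)
Lemma is_derive_ev V v (phi : R -> 'I_n -> R) (t : R) : dep_only (Stvars V) v ->
  (forall i, i \in V -> is_derive t 1 (phi^~ i) (ev (f i) t (phi t))) ->
  is_derive t 1 (fun u : R => ev v u (phi u)) (ev (Lie f V v) t (phi t)).
Proof.
move=> dv dphi; rewrite -(proj_id dv).
elim/spoly_ind: v {dv} => [c|j|p q dp dq|p q dp dq].
- rewrite /proj mpoly.comp_mpolyC LieC.
  under eq_fun do rewrite evC.
  rewrite /ev mpoly.meval0; exact: is_derive_cst.
- rewrite projXv; have [->|[i ->]] := ord_tvxvP j.
    rewrite tv_Stvars Lie_tv ev1.
    under eq_fun do rewrite ev_tv.
    exact: is_derive_id.
  rewrite xv_Stvars; case: ifP => iV.
    rewrite Lie_xv //.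
    under eq_fun do rewrite ev_xv.
    exact: dphi.
  rewrite Lie0 /ev mpoly.meval0.
  under eq_fun do rewrite mpoly.meval0.
  exact: is_derive_cst.
- rewrite projD LieD evD.
  under eq_fun do rewrite evD.
  exact (is_deriveD dp dq).
- rewrite projM LieM evD !evM.
  under eq_fun do rewrite evM.
  have dpq := is_deriveM dp dq; refine (is_derive_eq dpq _).
  by rewrite /GRing.scale /= addrC [X in X + _]mulrC.
Qed.

Lemma continuous_ev (A : set R) V v (phi : R -> 'I_n -> R) : dep_only (Stvars V) v ->
  (forall i, i \in V -> {within A, continuous (phi^~ i)}) ->
  {within A, continuous (fun u : R => ev v u (phi u))}.
Proof.
move=> dv cphi; rewrite -(proj_id dv).
elim/spoly_ind: v {dv} => [c|j|p q cp cq|p q cp cq].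
- rewrite /proj mpoly.comp_mpolyC.
  under eq_fun do rewrite evC.
  by move=> x; exact: cvg_cst.
- rewrite projXv; have [->|[i ->]] := ord_tvxvP j.
    rewrite tv_Stvars.
    under eq_fun do rewrite ev_tv.
    by apply: continuous_subspaceT => x; exact: cvg_id.
  rewrite xv_Stvars; case: ifP => iV.
    under eq_fun do rewrite ev_xv.
    exact: cphi.
  under eq_fun do rewrite /ev mpoly.meval0.
  by move=> x; exact: cvg_cst.
- rewrite projD.
  under eq_fun do rewrite evD.
  by move=> x; apply: cvgD; [exact: cp|exact: cq].
- rewrite projM.
  under eq_fun do rewrite evM.
  by move=> x; apply: cvgM; [exact: cp|exact: cq].
Qed.

Lemma Lie_nonincreasing V v (phi : R -> 'I_n -> R) (T : R) : 0 < T -> dep_only (Stvars V) v ->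
  (forall i, i \in V -> {within `[0, T], continuous (phi^~ i)}) ->
  (forall t, 0 < t < T -> forall i, i \in V ->
     is_derive t 1 (phi^~ i) (ev (f i) t (phi t))) ->
  (forall t, 0 < t < T -> ev (Lie f V v) t (phi t) <= 0) ->
  ev v T (phi T) <= ev v 0 (phi 0).
Proof.
move=> T0 dv cphi dphi Lv.
have [||t] := @MVT R (fun u : R => ev v u (phi u)) (fun u : R => ev (Lie f V v) u (phi u)) 0 T T0.
- by move=> t; rewrite in_itv /= => tT; apply: is_derive_ev => //; exact: dphi.
- exact: continuous_ev dv cphi.
rewrite in_itv /= => /Lv Lt; rewrite subr0 => /eqP; rewrite subr_eq => /eqP ->.
by rewrite gerDr; exact: mulr_le0_ge0 Lt (ltW T0).
Qed.

Lemma qmod_ge0 k S (gens : seq (SPoly R n)) h z : qmod k S gens h ->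
  (forall g, g \in gens -> 0 <= mpoly.meval z g) -> 0 <= mpoly.meval z h.
Proof.
have sos_ge0 q : sos S q -> 0 <= mpoly.meval z q.
  move=> [qs [_ ->]]; rewrite raddf_sum /= sumr_ge0 // => q' _.
  by rewrite rmorphXn /= sqr_ge0.
move=> [s0 [s [ss0 _ ss ->]]] gpos; rewrite mpoly.mevalD; apply: addr_ge0; first exact: sos_ge0.
rewrite raddf_sum /= sumr_ge0 // => i _; rewrite mpoly.mevalM mulr_ge0 //.
  by apply: sos_ge0; case: (ss i).
by apply: gpos; exact: mem_nth.
Qed.

Lemma ev_vat c v t (x : 'I_n -> R) : ev (vat c v) t x = ev v c x.
Proof.
rewrite /ev /vat mpoly.comp_mpoly_meval; apply: mpoly.meval_eq => j.
rewrite tnth_mktuple; case: eqP => [->|jt]; first by rewrite mpoly.mevalC pt_tv.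
rewrite mpoly.mevalXU; have [//|[i ->]] := ord_tvxvP j; by rewrite !pt_xv.
Qed.

Lemma vatD c p q : vat c (p + q) = vat c p + vat c q.
Proof. exact: mpoly.comp_mpolyD. Qed.

Lemma vatM c p q : vat c (p * q) = vat c p * vat c q.
Proof. exact: rmorphM. Qed.

Lemma vatXv c j : vat c (Xv R j) = if j == tv n then Cst n c else Xv R j.
Proof. by rewrite /vat mpoly.comp_mpolyXU -tnth_nth tnth_mktuple. Qed.

Lemma dep_only_vat V c v : dep_only (Stvars V) v -> dep_only (Svars V) (vat c v).
Proof.
move=> dv; rewrite -(proj_id dv); elim/spoly_ind: v {dv} => [a|j|p q dp dq|p q dp dq].
- by rewrite /proj /vat !mpoly.comp_mpolyC; exact: dep_onlyC.
- rewrite projXv; have [->|[i ->]] := ord_tvxvP j.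
    rewrite tv_Stvars vatXv eqxx.
    exact: dep_onlyC.
  rewrite xv_Stvars; case: ifP => iV.
    rewrite vatXv tv_xv.
    by apply: dep_onlyXv; rewrite xv_Svars.
  by rewrite /vat raddf0; exact: dep_only0.
- by rewrite projD vatD; exact: dep_onlyD.
- by rewrite projM vatM; exact: dep_onlyM.
Qed.

End LieCalculus.

(** * Barrier functions *)

Section ClampedField.
Variables (R : realType) (n : nat).
Implicit Types (p : SPoly R n) (x y : 'I_n -> R).

Lemma ev_lip p (r : R) : 0 <= r -> exists L B : R, [/\ 0 <= L, 0 <= B &
  forall x y, (forall i, `|x i| <= r) -> (forall i, `|y i| <= r) ->
    `|ev p 0 x| <= B /\ `|ev p 0 x - ev p 0 y| <= L * \sum_i `|x i - y i|].
Proof.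
move=> r0; elim/spoly_ind: p => [c|j|p q [L [B [L0 B0 IH]]] [L' [B' [L'0 B'0 IH']]]|
    p q [L [B [L0 B0 IH]]] [L' [B' [L'0 B'0 IH']]]].
- by exists 0, `|c|; split => // x y _ _; rewrite !evC subrr normr0 mul0r.
- exists 1, r; split => // x y xr yr; have [->|[i ->]] := ord_tvxvP j.
    by rewrite !ev_tv subrr normr0 mul1r sumr_ge0.
  by rewrite !ev_xv mul1r (bigD1 i) //= lerDl sumr_ge0.
- exists (L + L'), (B + B'); split; [exact: addr_ge0..|move=> x y xr yr].
  have [h1 h2] := IH _ _ xr yr; have [h3 h4] := IH' _ _ xr yr.
  rewrite !evD; split; first by apply: le_trans (ler_normD _ _) _; exact: lerD.
  by rewrite opprD addrACA mulrDl; apply: le_trans (ler_normD _ _) _; exact: lerD.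
- exists (L * B' + L' * B), (B * B'); split; [by rewrite addr_ge0 // mulr_ge0|exact: mulr_ge0|].
  move=> x y xr yr.
  have [h1 h2] := IH _ _ xr yr; have [h3 h4] := IH' _ _ xr yr.
  have [h1' _] := IH _ _ yr yr.
  rewrite !evM; split; first by rewrite normrM ler_pM.
  have -> : ev p 0 x * ev q 0 x - ev p 0 y * ev q 0 y =
    (ev p 0 x - ev p 0 y) * ev q 0 x + ev p 0 y * (ev q 0 x - ev q 0 y) by ring.
  apply: le_trans (ler_normD _ _) _; rewrite !normrM mulrDl; apply: lerD.
    by rewrite mulrAC ler_pM.
  by rewrite mulrC mulrAC ler_pM.
Qed.

Lemma sum_norm_sqr (V : {set 'I_n}) (u : 'I_n -> R) :
  (\sum_(i in V) `|u i|) ^+ 2 <= n%:R * \sum_(i in V) u i ^+ 2.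
Proof.
rewrite expr2 big_distrlr /=.
apply: (@le_trans _ _ (\sum_(i in V) \sum_(j in V) (u i ^+ 2 + u j ^+ 2) / 2)).
  apply: ler_sum => i _; apply: ler_sum => j _.
  rewrite ler_pdivlMr // -[u i ^+ 2]real_normK ?num_real // -[u j ^+ 2]real_normK ?num_real //.
  by have := sqr_ge0 (`|u i| - `|u j|); rewrite sqrrB; lra.
have E i : \sum_(j in V) (u i ^+ 2 + u j ^+ 2) / 2 =
    (u i ^+ 2 *+ #|V| + \sum_(j in V) u j ^+ 2) / 2.
  by rewrite -[LHS]mulr_suml big_split /= sumr_const.
rewrite (eq_bigr _ (fun i _ => E i)) -[leLHS]mulr_suml big_split /= sumr_const sumrMnl -mulr2n.
rewrite -[X in X / 2]mulr_natr mulfK ?pnatr_eq0 // -[leLHS]mulr_natl.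
apply: ler_wpM2r; first by apply: sumr_ge0 => i _; exact: sqr_ge0.
by rewrite ler_nat; have := max_card V; rewrite card_ord.
Qed.

Variable f : 'I_n -> SPoly R n.
Variable rho : R.
Hypothesis rho0 : 0 <= rho.

(** Clamping the state makes the polynomial field bounded and globally Lipschitz, so its curves live
    on all of [0, T]; on states in the cube of radius [rho] it is the original field. *)
Definition clampF (i : 'I_n) x : R := ev (f i) 0 (fun j => clamp rho (x j)).

Lemma clampF_lip_bounded : exists L M : R, [/\ 0 <= L,
  (forall i x y, `|clampF i x - clampF i y| <= L * \sum_j `|x j - y j|) &
  (forall i x, `|clampF i x| <= M)].
Proof.
have /choice[c Hc] i : exists c : R * R, [/\ 0 <= c.1, 0 <= c.2 & forall x y,
    `|clampF i x| <= c.2 /\ `|clampF i x - clampF i y| <= c.1 * \sum_j `|x j - y j|].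
  have [L [B [L0 B0 H]]] := ev_lip (f i) rho0.
  exists (L, B); split => // x y; have cl (z : 'I_n -> R) j : `|clamp rho (z j)| <= rho by exact: clamp_norm.
  have [h1 h2] := H _ _ (cl x) (cl y); split => //; apply: le_trans h2 _.
  by apply: ler_wpM2l => //; apply: ler_sum => j _; exact: clamp_lip.
have c0 i : 0 <= (c i).1 /\ 0 <= (c i).2 by case: (Hc i).
exists (\sum_i (c i).1), (\sum_i (c i).2); split.
- by apply: sumr_ge0 => i _; case: (c0 i).
- move=> i x y; have [_ _ /(_ x y)[_ h]] := Hc i; apply: le_trans h _.
  apply: ler_wpM2r; first exact: sumr_ge0.
  by rewrite (bigD1 i) //= lerDl sumr_ge0 // => j _; case: (c0 j).
- move=> i x; have [_ _ /(_ x x)[h _]] := Hc i; apply: le_trans h _.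
  by rewrite (bigD1 i) //= lerDl sumr_ge0 // => j _; case: (c0 j).
Qed.

Lemma clampF_approx (a b : R) (psi : 'I_n -> {poly R}) i :
  papprox a b (fun t => clampF i (fun j => (psi j).[t])).
Proof.
rewrite /clampF; elim/spoly_ind: (f i) => [c|j|p q ap aq|p q ap aq].
- under eq_fun do rewrite evC.
  by move=> e e0; exists c%:P => t _; rewrite hornerC subrr normr0 ltW.
- have [->|[k ->]] := ord_tvxvP j.
    under eq_fun do rewrite ev_tv.
    by move=> e e0; exists 0 => t _; rewrite horner0 subrr normr0 ltW.
  under eq_fun do rewrite ev_xv.
  by apply: papprox_clamp; exact: papprox_horner.
- under eq_fun do rewrite evD.
  exact: papproxD.
- under eq_fun do rewrite evM.
  exact: papproxM.
Qed.

End ClampedField.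

Section Barrier.
Variables (R : realType) (n : nat) (f : 'I_n -> SPoly R n) (V : {set 'I_n}).
Variables (T rho L M : R) (XX XT : set ('I_n -> R)).
Hypothesis T0 : 0 < T.
Hypothesis rho0 : 0 <= rho.
Hypothesis f_dep : forall i, i \in V -> dep_only (Svars V) (f i).
Hypothesis XX_bounded : forall x, XX x -> forall i, i \in V -> `|x i| <= rho.
Hypothesis XT_bounded : forall x, XT x -> forall i, i \in V -> `|x i| <= rho.
Hypothesis L0 : 0 <= L.
Hypothesis F_lip : forall i x y,
  `|clampF f rho i x - clampF f rho i y| <= L * \sum_j `|x j - y j|.
Hypothesis F_bounded : forall i x, `|clampF f rho i x| <= M.
Local Notation F := (clampF f rho).

Lemma clampF_lip_dep i x y : i \in V ->
  `|F i x - F i y| <= L * \sum_(j in V) `|x j - y j|.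
Proof.
move=> iV; pose x' j := if j \in V then x j else y j.
have -> : F i x = F i x'.
  by apply: ev_dep_space (f_dep iV) _ => j jV; rewrite /x' jV.
apply: le_trans (F_lip i x' y) _; apply: ler_wpM2l => //.
rewrite (bigID (mem V)) /= [X in _ + X]big1 ?addr0 => [|j /negPf jV].
  by apply: ler_sum => j jV; rewrite /x' jV.
by rewrite /x' jV subrr normr0.
Qed.

Lemma clampF_id x i t : XX x -> i \in V -> ev (f i) t x = F i x.
Proof.
move=> Xx iV; apply: ev_dep_space (f_dep iV) _ => j jV.
by rewrite clamp_id // XX_bounded.
Qed.

(** For u = x - psi (t) and g = f (x) - psi' (t), the left side is the derivative of a |u|^2 along
    the field. The condition on [a'] absorbs the Lipschitz growth, as in Gronwall's inequality, and
    leaves a term linear in the error [e]. *)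
Lemma distance_drift (u g : 'I_n -> R) (a a' e U : R) :
  (forall i, i \in V -> `|g i| <= L * \sum_(j in V) `|u j| + e) ->
  (forall i, i \in V -> `|u i| <= U) -> 0 <= U -> 0 <= a -> 0 <= e ->
  a' + 2 * (L * n%:R) * a <= 0 ->
  a' * (\sum_(i in V) u i ^+ 2) + a * (\sum_(i in V) 2 * (u i * g i)) <=
  2 * a * (n%:R * U) * e.
Proof.
move=> gb ub U0 a0 e0 aa'.
set S1 := \sum_(j in V) `|u j|; set S2 := \sum_(i in V) u i ^+ 2.
have S2_ge0 : 0 <= S2 by apply: sumr_ge0 => i _; exact: sqr_ge0.
have S1_ge0 : 0 <= S1 by exact: sumr_ge0.
have h1 : \sum_(i in V) 2 * (u i * g i) <= 2 * (S1 * (L * S1 + e)).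
  rewrite -mulr_sumr ler_wpM2l // [leRHS]mulr_suml; apply: ler_sum => i iV.
  apply: le_trans (ler_norm _) _; rewrite normrM; apply: ler_wpM2l => //.
  exact: gb.
have h2 : S1 <= n%:R * U.
  apply: le_trans (ler_sum _ (fun i iV => ub i iV)) _.
  rewrite sumr_const -[leLHS]mulr_natl ler_wpM2r // ler_nat.
  by have := max_card V; rewrite card_ord.
have h3 := sum_norm_sqr V u; rewrite -/S1 -/S2 expr2 in h3.
have h4 : L * (S1 * S1) <= L * (n%:R * S2) by exact: ler_wpM2l.
have h5 : e * S1 <= e * (n%:R * U) by exact: ler_wpM2l.
have h6 : a * (\sum_(i in V) 2 * (u i * g i)) <= a * (2 * (L * (n%:R * S2) + e * (n%:R * U))).
  by apply: ler_wpM2l => //; apply: le_trans h1 _; lra.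
have h7 : (a' + 2 * (L * n%:R) * a) * S2 <= 0 by rewrite mulr_le0_ge0.
lra.
Qed.

Variables (x0 : 'I_n -> R) (phi : R -> 'I_n -> R).
Hypothesis phi_sol : approx_sol T F x0 phi.

Tactic Notation "lra_from" hyp_list(hs) :=
  clear - T0 rho0 f_dep XX_bounded XT_bounded L0 F_lip F_bounded phi_sol hs; lra.

(* The function [v] is minus a bump around the curve [phi]: it is a function of
   [a(t) |x - phi(t)|^2], with the weight [a] decreasing fast enough to be nonincreasing
   along all trajectories, and of [K (t - s0)_+^2], which switches it off after [phi]
   has left [XX]. *)
Lemma barrier (d K s0 : R) : 0 < d -> 0 <= K -> 0 <= s0 <= T ->
  (forall t x, 0 <= t <= T -> s0 < t -> XX x ->
     (exists2 i, i \in V & 2 * d < `|x i - phi t i|) \/ d ^+ 2 <= K * (t - s0) ^+ 2) ->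
  (forall x, XT x ->
     (exists2 i, i \in V & 2 * d < `|x i - phi T i|) \/ d ^+ 2 <= K * (T - s0) ^+ 2) ->
  exists2 r, 0 < r & forall m delta, 0 <= m -> 0 < delta -> exists v,
    [/\ dep_only (Stvars V) v,
        (forall t x, 0 <= t <= T -> XX x -> ev (Lie f V v) t x < 0),
        (forall x, XT x -> 0 < ev v T x),
        (forall x, XX x -> ev v 0 x <= delta) &
        (forall x, XX x -> (forall i, i \in V -> `|x i - x0 i| < r) -> ev v 0 x <= - m)].
Proof.
move=> d0 K0 /andP[s00 s0T] Hfar HfarT; have T0' := T0.
have Ln : 0 <= L * n%:R by rewrite mulr_ge0.
(* The weight (T + 1 - t)^kk replaces exp (- 2 L n t): its logarithmic derivative is - kk / (T + 1 -
   t), and its base stays at least 1 up to time T. *)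
have [kk Hk] : exists k : nat, 2 * (L * n%:R) * (T + 1) < k%:R.
  by exists (Num.bound `|2 * (L * n%:R) * (T + 1)|); apply: le_lt_trans (ler_norm _) (archi_boundP (normr_ge0 _)).
have kk0 : (0 < kk)%N.
  by rewrite -(ltr0n R); apply: le_lt_trans Hk; apply: mulr_ge0; [exact: mulr_ge0|lra_from T0'].
pose ap : {poly R} := ((T + 1)%:P - 'X) ^+ kk.
pose A := (T + 1) ^+ kk.
have A1 : 1 <= A by apply: exprn_ege1; lra_from T0'.
have apE t : ap.[t] = (T + 1 - t) ^+ kk by rewrite /ap !hornerE.
have ap1 t : 0 <= t <= T -> 1 <= ap.[t].
  by move=> /andP[t0 t1]; rewrite apE exprn_ege1 //; lra_from t1.
have apA t : 0 <= t <= T -> ap.[t] <= A.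
  move=> /andP[t0 t1]; rewrite apE /A; apply: lerXn2r; rewrite ?nnegrE; lra_from t0 t1 T0'.
have apD t : 0 <= t <= T -> ap^`().[t] + 2 * (L * n%:R) * ap.[t] <= 0.
  move=> /andP[t0 t1]; have w0 : 0 <= T + 1 - t by lra_from t1.
  have wE : (T + 1 - t) ^+ kk = (T + 1 - t) * (T + 1 - t) ^+ kk.-1 by rewrite -exprS prednK.
  have h : 2 * (L * n%:R) * (T + 1 - t) <= kk%:R.
    by apply: le_trans (ltW Hk); apply: ler_wpM2l; [exact: mulr_ge0|lra_from t0].
  have h' := ler_wpM2r (exprn_ge0 kk.-1 w0) h.
  have -> : ap^`().[t] = - (kk%:R * (T + 1 - t) ^+ kk.-1).
    rewrite /ap deriv_exp derivB derivC derivX sub0r hornerMn hornerM hornerN hornerC.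
    by rewrite horner_exp hornerD hornerN hornerC hornerX -[LHS]mulr_natl mulN1r mulrN.
  by rewrite apE wE; lra_from h'.
pose Phi : R := `|M| * T + \sum_i `|x0 i|.
have Phi0 : 0 <= Phi by rewrite addr_ge0 ?sumr_ge0 // mulr_ge0 // ltW.
have phiB t i : 0 <= t <= T -> `|phi t i| <= Phi.
  move=> tT; have O : 0 <= (0 : R) <= T by rewrite lexx ltW.
  have := approx_sol_lip F_bounded phi_sol i tT O.
  rewrite (approx_sol0 (ltW T0) phi_sol) subr0 => h.
  rewrite -(subrK (x0 i) (phi t i)); apply: le_trans (ler_normD _ _) _; apply: lerD.
    apply: le_trans h _; case/andP: (tT) => t0 t1.
    rewrite (ger0_norm t0) ler_pM ?ler_norm //.
    exact: le_trans (normr_ge0 _) (F_bounded i x0).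
  by rewrite (bigD1 i) //= lerDl sumr_ge0.
clearbody Phi.
(* Bounds over the constraint sets: [U] for x_i - psi_i, where the 1 allows for e <= 1, [Rm] for
   [rhoP], and [C] for both arguments at which [q] is used. *)
pose U := rho + Phi + 1; have U0 : 0 <= U by rewrite /U !addr_ge0.
pose Rm := A * (n%:R * U ^+ 2).
have A0 : 0 <= A by exact: le_trans A1.
have nU0 : 0 <= n%:R * U by exact: mulr_ge0.
have Rm0 : 0 <= Rm by apply: mulr_ge0 => //; apply: mulr_ge0 => //; exact: exprn_ge0.
pose C := T + d ^+ 2 + Rm + K * (T ^+ 2 + 1).
have d20 : 0 < d ^+ 2 by rewrite exprn_gt0.
have T20 : 0 < T ^+ 2 by rewrite exprn_gt0.
have KT0 : 0 <= K * (T ^+ 2 + 1) by apply: mulr_ge0 => //; lra_from T20.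
have C0 : 0 <= C by rewrite /C; lra_from T0' d20 Rm0 KT0.
(* [C1 * e] will bound the drift of [rhoP], and [C3 * e] the product of q' with the total drift,
   before as well as after [s0]. *)
pose C1 := 2 * A * (n%:R * U).
have C10 : 0 <= C1 by apply: mulr_ge0 => //; exact: mulr_ge0.
have K20 : 0 <= K * (2 * T + 1) by apply: mulr_ge0 => //; lra_from T0'.
pose C3 := (2 * C + 1) * (C1 + K * (2 * T + 1)).
have C30 : 0 <= C3 by apply: mulr_ge0; [lra_from C0|exact: addr_ge0].
(* [r] is fixed before [m] and [delta], so one box serves all depths. At time 0 it gives A n r^2 <=
   A n r <= d^2 / 2. *)
pose r := Num.min 1 (d ^+ 2 / (2 * (A * (n%:R + 1)))).
have An0 : 0 < 2 * (A * (n%:R + 1)).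
  by apply: mulr_gt0 => //; apply: mulr_gt0; [lra_from A1|apply: ltr_wpDl].
exists r; first by rewrite lt_min ltr01 divr_gt0.
move=> m delta m0 delta0.
(* The term b (T - t) + b has Lie derivative - b, equals b at time T and delta at time 0: it
   supplies the strict margins within the allowed height. *)
pose b := delta / (T + 1); have T10 : 0 < T + 1 by lra_from T0'.
have b0 : 0 < b by rewrite divr_gt0.
have bT : b * T + b = delta by rewrite -[X in _ + X]mulr1 -mulrDr divfK // gt_eqF.
(* On the box at time 0 the bump is at least (d^2 / 4)^2 = d^4 / 16, so this factor brings it to m +
   delta. *)
pose m' := 16 * (m + delta) / d ^+ 4.
have d40 : 0 < d ^+ 4 by rewrite exprn_gt0.
have m'0 : 0 <= m' by rewrite divr_ge0 ?ltW //; lra_from m0 delta0.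
have m'E : m' * d ^+ 4 = 16 * (m + delta) by rewrite divfK // gt_eqF.
(* One [e] measures the error of the companion curve and of [q]; the last condition keeps it below
   the margin [b] after amplification by [m']. *)
have [e [e0 e1 ed eK eb]] : exists e, [/\ 0 < e, e <= 1, e <= d, K * e <= d ^+ 2 / 4 &
    m' * (C3 + 1) * e < b].
  have mC0 : 0 <= m' * (C3 + 1) by apply: mulr_ge0 => //; lra_from C30.
  exists (Num.min (Num.min 1 d) (Num.min (d ^+ 2 / (4 * (K + 1))) (b / (m' * (C3 + 1) + 1)))).
  have K4 : 0 < 4 * (K + 1) by apply: mulr_gt0 => //; lra_from K0.
  set e := Num.min _ _.
  have e0 : 0 < e by rewrite !lt_min ltr01 d0 !divr_gt0 //; lra_from mC0.
  have [e1 e2] : e <= Num.min 1 d /\ e <= Num.min (d ^+ 2 / (4 * (K + 1))) (b / (m' * (C3 + 1) + 1)).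
    by split; rewrite /e ge_min lexx // orbT.
  move: e1 e2; rewrite !le_min => /andP[e1 e2] /andP[].
  rewrite ler_pdivlMr // ler_pdivlMr; last by lra_from mC0.
  by move=> e3 e4; split => //; [lra_from e0 e3|lra_from e0 e4].
have [psi Hpsi] := phi_sol e0.
have [q Hq] := pospart_sqr_approx C0 e0.
pose tX := Xv R (tv n).
pose w i := Xv R (xv i) - emb (psi i) tX.
pose rhoP := emb ap tX * \sum_(i in V) w i ^+ 2.
pose kapP := Cst n K * emb q (tX - Cst n s0).
pose sP := Cst n (d ^+ 2) - rhoP - kapP.
pose v := Cst n b * (Cst n T - tX) + Cst n b - Cst n m' * emb q sP.
have ev_w t x i : ev (w i) t x = x i - (psi i).[t] by rewrite evB ev_xv ev_emb ev_tv.
have ev_rho t x : ev rhoP t x = ap.[t] * \sum_(i in V) (x i - (psi i).[t]) ^+ 2.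
  rewrite evM ev_emb ev_tv ev_sum; congr (_ * _); apply: eq_bigr => i _.
  by rewrite evX ev_w.
have ev_kap t x : ev kapP t x = K * q.[t - s0] by rewrite evM evC ev_emb evB ev_tv evC.
have ev_s t x : ev sP t x = d ^+ 2 - ev rhoP t x - ev kapP t x by rewrite !evB evC.
have ev_v t x : ev v t x = b * (T - t) + b - m' * q.[ev sP t x].
  by rewrite /v; move: (sP) => s'; rewrite !(evB, evD, evM, evC) ev_emb ev_tv.
have dw i : i \in V -> dep_only (Stvars V) (w i).
  move=> iV; apply: dep_onlyB; first by apply: dep_onlyXv; rewrite xv_Stvars.
  by apply: dep_only_emb; apply: dep_onlyXv; exact: tv_Stvars.
have dtX : dep_only (Stvars V) tX by apply: dep_onlyXv; exact: tv_Stvars.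
have dv : dep_only (Stvars V) v.
  apply: dep_onlyB; first apply: dep_onlyD; [|exact: dep_onlyC|].
    by apply: dep_onlyM; [exact: dep_onlyC|apply: dep_onlyB => //; exact: dep_onlyC].
  apply: dep_onlyM; [exact: dep_onlyC|apply: dep_only_emb].
  apply: dep_onlyB; first apply: dep_onlyB; [exact: dep_onlyC| |].
    apply: dep_onlyM; first exact: dep_only_emb.
    by apply: dep_only_sum => i iV; apply: dep_onlyX; exact: dw.
  apply: dep_onlyM; [exact: dep_onlyC|apply: dep_only_emb].
  by apply: dep_onlyB => //; exact: dep_onlyC.
have ev_Lie_rho t x : ev (Lie f V rhoP) t x = ap^`().[t] * (\sum_(i in V) (x i - (psi i).[t]) ^+ 2)
    + ap.[t] * \sum_(i in V) 2 * ((x i - (psi i).[t]) * (ev (f i) t x - (psi i)^`().[t])).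
  rewrite LieM Lie_emb Lie_tv mulr1 Lie_sum evD !evM !ev_emb ev_tv !ev_sum.
  congr (_ * _ + _ * _); apply: eq_bigr => i iV; first by rewrite evX ev_w.
  have Lw : Lie f V (w i) = f i - emb (psi i)^`() tX.
    by rewrite /w LieB Lie_xv // Lie_emb Lie_tv mulr1.
  by rewrite expr2 LieM Lw evD !evM ev_w evB ev_emb ev_tv; ring.
have ev_Lie_s t x : ev (Lie f V sP) t x = - ev (Lie f V rhoP) t x - K * q^`().[t - s0].
  rewrite /sP; move: (rhoP) => s'; rewrite /kapP LieB LieB LieC LieM LieC Lie_emb LieB Lie_tv LieC.
  by rewrite sub0r mul0r add0r subr0 mulr1 evB evN evM evC ev_emb evB ev_tv evC.
have ev_Lie_v t x : ev (Lie f V v) t x =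
    - b + m' * (q^`().[ev sP t x] * (ev (Lie f V rhoP) t x + K * q^`().[t - s0])).
  have := ev_Lie_s t x; rewrite /v; move: (sP) (rhoP) => s' r' hs.
  have -> : Lie f V (Cst n b * (Cst n T - tX) + Cst n b - Cst n m' * emb q s') =
      - Cst n b - Cst n m' * (emb q^`() s' * Lie f V s').
    by rewrite LieB LieD LieM LieB !LieC LieM LieC Lie_tv Lie_emb; ring.
  by rewrite evB evN !evM !evC ev_emb hs; ring.
clearbody v sP kapP rhoP w tX.
have bx t x : (forall i, i \in V -> `|x i| <= rho) -> 0 <= t <= T ->
    forall i, i \in V -> `|x i - (psi i).[t]| <= U.
  move=> xb tT i iV; have := phiB t i tT; have := xb i iV.
  have [_ /(_ t tT)[]] := Hpsi i; rewrite !ler_norml /U.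
  move=> /andP[h1 h2] _ /andP[h3 h4] /andP[h5 h6].
  by apply/andP; split; lra_from e1 h1 h2 h3 h4 h5 h6.
have rho_ge0 t x : 0 <= t <= T -> 0 <= ev rhoP t x.
  move=> tT; rewrite ev_rho mulr_ge0 //; first exact: le_trans (ap1 t tT).
  by apply: sumr_ge0 => i _; exact: sqr_ge0.
have rho_le t x : (forall i, i \in V -> `|x i| <= rho) -> 0 <= t <= T -> ev rhoP t x <= Rm.
  move=> xb tT; rewrite ev_rho /Rm; apply: ler_pM.
  - exact: le_trans (ap1 t tT).
  - by apply: sumr_ge0 => i _; exact: sqr_ge0.
  - exact: apA.
  - apply: (@le_trans _ _ (\sum_(i in V) U ^+ 2)).
      apply: ler_sum => i iV; rewrite -[leLHS]real_normK ?num_real //.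
      by apply: lerXn2r; rewrite ?nnegrE //; exact: bx.
    rewrite sumr_const -[leLHS]mulr_natl ler_wpM2r ?exprn_ge0 // ler_nat.
    by have := max_card V; rewrite card_ord.
have ts0 t : 0 <= t <= T -> `|t - s0| <= C /\ `|t - s0| <= T.
  move=> /andP[t0 t1].
  have tT : `|t - s0| <= T.
    by rewrite ler_norml; apply/andP; split; lra_from t0 t1 s00 s0T.
  by split => //; apply: le_trans tT _; rewrite /C; lra_from d20 Rm0 KT0.
have pos_le (s : R) : pospart s <= `|s| by rewrite /pospart; have h := ler_norm s; lra_from h.
have kap_ge t x : 0 <= t <= T -> K * pospart (t - s0) ^+ 2 <= ev kapP t x.
  move=> /ts0[tC _]; rewrite ev_kap; apply: ler_wpM2l => //; by have [] := Hq _ tC.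
have kap_ge0 t x : 0 <= t <= T -> 0 <= ev kapP t x.
  by move=> /(kap_ge t x); apply: le_trans; rewrite mulr_ge0 // exprn_ge0 // pospart_ge0.
have kap_le t x : 0 <= t <= T -> ev kapP t x <= K * (T ^+ 2 + 1).
  move=> /ts0[tC tsT]; rewrite ev_kap; apply: ler_wpM2l => //; have [_ _] := Hq _ tC.
  move=> /le_trans; apply; apply: lerD => //; apply: lerXn2r; rewrite ?nnegrE ?pospart_ge0 ?(ltW T0) //.
  exact: le_trans (pos_le _) tsT.
have sC t x : (forall i, i \in V -> `|x i| <= rho) -> 0 <= t <= T -> `|ev sP t x| <= C.
  move=> xb tT; have h1 := rho_ge0 t x tT; have h2 := rho_le t x xb tT.
  have h3 := kap_ge0 t x tT; have h4 := kap_le t x tT.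
  by rewrite ev_s ler_norml /C; apply/andP; split; lra_from h1 h2 h3 h4 d20 T0' Rm0 KT0.
(* Replacing [phi] by its companion costs e <= d, so distance d remains, and the weight is at least
   1. *)
have far t x : 0 <= t <= T -> (exists2 i, i \in V & 2 * d < `|x i - phi t i|) -> d ^+ 2 <= ev rhoP t x.
  move=> tT [i iV xi]; rewrite ev_rho.
  have xp : d <= `|x i - (psi i).[t]|.
    have [_ /(_ t tT)[h _]] := Hpsi i.
    have := ler_normD (x i - (psi i).[t]) ((psi i).[t] - phi t i).
    by rewrite addrA subrK => h'; lra_from h h' xi ed.
  apply: (@le_trans _ _ (1 * \sum_(j in V) (x j - (psi j).[t]) ^+ 2)).
    rewrite mul1r (bigD1 i) //= -[X in _ <= X + _]real_normK ?num_real //.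
    apply: ler_wpDr; first by apply: sumr_ge0 => j _; exact: sqr_ge0.
    by apply: lerXn2r; rewrite ?nnegrE // ltW.
  by apply: ler_wpM2r; [apply: sumr_ge0 => j _; exact: sqr_ge0|exact: ap1].
have s_le0 t x : 0 <= t <= T -> s0 <= t ->
    (exists2 i, i \in V & 2 * d < `|x i - phi t i|) \/ d ^+ 2 <= K * (t - s0) ^+ 2 ->
    ev sP t x <= 0.
  move=> tT st [/(far _ _ tT) h|h]; rewrite ev_s.
    by have h' := kap_ge0 t x tT; lra_from h h'.
  have := kap_ge t x tT; rewrite pospart_pos ?subr_ge0 // => h'.
  by have h2 := rho_ge0 t x tT; lra_from h h' h2.
have O : 0 <= (0 : R) <= T by rewrite lexx ltW.
have TT : 0 <= T <= T by rewrite lexx ltW.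
have q_ge0 t x : (forall i, i \in V -> `|x i| <= rho) -> 0 <= t <= T -> 0 <= q.[ev sP t x].
  by move=> xb tT; have [_ h _] := Hq _ (sC t x xb tT); exact: le_trans (sqr_ge0 _) h.
exists v; split => //.
- move=> t x tT Xx; have xb := XX_bounded Xx.
  have Lrho : ev (Lie f V rhoP) t x <= C1 * e.
    have apt := ap1 t tT.
    rewrite ev_Lie_rho; apply: le_trans (distance_drift (e := e) (U := U) _ _ U0 _ (ltW e0) (apD t tT)) _.
    - move=> i iV; rewrite (clampF_id t Xx iV).
      have [_ /(_ t tT)[_ h]] := Hpsi i.
      have h2 := clampF_lip_dep x (fun j => (psi j).[t]) iV.
      rewrite -(subrKA (F i (fun j => (psi j).[t]))); apply: le_trans (ler_normD _ _) _.
      by apply: lerD => //; rewrite distrC.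
    - exact: bx.
    - exact: le_trans apt.
    - rewrite /C1; apply: ler_wpM2r; first exact: ltW.
      apply: ler_wpM2r; first exact: mulr_ge0.
      by apply: ler_wpM2l => //; exact: apA.
  have [/andP[q'0 q'1] _ _] := Hq _ (sC t x xb tT).
  have [tC tsT] := ts0 t tT; have [/andP[k'0 k'1] _ _] := Hq _ tC.
  have Kk0 : 0 <= K * q^`().[t - s0] by exact: mulr_ge0.
  suff h : q^`().[ev sP t x] * (ev (Lie f V rhoP) t x + K * q^`().[t - s0]) <= C3 * e.
    rewrite ev_Lie_v addrC subr_lt0; apply: le_lt_trans eb.
    rewrite -mulrA; apply: ler_wpM2l => //; apply: le_trans h _.
    by apply: ler_wpM2r; [exact: ltW|lra_from C30].
  have CK0 : 0 <= C1 + K by exact: addr_ge0.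
  have KT1 : K <= K * (2 * T + 1) by rewrite ler_peMr //; lra_from T0'.
  have KK : K * q^`().[t - s0] <= K * (2 * pospart (t - s0) + e) by exact: ler_wpM2l.
  (* Up to [s0] the drift is of order e while q' is merely bounded. After [s0] the argument of [q]
     is nonpositive, so q' <= e while the drift is merely bounded. Either way the product is of
     order e. *)
  have [ts|st] := leP t s0.
    rewrite pospart_le0 ?subr_le0 // mulr0 add0r in KK.
    apply: (@le_trans _ _ (q^`().[ev sP t x] * ((C1 + K) * e))).
      by apply: ler_wpM2l => //; lra_from Lrho KK.
    rewrite /C3 -mulrA; apply: ler_pM => //.
    - by apply: mulr_ge0 => //; exact: ltW.
    - by apply: le_trans q'1 _; have h := le_trans (pos_le _) (sC t x xb tT); lra_from h e1.
    - by apply: ler_wpM2r; [exact: ltW|lra_from KT1].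
  have s_0 : ev sP t x <= 0 by apply: s_le0 => //; [exact: ltW|exact: Hfar].
  rewrite pospart_le0 // mulr0 add0r in q'1.
  apply: (@le_trans _ _ (q^`().[ev sP t x] * (C1 + K * (2 * T + 1)))).
    apply: ler_wpM2l => //; apply: lerD.
      by apply: le_trans Lrho _; rewrite -[leRHS]mulr1; exact: ler_wpM2l.
    apply: le_trans KK _; apply: ler_wpM2l => //.
    by have h := le_trans (pos_le (t - s0)) tsT; lra_from h e1.
  rewrite mulrC /C3 -mulrA; apply: (@le_trans _ _ (1 * ((C1 + K * (2 * T + 1)) * e))).
    by rewrite mul1r; apply: ler_wpM2l => //; exact: addr_ge0.
  apply: ler_wpM2r; last by lra_from C0.
  by apply: mulr_ge0; [exact: addr_ge0|exact: ltW].
- move=> x Xx; have xb := XT_bounded Xx; rewrite ev_v subrr mulr0 add0r subr_gt0.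
  have s_0 : ev sP T x <= 0 by apply: s_le0 => //; exact: HfarT.
  have [_ _] := Hq _ (sC T x xb TT); rewrite pospart_le0 // expr0n /= mulr0n add0r => qe.
  apply: le_lt_trans eb; rewrite -mulrA; apply: ler_wpM2l => //.
  by apply: le_trans qe _; apply: ler_peMl; [exact: ltW|lra_from C30].
- move=> x Xx; rewrite ev_v subr0 bT gerBl mulr_ge0 //.
  exact: q_ge0 (XX_bounded Xx) O.
- move=> x Xx xr; have xb := XX_bounded Xx; rewrite ev_v subr0 bT.
  suff : d ^+ 4 / 16 <= q.[ev sP 0 x].
    by move=> /(ler_wpM2l m'0); rewrite mulrA m'E => h; lra_from h delta0.
  (* Of d^2, the distance term takes at most one half and the switch-off term, here pure
     approximation error, at most one quarter. *)
  have s_ge : d ^+ 2 / 4 <= ev sP 0 x.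
    have kap0 : ev kapP 0 x <= d ^+ 2 / 4.
      apply: le_trans eK; rewrite ev_kap; apply: ler_wpM2l => //.
      have [h _] := ts0 0 O; have [_ _] := Hq _ h.
      by rewrite pospart_le0 ?expr0n /= ?mulr0n ?add0r //; lra_from s00.
    have rho0' : ev rhoP 0 x <= d ^+ 2 / 2.
      rewrite ev_rho; apply: (@le_trans _ _ (A * (n%:R * r))).
        apply: ler_pM.
        - exact: le_trans (ap1 0 O).
        - by apply: sumr_ge0 => i _; exact: sqr_ge0.
        - exact: apA.
        - apply: (@le_trans _ _ (\sum_(i in V) r)).
            apply: ler_sum => i iV; have [-> _] := Hpsi i.
            rewrite -[leLHS]real_normK ?num_real // expr2.
            have h := ltW (xr i iV); have r1 : r <= 1 by rewrite ge_min lexx.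
            by apply: le_trans (ler_pM _ _ h (le_trans h r1)) _; rewrite ?mulr1.
          rewrite sumr_const -[leLHS]mulr_natl; apply: ler_wpM2r; last first.
            by rewrite ler_nat; have := max_card V; rewrite card_ord.
          by rewrite le_min ler01 divr_ge0 ?ltW.
      have rr : r * (2 * (A * (n%:R + 1))) <= d ^+ 2.
        by rewrite -ler_pdivlMr // ge_min lexx orbT.
      have r0 : 0 <= A * r by rewrite mulr_ge0 ?le_min ?ler01 ?divr_ge0 ?ltW //; lra_from A1.
      by lra_from rr r0.
    by rewrite ev_s; lra_from kap0 rho0'.
  have [_ + _] := Hq _ (sC 0 x xb O) => /(le_trans _); apply.
  have s1 : 0 <= ev sP 0 x by apply: le_trans s_ge; rewrite divr_ge0 ?ltW.
  rewrite pospart_pos //.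
  have -> : d ^+ 4 / 16 = (d ^+ 2 / 4) ^+ 2 by field.
  by apply: lerXn2r; rewrite ?nnegrE // divr_ge0 ?ltW.
Qed.

End Barrier.

(** * Iterated Lebesgue integrals *)

Section IteratedIntegrals.
Local Open Scope ereal_scope.

(** The integral is a supremum over the nonnegative simple functions below the integrand.
    Monotonicity in this generality lets [le_Leb] compare sets built from [ROA] with measurable
    ones. *)
Lemma le_integral_ge0 (d : measure_display) (T : measurableType d) (R : realType)
    (mu : {measure set T -> \bar R}) (f g : T -> \bar R) :
  (forall x, 0 <= f x) -> (forall x, f x <= g x) ->
  \int[mu]_x f x <= \int[mu]_x g x.
Proof.
move=> f0 fg; rewrite !ge0_integralE //; last by move=> x _; exact: le_trans (fg x).
rewrite !patch_setT; apply: ereal_sup_le => _ [h /= hf <-].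
by exists h => // x; exact: le_trans (hf x) (fg x).
Qed.

Variables (R : realType) (n : nat).
Local Notation mu := (@lebesgue_measure R).
Implicit Types (A B : set ('I_n -> R)) (g h : ('I_n -> R) -> \bar R) (x y : 'I_n -> R) (s : seq 'I_n).

(* ['I_n -> R] carries no sigma-algebra here: Borel measurability is expressed by
   composition with all measurable families of coordinates. *)
Definition mfun_coord g : Prop :=
  forall (d : measure_display) (O : measurableType d) (c : O -> 'I_n -> R),
    (forall i, measurable_fun [set: O] (fun o => c o i)) ->
    measurable_fun [set: O] (fun o => g (c o)).

Definition mset_coord (A : set ('I_n -> R)) : Prop :=
  forall (d : measure_display) (O : measurableType d) (c : O -> 'I_n -> R),
    (forall i, measurable_fun [set: O] (fun o => c o i)) ->
    measurable [set o | A (c o)].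

Lemma measurable_upd (d : measure_display) (O : measurableType d) (c : O -> 'I_n -> R)
    (u : O -> R) i : (forall j, measurable_fun [set: O] (fun o => c o j)) ->
  measurable_fun [set: O] u ->
  forall j, measurable_fun [set: O] (fun o => upd (c o) i (u o) j).
Proof. by move=> mc mu_ j; rewrite /upd; case: eqP => _; [exact: mu_|exact: mc]. Qed.

Lemma mfun_coord_upd g x i : mfun_coord g ->
  measurable_fun [set: R] (fun t : R => g (upd x i t)).
Proof.
move=> mg; apply: (mg _ _ (fun t => upd x i t)); by apply: measurable_upd.
Qed.

Lemma iint_ge0 s g x : (forall y, 0 <= g y) -> 0 <= iint s g x.
Proof.
move=> g0; elim: s x => [|i s IH] x //=; exact: integral_ge0.
Qed.

Lemma le_iint s g h x : (forall y, 0 <= g y) -> (forall y, g y <= h y) ->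
  iint s g x <= iint s h x.
Proof.
move=> g0 gh; elim: s x => [|i s IH] x //=.
by apply: le_integral_ge0 => t; [exact: iint_ge0|exact: IH].
Qed.

Lemma eq_iint s g h x :
  (forall y, (forall j, j \notin s -> y j = x j) -> g y = h y) ->
  iint s g x = iint s h x.
Proof.
elim: s x => [|i s IH] x gh /=; first exact: gh.
apply: eq_integral => t _; apply: IH => y yx; apply: gh => j.
by rewrite inE negb_or => /andP[ji js]; rewrite yx // /upd (negbTE ji).
Qed.

Lemma iint0 s x : iint s (fun=> 0) x = 0.
Proof.
elim: s x => [|i s IH] x //=.
by under eq_integral do rewrite IH; rewrite integral0.
Qed.

Lemma iint_cat s1 s2 g x : iint (s1 ++ s2) g x = iint s1 (iint s2 g) x.
Proof. by elim: s1 x => [|i s1 IH] x //=; apply: eq_integral => t _; exact: IH. Qed.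

(** The parameter and the integration variable are merged into a point of [O * R], to which the
    induction hypothesis applies; hence the quantification over all [O] in [mfun_coord]. Tonelli
    then integrates one factor out. *)
Lemma mfun_coord_iint s g : (forall y, 0 <= g y) -> mfun_coord g -> mfun_coord (iint s g).
Proof.
move=> g0 mg; elim: s => [|i s IH] //= d O c mc.
pose G (p : O * R) := iint s g (upd (c p.1) i p.2).
have mG : measurable_fun [set: O * R] G.
  apply: (IH _ _ (fun p : O * R => upd (c p.1) i p.2)); apply: measurable_upd => //.
  by move=> j; apply: (measurableT_comp (mc j)); exact: measurable_fst.
exact: (@measurable_fun_fubini_tonelli_F _ _ _ _ _ mu G mG (fun p => iint_ge0 _ _ g0)).
Qed.

Lemma iint_swap i j s g x : i != j -> (forall y, 0 <= g y) -> mfun_coord g ->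
  iint (i :: j :: s) g x = iint (j :: i :: s) g x.
Proof.
move=> ij g0 mg /=.
pose G (p : R * R) := iint s g (upd (upd x i p.1) j p.2).
have mG : measurable_fun [set: R * R] G.
  apply: (mfun_coord_iint s g0 mg (c := fun p : R * R => upd (upd x i p.1) j p.2)).
  apply: measurable_upd; last exact: measurable_snd.
  apply: measurable_upd; last exact: measurable_fst.
  by move=> k; exact: measurable_cst.
transitivity (\int[mu]_t \int[mu]_u G (t, u)); first by [].
rewrite (@fubini_tonelli _ _ _ _ _ mu mu G mG (fun p => iint_ge0 _ _ g0)).
apply: eq_integral => u _; apply: eq_integral => t _; rewrite /G /=; congr iint.
apply/funext => k; rewrite /upd; case: eqP => // ->.
by rewrite eq_sym (negbTE ij).
Qed.

(** Used to move the coordinates of a past innermost, where their integral is an [intOn]. *)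
Lemma iint_perm s s' g x : uniq s -> perm_eq s s' -> (forall y, 0 <= g y) -> mfun_coord g ->
  iint s g x = iint s' g x.
Proof.
move=> us ss g0 mg.
have front i r y : uniq (i :: r) -> forall r1 r2, r = r1 ++ r2 ->
    iint (r1 ++ i :: r2) g y = iint (i :: r) g y.
  move=> uir r1; elim: r1 r uir y => [|k r1 IH] r uir y r2 rE; first by rewrite rE.
  move: uir; rewrite {r}rE cat_cons /= inE negb_or => /andP[/andP[ik ir] /andP[_ ur]].
  transitivity (\int[mu]_t iint (i :: (r1 ++ r2)) g (upd y k t)).
    by apply: eq_integral => t _; apply: IH => //=; rewrite ir.
  by rewrite -/(iint (k :: i :: (r1 ++ r2)) g y) iint_swap // eq_sym.
elim: s s' x us ss => [|i s IH] s' x us ss.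
  by move/perm_size: ss => /esym/eqP; rewrite size_eq0 => /eqP ->.
have is' : i \in s' by rewrite -(perm_mem ss) mem_head.
case/splitPr: is' ss => r1 r2 ss.
have ss' : perm_eq s (r1 ++ r2).
  by rewrite -(perm_cons i); apply: (perm_trans ss); rewrite -cat1s perm_catCA.
have ur : uniq (i :: (r1 ++ r2)).
  by rewrite /= -(perm_mem ss') -(perm_uniq ss').
rewrite (front i (r1 ++ r2) x ur r1 r2 erefl) /=.
by apply: eq_integral => t _; apply: IH => //; case/andP: us.
Qed.

Lemma iintD s g h x : (forall y, 0 <= g y) -> (forall y, 0 <= h y) ->
  mfun_coord g -> mfun_coord h ->
  iint s (fun y => g y + h y) x = iint s g x + iint s h x.
Proof.
move=> g0 h0 mg mh; elim: s x => [|i s IH] x //=.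
rewrite -ge0_integralD //; try by move=> t _; exact: iint_ge0.
- by apply: eq_integral => t _; exact: IH.
- exact: mfun_coord_upd (mfun_coord_iint s g0 mg).
- exact: mfun_coord_upd (mfun_coord_iint s h0 mh).
Qed.

Lemma iint_nondecreasing_cvg s (g : nat -> ('I_n -> R) -> \bar R) h x :
  (forall m y, 0 <= g m y) -> (forall m, mfun_coord (g m)) ->
  (forall y, {homo (g^~ y) : m k / (m <= k)%N >-> m <= k}) ->
  (forall y, g m y @[m --> \oo] --> h y) ->
  iint s (g m) x @[m --> \oo] --> iint s h x.
Proof.
move=> g0 mg ndg gh; elim: s x => [|i s IH] x /=; first exact: gh.
have -> : \int[mu]_t iint s h (upd x i t) =
    \int[mu]_t limn (fun m => iint s (g m) (upd x i t)).
  by apply: eq_integral => t _; apply/esym/cvg_lim => //; exact: IH.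
apply: cvg_monotone_convergence => //.
- by move=> m; exact: mfun_coord_upd (mfun_coord_iint s (g0 m) (mg m)).
- by move=> m t _; exact: iint_ge0.
- by move=> t _ m k mk; apply: le_iint => // y; exact: ndg.
Qed.

Lemma iint_bounded s g x (C r : R) : uniq s -> (0 <= C)%R -> (0 <= r)%R ->
  (forall y, 0 <= g y) -> (forall y, g y <= C%:E) ->
  (forall y i, i \in s -> (r < `|y i|)%R -> g y = 0) ->
  iint s g x <= (C * (2 * r) ^+ size s)%:E.
Proof.
move=> us C0 r0 g0 gC; elim: s x us => [|i s IH] x us gs /=.
  by rewrite expr0 mulr1.
have [is_ {}us] := andP us.
pose D := (C * (2 * r) ^+ size s)%R.
have D0 : (0 <= D)%R by rewrite mulr_ge0 // exprn_ge0 // mulr_ge0.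
apply: (@le_trans _ _ (\int[mu]_(t in `[(- r)%R, r]) (cst D%:E) t)).
  rewrite [leRHS]integral_mkcond; apply: le_integral_ge0 => t; first exact: iint_ge0.
  rewrite patchE; case: ifPn => [_|].
    by apply: IH => // y j js; apply: gs; rewrite inE js orbT.
  rewrite notin_setE /= in_itv /= => /negP; rewrite -ler_norml -ltNge => rt.
  rewrite (@eq_iint s g (fun=> 0)) ?iint0 // => y yx.
  by apply: (gs y i); rewrite ?mem_head // yx // /upd eqxx.
have mE : mu `[(- r)%R, r]%classic <= (2 * r)%:E.
  rewrite lebesgue_measure_itv /= lte_fin; case: ifPn => _; last by rewrite lee_fin mulr_ge0.
  by rewrite -EFinD lee_fin opprK -mulr2n mulr_natl.
rewrite integral_cst //; apply: le_trans (lee_wpmul2l _ mE) _; rewrite ?lee_fin //.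
by rewrite /D -mulrA -exprSr.
Qed.

Lemma mset_coordI A B : mset_coord A -> mset_coord B -> mset_coord (A `&` B).
Proof. by move=> mA mB d O c mc; apply: measurableI; [exact: mA|exact: mB]. Qed.

Lemma mset_coordC A : mset_coord A -> mset_coord (~` A).
Proof. by move=> mA d O c mc; apply: measurableC; exact: mA. Qed.

Lemma mset_coordD A B : mset_coord A -> mset_coord B -> mset_coord (A `\` B).
Proof. by move=> mA mB; apply: mset_coordI => //; exact: mset_coordC. Qed.

Lemma mset_coordT : mset_coord setT.
Proof. by move=> d O c mc; exact: measurableT. Qed.

Lemma mset_coord0 : mset_coord set0.
Proof. by move=> d O c mc; exact: measurable0. Qed.

Lemma mset_coord_bigcup (A : nat -> set ('I_n -> R)) :
  (forall m, mset_coord (A m)) -> mset_coord (\bigcup_m A m).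
Proof.
move=> mA d O c mc.
have -> : [set o | (\bigcup_m A m) (c o)] = \bigcup_m [set o | A m (c o)].
  by apply/seteqP; split => o [m _ Am]; exists m.
by apply: bigcup_measurable => m _; exact: mA.
Qed.

Lemma mset_coord_bigcap_seq (I : eqType) (r : seq I) (A : I -> set ('I_n -> R)) :
  (forall i, i \in r -> mset_coord (A i)) ->
  mset_coord [set x | forall i, i \in r -> A i x].
Proof.
elim: r => [|i r IH] mA.
  have -> : [set x | forall i, i \in [::] -> A i x] = setT by apply/seteqP.
  exact: mset_coordT.
have -> : [set x | forall j, j \in i :: r -> A j x] = A i `&` [set x | forall j, j \in r -> A j x].
  apply/seteqP; split => x.
    by move=> Ax; split; [apply: Ax; rewrite mem_head|move=> j jr; apply: Ax; rewrite inE jr orbT].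
  by move=> [Ai Ar] j; rewrite inE => /predU1P[->|/Ar].
apply: mset_coordI; first by apply: mA; rewrite mem_head.
by apply: IH => j jr; apply: mA; rewrite inE jr orbT.
Qed.

Lemma measurable_ev (p : SPoly R n) (t : R) (d : measure_display) (O : measurableType d)
    (c : O -> 'I_n -> R) :
  (forall i, measurable_fun [set: O] (fun o => c o i)) ->
  measurable_fun [set: O] (fun o => ev p t (c o)).
Proof.
move=> mc; elim/spoly_ind: p => [a|j|p q mp mq|p q mp mq].
- by under eq_fun do rewrite evC; exact: measurable_cst.
- have [->|[i ->]] := ord_tvxvP j.
    by under eq_fun do rewrite ev_tv; exact: measurable_cst.
  by under eq_fun do rewrite ev_xv; exact: mc.
- by under eq_fun do rewrite evD; exact: measurable_funD.
- by under eq_fun do rewrite evM; exact: measurable_funM.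
Qed.

Lemma mset_coord_ev_ge (p : SPoly R n) (t a : R) : mset_coord [set x | (a <= ev p t x)%R].
Proof.
move=> d O c mc; have mp := measurable_ev p t mc.
have := mp measurableT _ (measurable_itv `[a, +oo[); rewrite setTI.
by congr measurable; apply/seteqP; split => o /=; rewrite in_itv /= andbT.
Qed.

Lemma mset_coord_lt i (a r : R) : mset_coord [set x | (`|x i - a| < r)%R].
Proof.
move=> d O c mc.
have mp : measurable_fun [set: O] (fun o => c o i - a)%R.
  by apply: measurable_funB => //; exact: measurable_cst.
have := mp measurableT _ (measurable_itv `](- r)%R, r[); rewrite setTI.
by congr measurable; apply/seteqP; split => o /=; rewrite in_itv /= ltr_norml.
Qed.

Lemma mset_coord_indic A : mset_coord A -> mfun_coord (fun x => (\1_A x)%:E).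
Proof.
move=> mA d O c mc; apply/measurable_EFinP.
have -> : (fun o => \1_A (c o)) = \1_[set o | A (c o)] :> (O -> R).
  by apply/funext => o; rewrite !indicE; congr (_%:R); apply/idP/idP; rewrite !inE.
by apply: measurable_indic; exact: mA.
Qed.

Lemma mfun_coord_indicM A (p : SPoly R n) : mset_coord A ->
  mfun_coord (fun x => (\1_A x * ev p 0 x)%:E).
Proof.
move=> mA d O c mc; apply/measurable_EFinP.
apply: measurable_funM; last exact: measurable_ev.
by apply/measurable_EFinP; exact: mset_coord_indic mc.
Qed.

Lemma Leb_ge0 A : 0 <= Leb A.
Proof. by apply: iint_ge0 => y; rewrite lee_fin. Qed.

Lemma le_Leb A B : A `<=` B -> Leb A <= Leb B.
Proof.
move=> AB; apply: le_iint => y; rewrite lee_fin // !indicE ler_nat.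
case: (boolP (y \in A)) => // /set_mem/AB yB; by rewrite mem_set.
Qed.

Lemma Leb_setU A B : mset_coord A -> mset_coord B -> Leb (A `|` B) <= Leb A + Leb B.
Proof.
move=> mA mB; rewrite /Leb -iintD; try exact: mset_coord_indic; try by move=> y; rewrite lee_fin.
apply: le_iint => y; first by rewrite lee_fin.
rewrite -EFinD lee_fin !indicE -natrD ler_nat in_setU.
by case: (y \in A); case: (y \in B).
Qed.

Lemma Leb_disjoint A B : mset_coord A -> mset_coord B -> A `&` B = set0 ->
  Leb (A `|` B) = Leb A + Leb B.
Proof.
move=> mA mB AB; rewrite /Leb -iintD; try exact: mset_coord_indic; try by move=> y; rewrite lee_fin.
apply: eq_iint => y _; rewrite -EFinD; congr (_%:E); rewrite !indicE -natrD in_setU.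
case: (boolP (y \in A)) => yA; case: (boolP (y \in B)) => yB //.
have : (A `&` B) y by split; exact: set_mem.
by rewrite AB.
Qed.

End IteratedIntegrals.

(** * Sparsity graph and blocks *)

Section SparsityGraph.
Variables (R : realType) (n N : nat) (blk : 'I_n -> 'I_N) (f : 'I_n -> SPoly R n).
Hypothesis acyclic_f : acyclic blk f.

(** By acyclicity a successor of [b] no longer reaches [b], so the set of descendants shrinks
    strictly; the induction is on its size. *)
Lemma connect_leaf b : exists2 a, leaf blk f a & connect (E blk f) b a.
Proof.
have [m] := ubnP #|[set a | connect (E blk f) b a]%SET|.
elim: m b => // m IH b hb.
have [lb|] := boolP (leaf blk f b); first by exists b.
rewrite negb_forall => /existsP[c]; rewrite negbK => bc.
have [|a la ca] := IH c; last by exists a => //; exact: connect_trans (connect1 bc) ca.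
rewrite -ltnS; apply: leq_trans hb; rewrite ltnS; apply: proper_card.
apply/properP; split.
  by apply/fintype.subsetP => a; rewrite !inE; exact: connect_trans (connect1 bc).
exists b; first by rewrite inE connect0.
by rewrite inE; exact: acyclic_f.
Qed.

Lemma past_mono a b : connect (E blk f) a b -> past blk f a \subset past blk f b.
Proof.
by move=> ab; apply/fintype.subsetP => c; rewrite !inE => /connect_trans; apply.
Qed.

Lemma Vr_mono (B B' : {set 'I_N}) : B \subset B' -> Vr blk B \subset Vr blk B'.
Proof. by move=> /fintype.subsetP BB; apply/fintype.subsetP => i; rewrite !inE => /BB. Qed.

(** Pasts grow along paths and every block reaches a leaf, so the largest past is that of a leaf. *)
Lemma omega_leaves (l : nat) (lf : 'I_l -> 'I_N) :
  (forall a, leaf blk f a <-> exists r, lf r = a) ->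
  \max_(r < l) #|Vr blk (past blk f (lf r))| = omega blk f.
Proof.
move=> lfP; apply/eqP; rewrite eqn_leq; apply/andP; split.
  apply/bigmax_leqP => r _.
  exact: (leq_bigmax (F := fun b => #|Vr blk (past blk f b)|) (lf r)).
apply/bigmax_leqP => b _; have [a /lfP[r <-] ba] := connect_leaf b.
apply: leq_trans (leq_bigmax (F := fun r => #|Vr blk (past blk f (lf r))|) r).
by apply: subset_leq_card; apply: Vr_mono; exact: past_mono.
Qed.

Lemma past_closed b i : (forall i, ~~ depb (f i) (tv n)) ->
  i \in Vr blk (past blk f b) -> dep_only (Svars (Vr blk (past blk f b))) (f i).
Proof.
move=> ft; rewrite !inE => ib j; have [->|[k ->]] := ord_tvxvP j; first by move=> _; exact: ft.
rewrite xv_Svars !inE; apply: contra => dk.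
(* [E] has no loops, so dependence inside a block is treated apart from the edges. *)
have [->//|ki] := eqVneq (blk k) (blk i).
apply: connect_trans ib; apply: connect1; rewrite /E ki /=.
by apply/existsP; exists k; apply/existsP; exists i; rewrite !eqxx.
Qed.

End SparsityGraph.

(** * Constraint sets of blocks and their Positivstellensatz *)

Section Blocks.
Variables (R : realType) (n N : nat) (blk : 'I_n -> 'I_N).
Implicit Types (g : 'I_N -> seq (SPoly R n)) (B : {set 'I_N}) (x y : 'I_n -> R).

Definition block_dep g := forall j p, p \in g j -> dep_only (Svars (Jset blk j)) p.
Definition has_balls g := forall j, exists rho : R, ball_con blk j rho \in g j.

Lemma Jset_Vr j B : j \in B -> Jset blk j \subset Vr blk B.
Proof. by move=> jB; apply/fintype.subsetP => i; rewrite !inE => /eqP ->. Qed.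

Lemma XB_dep g B x y : block_dep g -> (forall i, i \in Vr blk B -> x i = y i) ->
  XB g B x -> XB g B y.
Proof.
move=> dg xy Xx j jB p pg; rewrite -(@ev_dep_space _ _ (Jset blk j) p 0 0 x y (dg j p pg)).
  exact: Xx pg.
by move=> i /(fintype.subsetP (Jset_Vr jB)); exact: xy.
Qed.

Lemma gensOfP g B p : reflect (exists2 j, j \in B & p \in g j) (p \in gensOf g B).
Proof.
apply: (iffP flattenP) => [[s /mapP[j]]|[j jB pj]].
  by rewrite mem_enum => jB -> pj; exists j.
by exists (g j) => //; apply/mapP; exists j => //; rewrite mem_enum.
Qed.

Lemma gensOf_dep g B p : block_dep g -> p \in gensOf g B -> dep_only (Svars (Vr blk B)) p.
Proof.
move=> dg /gensOfP[j jB /dg]; apply: dep_only_sub.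
exact: Svars_mono (Jset_Vr jB).
Qed.

Lemma ball_bounded g : has_balls g ->
  exists2 r, 0 <= r & forall B x i, XB g B x -> i \in Vr blk B -> `|x i| <= r.
Proof.
move=> /choice[rho Hrho]; exists (\sum_j `|rho j|); first by apply: sumr_ge0.
move=> B x i Xx; rewrite inE => iB.
have := Xx _ iB _ (Hrho (blk i)).
rewrite /ball_con evB evC ev_sum subr_ge0 (bigD1 i) /=; last by rewrite inE.
rewrite evX ev_xv => h.
have : x i ^+ 2 <= rho (blk i) ^+ 2.
  apply: le_trans h; rewrite lerDl; apply: sumr_ge0 => k _.
  by rewrite evX sqr_ge0.
rewrite -(real_normK (num_real (x i))) -(real_normK (num_real (rho _))) => h2.
have : `|x i| <= `|rho (blk i)| by rewrite -(ler_pXn2r (n := 2)) // nnegrE.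
by move=> /le_trans; apply; rewrite (bigD1 (blk i)) //= lerDl sumr_ge0.
Qed.

(** Adding the squares of the other coordinates of the block to its ball constraint leaves rho^2 -
    x_i^2. *)
Lemma ball_archimedean g B i : has_balls g -> i \in Vr blk B ->
  exists c, qgen (gensOf g B) (Cst n c - Xv R (xv i) ^+ 2).
Proof.
move=> hg; rewrite inE => iB; have [rho Hrho] := hg (blk i).
exists (rho ^+ 2).
have -> : Cst n (rho ^+ 2) - Xv R (xv i) ^+ 2 =
    \sum_(k in Jset blk (blk i) | k != i) Xv R (xv k) ^+ 2 + ball_con blk (blk i) rho.
  by rewrite /ball_con [X in _ = _ + (_ - X)](bigD1 i) ?inE //=; ring.
apply: qgenD; last by apply: qgen_mem; apply/gensOfP; exists (blk i).
apply: (big_ind (qgen (gensOf g B))); [exact: qgen0|exact: qgenD|].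
by move=> k _; rewrite -[_ ^+ 2]addr0; apply: qgen_sqr; exact: qgen0.
Qed.

Lemma meval_pt (z : 'I_n.+1 -> R) p : mpoly.meval z p = ev p (z (tv n)) (fun i => z (xv i)).
Proof.
by apply: mpoly.meval_eq => j; have [->|[i ->]] := ord_tvxvP j; rewrite ?pt_tv ?pt_xv.
Qed.

Lemma XB_meval g B (z : 'I_n.+1 -> R) : block_dep g ->
  (forall p, p \in gensOf g B -> 0 <= mpoly.meval z p) -> XB g B (fun i => z (xv i)).
Proof.
move=> dg gz j jB p pj; have := gz p; rewrite meval_pt => h.
rewrite (ev_dep_space 0 (z (tv n)) (dg j p pj) (y := fun i => z (xv i))) //.
by apply: h; apply/gensOfP; exists j.
Qed.

Lemma putinar_space g B h : block_dep g -> has_balls g -> dep_only (Svars (Vr blk B)) h ->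
  (forall x, XB g B x -> 0 < ev h 0 x) ->
  exists k, qmod k (Svars (Vr blk B)) (gensOf g B) h.
Proof.
move=> dg bg dh hpos; apply: putinar => //.
- by move=> p; exact: gensOf_dep.
- move=> j; have [->|[i ->]] := ord_tvxvP j; first by rewrite tv_Svars.
  by rewrite xv_Svars; exact: ball_archimedean.
- move=> z _ gz; have := hpos _ (XB_meval dg gz).
  by rewrite meval_pt (ev_dep_space 0 (z (tv n)) dh (y := fun i => z (xv i))).
Qed.

Lemma putinar_time g B h (T : R) : 0 < T -> block_dep g -> has_balls g ->
  dep_only (Stvars (Vr blk B)) h ->
  (forall t x, 0 <= t <= T -> XB g B x -> 0 < ev h t x) ->
  exists k, qmod k (Stvars (Vr blk B)) (tTpoly n T :: gensOf g B) h.
Proof.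
move=> T0 dg bg dh hpos; apply: putinar => //.
- move=> p; rewrite inE => /predU1P[->|pg]; last first.
    by apply: dep_only_sub (gensOf_dep dg pg); exact: Svars_sub.
  have dt : dep_only (Stvars (Vr blk B)) (Xv R (tv n)) by apply: dep_onlyXv; exact: tv_Stvars.
  by apply: dep_onlyM => //; apply: dep_onlyB => //; exact: dep_onlyC.
- move=> j; have [->|[i ->]] := ord_tvxvP j => [_|].
    (* T^2 - t^2 = (T - t)^2 + 2 t (T - t). *)
    exists (T ^+ 2).
    have -> : Cst n (T ^+ 2) - Xv R (tv n) ^+ 2 =
        (Cst n T - Xv R (tv n)) ^+ 2 + (1 ^+ 2 * tTpoly n T + (1 ^+ 2 * tTpoly n T + 0)).
      have CM (a b : R) : Cst n (a * b) = Cst n a * Cst n b by exact: mpoly.mpolyCM.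
      by rewrite expr2 CM /tTpoly; ring.
    apply: qgen_sqr; apply: qgen_mul; first by rewrite mem_head.
    by apply: qgen_mul; [rewrite mem_head|exact: qgen0].
  rewrite xv_Stvars => iV; have [c Hc] := ball_archimedean bg iV.
  by exists c; apply: qgen_sub Hc => p pg; rewrite inE pg orbT.
- move=> z _ gz; rewrite meval_pt; apply: hpos.
    have := gz (tTpoly n T); rewrite mem_head => /(_ isT).
    rewrite meval_pt evM evB ev_tv evC; set t := z (tv n) => htT.
    by apply/andP; split; rewrite leNgt; apply/negP => ht; nra.
  by apply: XB_meval => // p pg; apply: gz; rewrite inE pg orbT.
Qed.

(** Some defining polynomial is negative at [y], and its Lipschitz bound keeps it negative nearby.
    Of the 3d, one d is later spent on the motion of the curve. *)
Lemma far_from_XB g B y r : block_dep g -> (forall i, `|y i| <= r) ->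
  (forall x, XB g B x -> forall i, i \in Vr blk B -> `|x i| <= r) -> ~ XB g B y ->
  exists2 d, 0 < d & forall x, XB g B x -> exists2 i, i \in Vr blk B & 3 * d < `|x i - y i|.
Proof.
move=> dg yr Xr nXy.
have [j jB [p pj py]] : exists2 j, j \in B & exists2 p, p \in g j & ev p 0 y < 0.
  apply: contrapT => h; apply: nXy => j jB p pj; rewrite leNgt; apply/negP => py.
  by apply: h; exists j => //; exists p.
have r0 : 0 <= `|r| by [].
have [L [C [L0 _ Hp]]] := ev_lip p r0.
have Ln : 0 <= L * n%:R by exact: mulr_ge0.
pose d := - ev p 0 y / (3 * (L * n%:R) + 1).
have D0 : 0 < 3 * (L * n%:R) + 1 by lra.
have d0 : 0 < d by rewrite divr_gt0 // oppr_gt0.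
have dE : d * (3 * (L * n%:R) + 1) = - ev p 0 y by rewrite divfK // gt_eqF.
exists d => // x Xx; apply: contrapT => far.
(* Coordinates outside the blocks of [B] are unbounded on the cylinder; those of [y] are put in
   their place. *)
pose x' i := if i \in Vr blk B then x i else y i.
have x'y i : `|x' i - y i| <= 3 * d.
  rewrite /x'; case: ifPn => iV; last by rewrite subrr normr0 mulr_ge0 // ltW.
  by rewrite leNgt; apply/negP => xi; apply: far; exists i.
have x'r i : `|x' i| <= `|r|.
  by rewrite /x'; case: ifPn => iV; apply: le_trans (ler_norm r); [exact: Xr|exact: yr].
have yr' i : `|y i| <= `|r| by exact: le_trans (yr i) (ler_norm r).
have px : 0 <= ev p 0 x'.
  have Xx' : XB g B x' by apply: XB_dep Xx => // i iV; rewrite /x' iV.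
  exact: Xx' pj.
have [_ h] := Hp _ _ x'r yr'.
have h2 : L * \sum_i `|x' i - y i| <= L * (n%:R * (3 * d)).
  apply: ler_wpM2l => //; apply: le_trans (ler_sum _ (fun i _ => x'y i)) _.
  by rewrite sumr_const card_ord -[leLHS]mulr_natl.
move: h; rewrite ler_norml => /andP[_ h].
have : ev p 0 x' - ev p 0 y <= L * (n%:R * (3 * d)) by exact: le_trans h h2.
lra.
Qed.

End Blocks.

(** * Convergence of the decoupled hierarchy *)

Lemma indic_iff (R : realType) (I : Type) (A : set I) x y :
  (A x <-> A y) -> \1_A x = \1_A y :> R.
Proof.
move=> Axy; rewrite !indicE; have [Ax|nAx] := pselect (A x).
  by rewrite !mem_set //; apply/Axy.
by rewrite !memNset // => /Axy.
Qed.

Lemma Leb_split (R : realType) (n : nat) (A B : set ('I_n -> R)) :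
  mset_coord A -> mset_coord B -> Leb A = (Leb (A `&` B) + Leb (A `\` B))%E.
Proof.
move=> mA mB; rewrite -Leb_disjoint; first 1 last.
- exact: mset_coordI.
- exact: mset_coordD.
- by apply/seteqP; split => x // [[_ Bx] [_ nBx]].
congr Leb; apply/seteqP; split => x; last by case=> [[]|[]].
by move=> Ax; have [Bx|nBx] := pselect (B x); [left|right].
Qed.

Section DecoupledHierarchy.
Variables (R : realType) (n N : nat) (blk : 'I_n -> 'I_N) (f : 'I_n -> SPoly R n).
Variables (gs gsT : 'I_N -> seq (SPoly R n)) (T : R).
Hypothesis gs_dep : block_dep blk gs.
Hypothesis gsT_dep : block_dep blk gsT.
Hypothesis gs_balls : has_balls blk gs.
Hypothesis gsT_balls : has_balls blk gsT.
Hypothesis T0 : 0 < T.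
Implicit Types (B : {set 'I_N}) (x : 'I_n -> R) (W A : set ('I_n -> R)) (v w : SPoly R n).

Definition past_closed_blocks B : Prop :=
  forall i, i \in Vr blk B -> dep_only (Svars (Vr blk B)) (f i).

(** The region of attraction of the subsystem on [B], as a cylinder: at positive times only the
    coordinates in [Vr blk B] are constrained. *)
Definition admissible B x : Prop := exists phi : R -> 'I_n -> R,
  [/\ phi 0 = x,
      (forall i, i \in Vr blk B -> {within `[0, T], continuous (phi^~ i)}),
      (forall t, 0 < t < T -> forall i, i \in Vr blk B ->
         is_derive t 1 (phi^~ i) (ev (f i) t (phi t))),
      (forall t, 0 <= t <= T -> XB gs B (phi t)) & XB gsT B (phi T)].

(* Polynomial barriers, arbitrarily deep on [W] and negligible elsewhere: this makes
   the property stable under finite unions. *)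
Definition separated B W : Prop := forall m delta : R, 0 <= m -> 0 < delta ->
  exists v, [/\ dep_only (Stvars (Vr blk B)) v,
    (forall t x, 0 <= t <= T -> XB gs B x -> ev (Lie f (Vr blk B) v) t x < 0),
    (forall x, XB gsT B x -> 0 < ev v T x),
    (forall x, XB gs B x -> ev v 0 x <= delta) &
    (forall x, XB gs B x -> W x -> ev v 0 x <= - m)].

Lemma separated0 B : separated B set0.
Proof.
move=> m delta m0 d0; have T0' := T0; pose b := delta / (T + 1); have T1 : 0 < T + 1 by lra.
have b0 : 0 < b by rewrite divr_gt0.
have bT : b * (T + 1) = delta by rewrite divfK // gt_eqF.
exists (Cst n b * (Cst n (T + 1) - Xv R (tv n))).
have dt : dep_only (Stvars (Vr blk B)) (Xv R (tv n)).
  by apply: dep_onlyXv; exact: tv_Stvars.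
split => //.
- by apply: dep_onlyM; [exact: dep_onlyC|apply: dep_onlyB => //; exact: dep_onlyC].
- move=> t x _ _; have -> : Lie f (Vr blk B) (Cst n b * (Cst n (T + 1) - Xv R (tv n))) = - Cst n b.
    by rewrite LieM LieB !LieC Lie_tv; ring.
  by rewrite evN evC oppr_lt0.
- by move=> x _; rewrite evM evB ev_tv !evC mulr_gt0 //; lra.
- by move=> x _; rewrite evM evB ev_tv !evC subr0 bT.
Qed.

Lemma separatedU B W W' : separated B W -> separated B W' -> separated B (W `|` W').
Proof.
move=> sW sW' m delta m0 d0.
have d2 : 0 < delta / 2 by rewrite divr_gt0.
(* On the box of one summand the other may be as large as [delta / 2], hence the extra depth. *)
have md : 0 <= m + delta by lra.
have [v [dv v1 v2 v3 v4]] := sW _ _ md d2; have [v' [dv' v1' v2' v3' v4']] := sW' _ _ md d2.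
exists (v + v'); split; first exact: dep_onlyD.
- by move=> t x tT Xx; rewrite LieD evD; have := v1 t x tT Xx; have := v1' t x tT Xx; lra.
- by move=> x Xx; rewrite evD; have := v2 x Xx; have := v2' x Xx; lra.
- by move=> x Xx; rewrite evD; have := v3 x Xx; have := v3' x Xx; lra.
- move=> x Xx; rewrite evD; have := v3 x Xx; have := v3' x Xx.
  by move=> ? ? [/(v4 x Xx)|/(v4' x Xx)]; lra.
Qed.

Lemma separated_sub B W W' : W' `<=` W -> separated B W -> separated B W'.
Proof.
move=> WW sW m delta m0 d0; have [v [dv v1 v2 v3 v4]] := sW _ _ m0 d0.
by exists v; split => // x Xx /WW; exact: v4.
Qed.

(** [w] is a polynomial slightly above the positive part of v (0, .) + 1. Depth 1 makes this part
    vanish on [W], and v (0, .) <= eta / 2 keeps it below 1 + eta / 2 elsewhere. All four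
    constraints are strict, so [k0] bounds the four Putinar degrees and the degrees of [v] and
    [w]. *)
Lemma separated_feasible B W eta : past_closed_blocks B -> separated B W -> 0 < eta ->
  exists w k0, (forall k, (k0 <= k)%N -> exists v, feas_dec blk f gs gsT T k B v w) /\
    (forall x, XB gs B x -> ev w 0 x <= \1_(~` W) x + eta).
Proof.
move=> cB sW eta0; have e2 : 0 < eta / 2 by rewrite divr_gt0.
have [v [dv v1 v2 v3 v4]] := sW _ _ ler01 e2.
have [r r0 Hr] := ball_bounded gs_balls.
have [L [C [_ C0 HC]]] := ev_lip v r0.
have vC x : XB gs B x -> `|ev v 0 x| <= C.
  move=> Xx; pose x' i := if i \in Vr blk B then x i else 0.
  have x'r i : `|x' i| <= r by rewrite /x'; case: ifPn => [iV|_]; [exact: Hr Xx iV|rewrite normr0].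
  by have [+ _] := HC _ _ x'r x'r; rewrite (@ev_dep _ _ _ v 0 x x' dv) // => i iV; rewrite /x' iV.
have [g Hg] := pospart_approx (C + 1) e2.
pose w := emb g (vat 0 v + 1).
have ev_w x : ev w 0 x = g.[ev v 0 x + 1] by rewrite ev_emb evD ev_vat ev1.
have Hw x : XB gs B x -> pospart (ev v 0 x + 1) < ev w 0 x <= pospart (ev v 0 x + 1) + eta / 2.
  move=> Xx; rewrite ev_w; apply: Hg; apply: le_trans (ler_normD _ _) _.
  by rewrite normr1 lerD2r vC.
have dw : dep_only (Svars (Vr blk B)) w.
  by apply: dep_only_emb; apply: dep_onlyD; [exact: dep_only_vat|exact: dep_only1].
have [k1 q1] : exists k, qmod k (Stvars (Vr blk B)) (tTpoly n T :: gensOf gs B) (- Lie f (Vr blk B) v).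
  apply: putinar_time => //.
    apply: dep_onlyN; apply: dep_only_Lie => // i iV.
    by apply: dep_only_sub (cB i iV); exact: Svars_sub.
  by move=> t x tT Xx; rewrite evN oppr_gt0; exact: v1.
have [k2 q2] : exists k, qmod k (Svars (Vr blk B)) (gensOf gsT B) (vat T v).
  apply: putinar_space => //; first exact: dep_only_vat.
  by move=> x Xx; rewrite ev_vat; exact: v2.
have [k3 q3] : exists k, qmod k (Svars (Vr blk B)) (gensOf gs B) w.
  apply: putinar_space => // x /Hw/andP[+ _]; apply: le_lt_trans.
  exact: pospart_ge0.
have [k4 q4] : exists k, qmod k (Svars (Vr blk B)) (gensOf gs B) (w - vat 0 v - 1).
  apply: putinar_space => //.
    by apply: dep_onlyB; [apply: dep_onlyB => //; exact: dep_only_vat|exact: dep_only1].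
  move=> x /Hw/andP[+ _]; rewrite !evB ev_vat ev1.
  by have := pospart_ge (ev v 0 x + 1); lra.
exists w, (\max_(k <- [:: k1; k2; k3; k4; mpoly.msize v; mpoly.msize w]) k)%N; split.
  move=> k; rewrite !big_cons big_nil !geq_max => /and5P[? ? ? ? /and3P[? ? _]].
  exists v; split; split => //; try (by apply: deg_le_mono (deg_le_msize _));
    by [apply: qmod_mono q1|apply: qmod_mono q2|apply: qmod_mono q3|apply: qmod_mono q4].
move=> x Xx; have /andP[_ h] := Hw x Xx; apply: le_trans h _.
rewrite indicE; have [xW|xW] := boolP (x \in ~` W).
  have -> : true%:R = 1 :> R by [].
  have h3 := v3 x Xx; have [s0|s0] := leP (ev v 0 x + 1) 0.
    by rewrite (pospart_le0 s0); lra.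
  by rewrite (pospart_pos (ltW s0)); lra.
have Wx : W x by move: xW; rewrite notin_setE /= => /contrapT.
rewrite pospart_le0 ?mulr0n; first lra.
by have := v4 x Xx Wx; lra.
Qed.

Lemma ev_no_time p t t' x : ~~ depb p (tv n) -> ev p t x = ev p t' x.
Proof.
move=> dp; apply: (@ev_dep_space _ _ [set: 'I_n]%SET) => // j.
have [->|[i ->]] := ord_tvxvP j; first by [].
by rewrite xv_Svars inE.
Qed.

Lemma feas_dec_admissible k B v w x : feas_dec blk f gs gsT T k B v w ->
  admissible B x -> 1 <= ev w 0 x.
Proof.
move=> [[_ _ dv dw] [q1 q2 q3 q4]] [phi [phi0 cphi dphi Xphi XTphi]].
have spos y t : XB gs B y -> forall g, g \in gensOf gs B -> 0 <= mpoly.meval (pt t y) g.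
  move=> Xy g /gensOfP[j jB gj]; rewrite -/(ev g t y).
  by rewrite (@ev_dep_space _ _ _ g t 0 y y (gs_dep gj)) //; exact: Xy gj.
have vT : 0 <= ev v T (phi T).
  rewrite -(ev_vat T v 0); apply: qmod_ge0 q2 _ => g /gensOfP[j jB gj].
  exact: XTphi gj.
have v0 : ev v T (phi T) <= ev v 0 (phi 0).
  apply: (Lie_nonincreasing T0 dv cphi dphi) => t /andP[t0 t1].
  rewrite -oppr_ge0 -evN; have tT : 0 <= t <= T by rewrite !ltW.
  apply: qmod_ge0 q1 _ => g; rewrite inE => /predU1P[->|]; last by apply: spos; exact: Xphi.
  by rewrite -/(ev _ t (phi t)) evM evB ev_tv evC mulr_ge0 ?subr_ge0 ?ltW.
have := qmod_ge0 q4 (spos _ 0 (Xphi 0 _)); rewrite lexx ltW // => /(_ isT).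
by rewrite -/(ev _ 0 (phi 0)) !evB ev_vat ev1 phi0 in v0 *; lra.
Qed.

Lemma feas_dec_ge0 k B v w x : feas_dec blk f gs gsT T k B v w ->
  XB gs B x -> 0 <= ev w 0 x.
Proof.
move=> [_ [_ _ q3 _]] Xx; apply: qmod_ge0 q3 _ => g /gensOfP[j jB gj]; exact: Xx gj.
Qed.

(** [phi] precedes [B]: it follows the clamped field in the full state space and obeys the equations
    of a past while it stays in the set of that past. A missed target or an exit time supplies the
    data for [barrier]. *)
Lemma admissible_or_separated x : exists2 phi : R -> 'I_n -> R,
  [/\ phi 0 = x, (forall i, {within `[0, T], continuous (phi^~ i)}) &
      forall t i, 0 < t < T -> forall B, past_closed_blocks B -> i \in Vr blk B ->
        XB gs B (phi t) -> is_derive t 1 (phi^~ i) (ev (f i) t (phi t))] &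
  forall B, past_closed_blocks B -> XB gs B x ->
    ((forall t, 0 <= t <= T -> XB gs B (phi t)) /\ XB gsT B (phi T)) \/
    exists2 r : R, 0 < r &
      separated B [set y | forall i, i \in Vr blk B -> `|y i - x i| < r].
Proof.
have T0' := T0; have [r1 r10 Hr1] := ball_bounded gs_balls; have [r2 r20 Hr2] := ball_bounded gsT_balls.
(* One cube contains constraint and target sets, so a single clamped field serves all pasts. *)
pose rho := r1 + r2; have rho0 : 0 <= rho by rewrite addr_ge0.
have Xrho B y i : XB gs B y -> i \in Vr blk B -> `|y i| <= rho.
  by move=> Xy iV; apply: le_trans (Hr1 _ _ _ Xy iV) _; rewrite lerDl.
have XTrho B y i : XB gsT B y -> i \in Vr blk B -> `|y i| <= rho.
  by move=> Xy iV; apply: le_trans (Hr2 _ _ _ Xy iV) _; rewrite lerDr.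
have [L [M [L0 Flip Fb]]] := clampF_lip_bounded f rho0.
have [phi phi_sol] := picard (ltW T0) L0 Flip (clampF_approx f rho 0 T) x.
have phi0 := approx_sol0 (ltW T0) phi_sol.
exists phi.
  split => //; first by move=> i; exact (@approx_sol_continuous _ _ _ _ _ (ltW T0) Fb _ _ phi_sol i).
  move=> t i tT B cB iV Xphi.
  rewrite (@clampF_id _ _ f (Vr blk B) rho (XB gs B) cB _ _ i t Xphi iV).
    exact (@approx_sol_derive _ _ _ _ _ _ (ltW T0) L0 Flip Fb _ _ phi_sol t i tT).
  by move=> y Xy j jV; exact: Xrho Xy jV.
move=> B cB XBx.
have XXb y : XB gs B y -> forall i, i \in Vr blk B -> `|y i| <= rho.
  by move=> Xy i; exact: Xrho.
have XTb y : XB gsT B y -> forall i, i \in Vr blk B -> `|y i| <= rho.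
  by move=> Xy i; exact: XTrho.
have bar := barrier T0 rho0 cB XXb XTb L0 Flip Fb phi_sol.
pose Phi : R := rho + \sum_i `|x i| + `|M| * T.
have S0 : 0 <= \sum_i `|x i| by exact: sumr_ge0.
have MT0 : 0 <= `|M| * T by rewrite mulr_ge0 // ltW.
have O : 0 <= (0 : R) <= T by rewrite lexx ltW.
have lip s t i : 0 <= s <= T -> 0 <= t <= T -> `|phi s i - phi t i| <= `|M| * `|s - t|.
  move=> sT tT; apply: le_trans (approx_sol_lip Fb phi_sol i sT tT) _.
  by apply: ler_wpM2r => //; exact: ler_norm.
have phiB t i : 0 <= t <= T -> `|phi t i| <= Phi.
  move=> tT; rewrite -(subrK (phi 0 i) (phi t i)); apply: le_trans (ler_normD _ _) _.
  have h1 := lip t 0 i tT O; have h2 : `|phi 0 i| <= \sum_j `|x j|.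
    by rewrite phi0 (bigD1 i) //= lerDl sumr_ge0.
  have h3 : `|M| * `|t - 0| <= `|M| * T.
    by apply: ler_wpM2l => //; case/andP: tT => t0 t1; rewrite subr0 ger0_norm.
  rewrite /Phi; lra.
have XPhi (g : 'I_N -> seq (SPoly R n)) : (forall y i, XB g B y -> i \in Vr blk B -> `|y i| <= rho) ->
    forall y, XB g B y -> forall i, i \in Vr blk B -> `|y i| <= Phi.
  move=> h y Xy i iV; apply: le_trans (h y i Xy iV) _; rewrite /Phi; lra.
have TT : 0 <= T <= T by rewrite lexx ltW.
have [XTphi|nXT] := pselect (XB gsT B (phi T)); last first.
  right; have [d d0 far] := far_from_XB gsT_dep (phiB T ^~ TT) (XPhi gsT (fun y i => XTrho B y i)) nXT.
  (* Only the target is missed: with K = 0 nothing is switched off, and s0 = T makes the condition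
     on later times void. *)
  apply: (bar d 0 T d0 (lexx _) TT).
    by move=> t y /andP[_ tT] Tt; rewrite ltNge tT in Tt.
  move=> y /far[i iV yi]; left; exists i => //; lra.
have [Xphi|nX] := pselect (forall t, 0 <= t <= T -> XB gs B (phi t)); first by left.
right; have [t1 t1T nX1] : exists2 t, 0 <= t <= T & ~ XB gs B (phi t).
  by apply: contrapT => h; apply: nX => t tT; apply: contrapT => Xt; apply: h; exists t.
have [d d0 far] := far_from_XB gs_dep (phiB t1 ^~ t1T) (XPhi gs (fun y i => Xrho B y i)) nX1.
(* Within time [eta] of [t1] the curve moves at most d, so distance 3d from the constraint set
   leaves 2d. *)
pose eta := d / (`|M| + 1); have M1 : 0 < `|M| + 1 by have := normr_ge0 M; lra.
have eta0 : 0 < eta by rewrite divr_gt0.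
have etaE : eta * (`|M| + 1) = d by rewrite divfK // gt_eqF.
have near t y : 0 <= t <= T -> `|t - t1| <= eta -> XB gs B y ->
    exists2 i, i \in Vr blk B & 2 * d < `|y i - phi t i|.
  move=> tT tt /far[i iV yi]; exists i => //.
  have h1 := lip t t1 i tT t1T; have h2 : `|M| * `|t - t1| <= `|M| * eta by exact: ler_wpM2l.
  have := ler_normD (y i - phi t i) (phi t i - phi t1 i); rewrite addrA subrK.
  lra.
(* At time 0 the curve is at [x], a point of the constraint set. This makes the starting time t1 -
   eta of the switch-off nonnegative. *)
have t1eta : eta <= t1.
  rewrite leNgt; apply/negP => t1e; have /andP[t10 _] := t1T.
  have h0 : `|0 - t1| <= eta by rewrite sub0r normrN ger0_norm // ltW.
  by have [i _] := near 0 x O h0 XBx; rewrite phi0 subrr normr0; lra.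
have e20 : 0 < eta ^+ 2 by rewrite exprn_gt0.
(* With K = (d / eta)^2 and s0 = t1 - eta the switch-off term reaches d^2 at [t1]; between [s0] and
   [t1] the curve is far from the constraint set. *)
have K0 : 0 <= d ^+ 2 / eta ^+ 2 by rewrite divr_ge0 ?sqr_ge0.
have sq t : eta <= t -> d ^+ 2 <= d ^+ 2 / eta ^+ 2 * t ^+ 2.
  move=> et; rewrite mulrAC ler_pdivlMr // ler_wpM2l ?sqr_ge0 //.
  by apply: lerXn2r; rewrite ?nnegrE //; lra.
have s0T : 0 <= t1 - eta <= T by move: t1T => /andP[? ?]; apply/andP; split; lra.
apply: (bar d _ _ d0 K0 s0T).
- move=> t y tT st Xy; have [tt|tt] := leP t t1.
    by left; apply: near => //; rewrite ler0_norm; lra.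
  by right; apply: sq; lra.
- by move=> y _; right; apply: sq; move: t1T => /andP[? ?]; lra.
Qed.

(** * Exhausting the bad set by rational boxes *)

Definition rational_box B (p : {ffun 'I_n -> rat} * rat) : set ('I_n -> R) :=
  [set y | forall i, i \in Vr blk B -> `|y i - ratr (p.1 i)| < ratr p.2].

(** Enumerates all rational boxes and keeps those that are separated; rejected boxes and numbers
    that encode no box give [set0], so the sequence is total. *)
Definition box_seq B (m : nat) : set ('I_n -> R) :=
  if unpickle m is Some p then
    if `[< separated B (rational_box B p) >] then rational_box B p else set0
  else set0.

Fixpoint box_union B (m : nat) : set ('I_n -> R) :=
  if m is m'.+1 then box_union B m' `|` box_seq B m' else set0.

Lemma separated_box_seq B m : separated B (box_seq B m).
Proof.
rewrite /box_seq; case: unpickle => [p|]; last exact: separated0.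
by case: asboolP => [//|_]; exact: separated0.
Qed.

Lemma separated_box_union B m : separated B (box_union B m).
Proof.
elim: m => [|m IH] /=; first exact: separated0.
by apply: separatedU => //; exact: separated_box_seq.
Qed.

Lemma box_union_mono B m k : (m <= k)%N -> box_union B m `<=` box_union B k.
Proof.
move=> /subnK <-; elim: (k - m)%N => [|j IH] //=.
by apply: (subset_trans IH); exact: subsetUl.
Qed.

(* Outside of [exit_set B] the points of [XB gs B] are admissible, by
   [admissible_or_separated] and [separated_exit_set]. *)
Definition exit_set B : set ('I_n -> R) := \bigcup_m box_seq B m.

Lemma exit_setP B x : exit_set B x -> exists m, box_union B m x.
Proof. by move=> [m _ mx]; exists m.+1; right. Qed.

Lemma box_union_exit B m : box_union B m `<=` exit_set B.
Proof. by elim: m => [|m IH] //= x [/IH//|mx]; exists m. Qed.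

Lemma separated_exit_set B x r : 0 < r ->
  separated B [set y | forall i, i \in Vr blk B -> `|y i - x i| < r] -> exit_set B x.
Proof.
move=> r0 sB.
(* A rational centre within q of [x] and radius q < r / 2 give a box that contains [x] and lies in
   the given one. *)
have [q] : exists q : rat, ratr q \in `]0, (r / 2)[ by apply: rat_in_itvoo; rewrite divr_gt0.
rewrite in_itv /= => /andP[q0 qr].
have /choice[c Hc] i : exists c : rat, `|x i - ratr c| < ratr q.
  have [c] : exists c : rat, ratr c \in `](x i - ratr q), (x i + ratr q)[.
    by apply: rat_in_itvoo; lra.
  by rewrite in_itv /= => /andP[c1 c2]; exists c; rewrite ltr_norml; apply/andP; split; lra.
pose p := ([ffun i => c i], q).
exists (pickle p) => //; rewrite /box_seq pickleK.
have sp : separated B (rational_box B p).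
  apply: separated_sub sB => y yp i iV; have := yp i iV; rewrite /p ffunE /= => h1.
  have := Hc i; rewrite distrC => h2.
  have := ler_normD (y i - ratr (c i)) (ratr (c i) - x i); rewrite addrA subrK; lra.
by rewrite asboolT // => i iV; rewrite ffunE; exact: Hc.
Qed.

Lemma mset_coord_box_seq B m : mset_coord (box_seq B m).
Proof.
rewrite /box_seq; case: unpickle => [p|]; last exact: mset_coord0.
case: asboolP => _; last exact: mset_coord0.
have -> : rational_box B p =
    [set y | forall i, i \in enum (Vr blk B) -> [set z | `|z i - ratr (p.1 i)| < ratr p.2] y].
  by apply/seteqP; split => y yp i; [rewrite mem_enum => /yp|move=> iV; apply: yp; rewrite mem_enum].
by apply: mset_coord_bigcap_seq => i _; exact: mset_coord_lt.
Qed.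

Lemma mset_coord_exit_set B : mset_coord (exit_set B).
Proof. by apply: mset_coord_bigcup => m; exact: mset_coord_box_seq. Qed.

Lemma mset_coord_box_union B m : mset_coord (box_union B m).
Proof.
elim: m => [|m IH] /=; first exact: mset_coord0.
have -> : box_union B m `|` box_seq B m = ~` (~` box_union B m `&` ~` box_seq B m).
  by rewrite setCI !setCK.
apply: mset_coordC; apply: mset_coordI; apply: mset_coordC => //.
exact: mset_coord_box_seq.
Qed.

Lemma mset_coord_XB g B : mset_coord (XB g B : set ('I_n -> R)).
Proof.
have -> : XB g B = [set x | forall p, p \in gensOf g B -> [set y | 0 <= ev p 0 y] x].
  apply/seteqP; split => x Xx; first by move=> p /gensOfP[j jB pj]; exact: Xx pj.
  by move=> j jB p pj; apply: Xx; apply/gensOfP; exists j.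
by apply: mset_coord_bigcap_seq => p _; exact: mset_coord_ev_ge.
Qed.

Lemma XsetE B : Xset gs = XB gs B `&` XB gs (~: B)%SET.
Proof.
apply/seteqP; split => x.
  by move=> Xx; split => j _; apply: Xx; rewrite inE.
by move=> [XBx XCx] j _; have [jB|jB] := boolP (j \in B); [exact: XBx|apply: XCx; rewrite inE].
Qed.

Lemma Xset_XB B : Xset gs `<=` XB gs B.
Proof. by rewrite (XsetE B) => x []. Qed.

(** * Integrals over products of blocks *)

Lemma iint_dep (s : seq 'I_n) (g : ('I_n -> R) -> \bar R) (P : pred 'I_n) x y :
  (forall z z', (forall i, P i -> z i = z' i) -> g z = g z') ->
  (forall i, P i -> i \notin s -> x i = y i) -> iint s g x = iint s g y.
Proof.
move=> gP; elim: s x y => [|i s IH] x y xy /=; first by apply: gP => j Pj; exact: xy.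
apply: eq_integral => t _; apply: IH => j Pj js; rewrite /upd; case: eqP => // /eqP ji.
by apply: xy; rewrite // inE negb_or ji.
Qed.

(** [Xset gs] is a product of the part over [B] and the part over the other blocks, so its slices
    are either the whole of the first part or empty. *)
Lemma iint_Xset B w x : dep_only (Svars (Vr blk B)) w ->
  iint (enum (Vr blk B)) (fun y => (\1_(Xset gs) y * ev w 0 y)%:E) x =
  if x \in (XB gs (~: B)%SET : set _) then intOn (Vr blk B) (XB gs B) w else 0%E.
Proof.
move=> dw.
have XC y : (forall j, j \notin enum (Vr blk B) -> y j = x j) ->
    (y \in XB gs (~: B)%SET) = (x \in XB gs (~: B)%SET).
  move=> yx; apply/idP/idP => /set_mem h; apply: mem_set.
    by apply: (XB_dep gs_dep _ h) => i; rewrite !inE => iB; apply: yx; rewrite mem_enum inE.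
  by apply: (XB_dep gs_dep _ h) => i; rewrite !inE => iB; apply/esym/yx; rewrite mem_enum inE.
case: ifPn => xC.
  rewrite (@eq_iint _ _ _ _ (fun y => (\1_(XB gs B) y * ev w 0 y)%:E)).
    apply: (@iint_dep _ _ (fun i => i \in Vr blk B)) => [z z' zz'|i iV].
      rewrite (@ev_dep_space _ _ _ w 0 0 z z' dw) //; congr ((_ * _)%:E).
      apply: indic_iff; split => h; apply: (XB_dep gs_dep _ h) => i iV; first exact: zz'.
      by apply/esym; exact: zz'.
    by rewrite mem_enum iV.
  move=> y yx; congr ((_ * _)%:E); rewrite !indicE (XsetE B) in_setI (XC y yx) xC.
  by rewrite andbT.
rewrite (@eq_iint _ _ _ _ (fun=> 0%E)) ?iint0 // => y yx.
by rewrite indicE (XsetE B) in_setI (XC y yx) (negbTE xC) andbF mul0r.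
Qed.

(** The objective integrates over the blocks of one past only; integrating once more over the other
    coordinates carries the comparison to [X], where all leafs share one measure. *)
Lemma le_iint_Xset B w w' x : dep_only (Svars (Vr blk B)) w -> dep_only (Svars (Vr blk B)) w' ->
  (forall y, XB gs B y -> 0 <= ev w 0 y) -> (forall y, XB gs B y -> 0 <= ev w' 0 y) ->
  (intOn (Vr blk B) (XB gs B) w <= intOn (Vr blk B) (XB gs B) w')%E ->
  (iint (enum 'I_n) (fun y => (\1_(Xset gs) y * ev w 0 y)%:E) x <=
   iint (enum 'I_n) (fun y => (\1_(Xset gs) y * ev w' 0 y)%:E) x)%E.
Proof.
move=> dw dw' w0 w'0 ww'.
have perm : perm_eq (enum 'I_n) (enum (~: Vr blk B)%SET ++ enum (Vr blk B)).
  apply: uniq_perm; first exact: enum_uniq.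
    rewrite cat_uniq !enum_uniq andbT; apply/hasPn => i /=.
    by rewrite !mem_enum finset.in_setC => ->.
  by move=> i; rewrite mem_cat !mem_enum !inE; case: (_ \in B).
have pos u : (forall y, XB gs B y -> 0 <= ev u 0 y) ->
    forall y, (0 <= (\1_(Xset gs) y * ev u 0 y)%:E)%E.
  move=> u0 y; rewrite lee_fin indicE; case: (boolP (y \in _)) => [/set_mem Xy|_].
    by rewrite mul1r; apply: u0; exact: Xset_XB Xy.
  by rewrite mul0r.
have mX : mset_coord (Xset gs : set ('I_n -> R)) by exact: mset_coord_XB.
rewrite !(iint_perm _ (enum_uniq _) perm) //; try exact: pos; try exact: mfun_coord_indicM.
rewrite !iint_cat; apply: le_iint => y; first by apply: iint_ge0; exact: pos.
by rewrite !iint_Xset //; case: ifP.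
Qed.

Lemma Xset_volume : exists2 K : R, 0 <= K & forall (C : R) (g : ('I_n -> R) -> \bar R), 0 <= C ->
  (forall y, 0 <= g y)%E -> (forall y, g y <= (C * \1_(Xset gs) y)%:E)%E ->
  (iint (enum 'I_n) g (fun=> 0%R) <= (C * K)%:E)%E.
Proof.
have [r r0 Hr] := ball_bounded gs_balls.
exists ((2 * r) ^+ size (enum 'I_n)); first by rewrite exprn_ge0 // mulr_ge0.
move=> C g C0 g0 gC; apply: iint_bounded => //; first exact: enum_uniq.
- move=> y; apply: le_trans (gC y) _; by rewrite lee_fin ler_piMr.
- move=> y i _ ri; apply/eqP; rewrite eq_le g0 andbT; apply: le_trans (gC y) _.
  rewrite indicE memNset ?mulr0 // => Xy.
  have := Hr _ y i Xy; by rewrite inE finset.in_setT leNgt ri => /(_ isT).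
Qed.

Lemma Leb_sub_Xset A : A `<=` Xset gs -> exists2 a : R, 0 <= a & Leb A = a%:E.
Proof.
move=> AX; have [K K0 HK] := Xset_volume.
have h : (Leb A <= (1 * K)%:E)%E.
  apply: HK => // y; rewrite lee_fin // mul1r !indicE ler_nat.
  by have [/set_mem/AX/mem_set ->|] := boolP (y \in A).
have h0 := Leb_ge0 A; exists (fine (Leb A)); first by rewrite fine_ge0.
by rewrite fineK // ge0_fin_numE // (le_lt_trans h) // ltry.
Qed.

(** Monotone convergence along the finite unions. The ball constraints keep the measures finite, so
    failure for every [m] would put the limit [eta] below itself. *)
Lemma Leb_box_union B (eta : R) : 0 < eta ->
  exists m, (Leb (Xset gs `&` exit_set B) <= Leb (Xset gs `&` box_union B m) + eta%:E)%E.
Proof.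
move=> eta0; have mX : mset_coord (Xset gs : set ('I_n -> R)) by exact: mset_coord_XB.
have cv : (fun m => Leb (Xset gs `&` box_union B m)) @ \oo --> Leb (Xset gs `&` exit_set B).
  apply: iint_nondecreasing_cvg => [m y|m|y m k mk|y].
  - by rewrite lee_fin.
  - by apply: mset_coord_indic; apply: mset_coordI => //; exact: mset_coord_box_union.
  - rewrite lee_fin !indicE ler_nat; case: (boolP (y \in (Xset gs `&` box_union B m : set _))) => // /set_mem[Xy my].
    by rewrite mem_set //; split => //; exact: box_union_mono my.
  - have [[Xy /exit_setP[m0 my]]|ny] := pselect ((Xset gs `&` exit_set B) y).
      apply: cvg_near_cst; exists m0 => //= m m0m.
      rewrite !indicE !mem_set //; first by split => //; exact: box_union_exit my.
      by split => //; exact: box_union_mono my.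
    apply: cvg_near_cst; exists 0%N => //= m _.
    by rewrite !indicE !memNset // => -[Xy my]; apply: ny; split => //; exact: box_union_exit my.
have [a a0 aE] := @Leb_sub_Xset (Xset gs `&` exit_set B) (@subIsetl _ _ _).
apply: contrapT => /forallNP h.
have : (Leb (Xset gs `&` exit_set B) <= (a - eta)%:E)%E.
  rewrite -(cvg_lim _ cv) //; apply: lime_le; first by apply/cvg_ex; eexists; exact: cv.
  apply: nearW => m; have [b b0 bE] := @Leb_sub_Xset (Xset gs `&` box_union B m) (@subIsetl _ _ _).
  have /negP := h m; rewrite aE bE -EFinD lee_fin -ltNge lee_fin; lra.
rewrite aE lee_fin; lra.
Qed.

(* Optimality compares [w k] with the certificate [w'] of a finite union [W] of boxes.
   With [E := exit_set B] and [Z := X `&` E `&` {1 <= w k}], and since [1 <= w k] on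
   [X `\` E], [Leb Z + Leb (X `\` E) <= int_X (w k) <= int_X w' <= Leb (X `\` W) + e K],
   where [Leb (X `\` W)] is close to [Leb (X `\` E)]. *)
Theorem decoupled_convergence B (w : nat -> SPoly R n) : past_closed_blocks B ->
  (forall k, exists v, opt_dec blk f gs gsT T k B v (w k)) ->
  forall eta : R, 0 < eta -> exists k0, forall k, (k0 <= k)%N ->
    (Leb (Xset gs `&` exit_set B `&` [set x | (1 <= ev (w k) 0 x)%R]) <= eta%:E)%E.
Proof.
move=> cB opt eta eta0; have [K K0 HK] := Xset_volume.
have K1 : 0 < 1 + K by lra.
(* One [e] pays for the part not covered by finitely many boxes, and [e * K] for the slack of [w']
   integrated over [X]. *)
pose e := eta / (1 + K); have e0 : 0 < e by rewrite divr_gt0.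
have eE : e * (1 + K) = eta by rewrite divfK // gt_eqF.
have [m Hm] := Leb_box_union B e0.
have [w' [k0 [Hfeas Hw']]] := separated_feasible cB (@separated_box_union B m) e0.
exists k0 => k kk; have [v' fv'] := Hfeas k kk; have [v [fv /(_ _ _ fv') opt_le]] := opt k.
have [[_ _ _ dw] _] := fv; have [[_ _ _ dw'] _] := fv'.
set X : set ('I_n -> R) := Xset gs; set W := box_union B m in Hm Hw' *.
set Z := _ `&` [set x | _].
have mX : mset_coord X by exact: mset_coord_XB.
have mE := @mset_coord_exit_set B; have mW : mset_coord W by exact: mset_coord_box_union.
have mD : mset_coord (X `&` exit_set B) by exact: mset_coordI.
have mXD : mset_coord (X `\` exit_set B) by exact: mset_coordD.
have mXW : mset_coord (X `&` W) by exact: mset_coordI.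
have mXnW : mset_coord (X `\` W) by exact: mset_coordD.
have mZ : mset_coord Z by apply: mset_coordI => //; exact: mset_coord_ev_ge.
have ind_ge0 A y : (0 <= (\1_A y)%:E :> \bar R)%E by rewrite lee_fin.
have Xw y : X y -> 0 <= ev (w k) 0 y by move=> Xy; apply: feas_dec_ge0 fv _; exact: Xset_XB Xy.
have Xw' y : X y -> 0 <= ev w' 0 y by move=> Xy; apply: feas_dec_ge0 fv' _; exact: Xset_XB Xy.
have h1 : (Leb Z + Leb (X `\` exit_set B) <=
    iint (enum 'I_n) (fun y => (\1_X y * ev (w k) 0 y)%:E) (fun=> 0%R))%E.
  rewrite /Leb -iintD //; try exact: mset_coord_indic.
  apply: le_iint => y; first exact: adde_ge0.
  rewrite -EFinD lee_fin; have [[Xy Ey]|nDy] := pselect ((X `&` exit_set B) y).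
    have -> : \1_(X `\` exit_set B) y = 0 :> R by rewrite indicE memNset // => -[].
    rewrite addr0 [\1_X y]indicE mem_set // mul1r.
    have [Zy|nZ] := pselect (Z y); first by rewrite indicE mem_set //; case: Zy.
    by rewrite indicE memNset //; exact: Xw.
  have -> : \1_Z y = 0 :> R by rewrite indicE memNset // => -[].
  have [Xy|nX] := pselect (X y); last first.
    have -> : \1_(X `\` exit_set B) y = 0 :> R by rewrite indicE memNset // => -[].
    by rewrite [\1_X y]indicE memNset // mul0r addr0.
  have nEy : ~ exit_set B y by move=> Ey; apply: nDy.
  rewrite !indicE !mem_set // add0r mul1r; apply: feas_dec_admissible fv _.
  have [phi [phi0 cphi dphi] /(_ B cB (Xset_XB Xy))[[Xphi XTphi]|[r r0 sr]]] := admissible_or_separated y.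
    exists phi; split => // t tT i iV; apply: (dphi t i tT B cB iV).
    by apply: Xphi; case/andP: tT => ? ?; rewrite !ltW.
  by case: nEy; exact: separated_exit_set sr.
have h2 := le_iint_Xset (fun=> 0) dw dw' (fun y => @feas_dec_ge0 _ _ _ _ y fv)
  (fun y => @feas_dec_ge0 _ _ _ _ y fv') opt_le.
have h3 : (iint (enum 'I_n) (fun y => (\1_X y * ev w' 0 y)%:E) (fun=> 0%R) <=
    Leb (X `\` W) + (e * K)%:E)%E.
  have mXe : mfun_coord (fun y => (e * \1_X y)%:E).
    have -> : (fun y => (e * \1_X y)%:E) = (fun y => (\1_X y * ev (Cst n e) 0 y)%:E).
      by apply/funext => y; rewrite evC mulrC.
    exact: mfun_coord_indicM.
  have e1_ge0 y : (0 <= (e * \1_X y)%:E :> \bar R)%E.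
    by rewrite lee_fin mulr_ge0 // ltW.
  apply: (@le_trans _ _ (iint (enum 'I_n) (fun y => (\1_(X `\` W) y)%:E + (e * \1_X y)%:E) (fun=> 0%R))%E).
    apply: le_iint => y.
      rewrite lee_fin indicE; case: (boolP (y \in X)) => [/set_mem/Xw'|_]; first by rewrite mul1r.
      by rewrite mul0r.
    rewrite -EFinD lee_fin; have [Xy|nX] := pselect (X y); last first.
      by rewrite [\1_X y]indicE memNset // mul0r mulr0 addr0.
    rewrite [\1_X y]indicE mem_set // mul1r mulr1.
    apply: le_trans (Hw' y (Xset_XB Xy)) _; rewrite lerD2r !indicE ler_nat.
    by case: (boolP (y \in ~` W)) => // /set_mem nW; rewrite mem_set.
  rewrite iintD //; last exact: mset_coord_indic.
  by apply: leeD => //; apply: HK => //; exact: ltW.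
have h4 := Leb_split mX mW; have h5 := Leb_split mX mE.
have [a a0 aE] := @Leb_sub_Xset (X `&` W) (@subIsetl _ _ _).
have [b b0 bE] := @Leb_sub_Xset (X `\` W) (@subDsetl _ _ _).
have [c c0 cE] := @Leb_sub_Xset (X `&` exit_set B) (@subIsetl _ _ _).
have [d d0 dE] := @Leb_sub_Xset (X `\` exit_set B) (@subDsetl _ _ _).
have [z z0 zE] : exists2 z : R, 0 <= z & Leb Z = z%:E by apply: Leb_sub_Xset => y [[]].
have := le_trans h1 (le_trans h2 h3); move: Hm h4 h5.
rewrite zE aE bE cE dE -!EFinD !lee_fin => Hm h4 h5.
have : a + b = c + d by apply: EFin_inj; rewrite -h4 -h5.
lra.
Qed.

End DecoupledHierarchy.

(** * The limit of the intersected approximations *)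

Lemma cvg_ereal0 (R : realType) (u : nat -> \bar R) : (forall k, (0 <= u k)%E) ->
  (forall e : R, 0 < e -> exists k0, forall k, (k0 <= k)%N -> (u k <= e%:E)%E) ->
  u @ \oo --> (0 : \bar R).
Proof.
move=> u0 ue; have fin k e : (u k <= e%:E)%E -> u k \is a fin_num.
  by move=> h; rewrite ge0_fin_numE // (le_lt_trans h) // ltry.
apply/fine_cvgP; split.
  by have [k0 Hk0] := ue 1 ltr01; exists k0 => // k /= /Hk0/fin.
apply/cvgrPdist_le => e e0; have [k0 Hk0] := ue e e0.
exists k0 => // k /= /Hk0 h; rewrite sub0r normrN ger0_norm ?fine_ge0 //.
by rewrite -lee_fin fineK //; exact: fin h.
Qed.

Lemma Leb_union_seq (R : realType) (n : nat) (I : eqType) (s : seq I) (A : I -> set ('I_n -> R)) :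
  (forall i, mset_coord (A i)) ->
  (Leb [set x | exists2 i, i \in s & A i x] <= \sum_(i <- s) Leb (A i))%E.
Proof.
move=> mA; suff [] : mset_coord [set x | exists2 i, i \in s & A i x] /\
  (Leb [set x | exists2 i, i \in s & A i x] <= \sum_(i <- s) Leb (A i))%E by [].
elim: s => [|i s [mS IH]].
  have -> : [set x | exists2 i, i \in [::] & A i x] = set0 by apply/seteqP; split => x // -[].
  split; first exact: mset_coord0.
  rewrite big_nil /Leb -[leRHS](iint0 (enum 'I_n) (fun=> 0%R)).
  by apply: le_iint => y; rewrite indic0.
have E : [set x | exists2 j, j \in i :: s & A j x] = A i `|` [set x | exists2 j, j \in s & A j x].
  apply/seteqP; split => x.
    by move=> [j]; rewrite inE => /predU1P[-> ?|js Aj]; [left|right; exists j].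
  by move=> [Ai|[j js Aj]]; [exists i; rewrite ?mem_head|exists j => //; rewrite inE js orbT].
rewrite E; split.
  rewrite -[A i `|` _]setCK setCU; apply: mset_coordC; apply: mset_coordI; exact: mset_coordC.
rewrite big_cons; apply: le_trans (Leb_setU (mA i) mS) _; exact: leeD.
Qed.

Lemma sqmod_ge0 (R : realType) (n l k : nat) (S : 'I_l -> {set 'I_n.+1})
    (G : 'I_l -> seq (SPoly R n)) h z :
  sqmod k S G h -> (forall r g, g \in G r -> 0 <= mpoly.meval z g) -> 0 <= mpoly.meval z h.
Proof.
move=> [hr [qr ->]] Gz; rewrite raddf_sum /= sumr_ge0 // => r _.
by apply: qmod_ge0 (qr r) _ => g; exact: Gz.
Qed.

(** In the sparse program only the sum of the [v r] decreases along solutions, so the monotonicity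
    argument is applied to this sum as a function of the full state. *)
Lemma ROA_sub_sparse (R : realType) (n N : nat) (blk : 'I_n -> 'I_N)
    (f : 'I_n -> SPoly R n) (gs gsT : 'I_N -> seq (SPoly R n)) (T : R) (l k : nat)
    (Bs : 'I_l -> {set 'I_N}) (v w : 'I_l -> SPoly R n) x :
  (forall i, ~~ depb (f i) (tv n)) -> block_dep blk gs -> 0 < T ->
  feas_sp blk f gs gsT T k Bs v w -> ROA f gs gsT T x -> l%:R <= \sum_(r < l) ev (w r) 0 x.
Proof.
move=> ft dgs T0 [dvw q1 q2 q3 q4] [Xx [phi [[phi0 cphi dphi] [Xphi XTphi]]]].
have spos y t : Xset gs y -> forall r g, g \in gensOf gs (Bs r) -> 0 <= mpoly.meval (pt t y) g.
  move=> Xy r g /gensOfP[j jB gj]; rewrite -/(ev g t y).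
  by rewrite (@ev_dep_space _ _ _ g t 0 y y (dgs _ _ gj)) //; apply: Xy gj; rewrite inE.
pose vS := \sum_r v r.
have dv r : dep_only (Stvars (Vr blk (Bs r))) (v r) by case: (dvw r).
have dvS : dep_only (Stvars [set: 'I_n]%SET) vS.
  apply: dep_only_sum => r _; apply: dep_only_sub (dv r).
  by apply: Stvars_mono; exact: finset.subsetT.
have LvS : Lie f [set: 'I_n]%SET vS = \sum_(r < l) Lie f (Vr blk (Bs r)) (v r).
  by rewrite Lie_sum; apply: eq_bigr => r _; rewrite (Lie_setT f (dv r)).
have vT : 0 <= ev vS T (phi T).
  have -> : ev vS T (phi T) = ev (\sum_(r < l) vat T (v r)) 0 (phi T).
    by rewrite !ev_sum; apply: eq_bigr => r _; rewrite ev_vat.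
  apply: sqmod_ge0 q2 _ => r g /gensOfP[j jB gj].
  by apply: XTphi gj; rewrite inE.
have v0 : ev vS T (phi T) <= ev vS 0 (phi 0).
  apply: (Lie_nonincreasing T0 dvS) => [i _|t tT i _|t /andP[t0 t1]]; first exact: cphi.
    by rewrite (ev_no_time t 0) //; exact: dphi.
  have tT : 0 <= t <= T by rewrite !ltW.
  rewrite -oppr_ge0 -evN LvS; apply: sqmod_ge0 q1 _ => r g.
  rewrite inE => /predU1P[->|]; last by apply: spos; exact: Xphi.
  by rewrite -/(ev _ t (phi t)) evM evB ev_tv evC mulr_ge0 ?subr_ge0 ?ltW.
have := sqmod_ge0 q4 (fun r => spos x 0 Xx r); rewrite -/(ev _ 0 x) evB.
have -> : ev (l%:R : SPoly R n) 0 x = l%:R by rewrite /ev rmorph_nat.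
have -> : ev (\sum_(r < l) (w r - vat 0 (v r))) 0 x = \sum_(r < l) ev (w r) 0 x - ev vS 0 x.
  by rewrite !ev_sum -sumrB; apply: eq_bigr => r _; rewrite evB ev_vat.
by rewrite phi0 in v0; lra.
Qed.

Theorem theorem5 (R : realType) (n N : nat) (blk : 'I_n -> 'I_N)
  (f : 'I_n -> SPoly R n) (gs gsT : 'I_N -> seq (SPoly R n)) (T : R)
  (l : nat) (lf : 'I_l -> 'I_N)
  (wd vd : nat -> 'I_l -> SPoly R n) (ws vs : nat -> 'I_l -> SPoly R n) :
  (forall j : 'I_N, exists i, blk i = j) ->
  (forall i, ~~ depb (f i) (tv n)) ->
  (forall j p, p \in gs j -> dep_only (Svars (Jset blk j)) p) ->
  (forall j p, p \in gsT j -> dep_only (Svars (Jset blk j)) p) ->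
  (forall j, exists rho : R, ball_con blk j rho \in gs j) ->
  (forall j, exists rho : R, ball_con blk j rho \in gsT j) ->
  0 < T ->
  acyclic blk f ->
  injective lf ->
  (forall a, leaf blk f a <-> exists r, lf r = a) ->
  (forall k (r : 'I_l), opt_dec blk f gs gsT T k (past blk f (lf r)) (vd k r) (wd k r)) ->
  (forall k, opt_sp blk f gs gsT T k (fun r => past blk f (lf r)) (vs k) (ws k)) ->
  let X := Xset gs in
  let S := fun k => [set x | X x /\ forall r, 1 <= ev (wd k r) 0 x] in
  let Y := fun k => [set x | X x /\ l%:R <= \sum_(r < l) ev (ws k r) 0 x] in
  let RT := ROA f gs gsT T in
  [/\ (forall k, RT `<=` S k `&` Y k),
      (fun k => Leb ((S k `&` Y k `\` RT) `|` (RT `\` (S k `&` Y k))))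
        @ \oo --> (0 : \bar R) &
      \max_(r < l) #|Vr blk (past blk f (lf r))| = omega blk f].
Proof.
move=> _ ft dgs dgT bgs bgT T0 acf _ lfP optd opts X S Y RT.
pose B r := past blk f (lf r).
have cB r : past_closed_blocks blk f (B r) by move=> i; exact: past_closed.
have RTS k : RT `<=` S k `&` Y k.
  move=> x RTx; have [Xx [phi [[phi0 cphi dphi] [Xphi XTphi]]]] := RTx.
  split; split => //; last first.
    by have [fs _] := opts k; exact: ROA_sub_sparse ft dgs T0 fs RTx.
  move=> r; have [fd _] := optd k r; apply: (feas_dec_admissible dgs T0 fd).
  exists phi; split => // [t tT i _|t tT|].
  - by rewrite (ev_no_time t 0 (phi t) (ft i)); exact: dphi.
  - exact: Xset_XB (Xphi t tT).
  - by move=> j _; apply: XTphi; rewrite inE.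
split => //; last exact: omega_leaves.
pose Z k r := X `&` exit_set blk f gs gsT T (B r) `&` [set x | 1 <= ev (wd k r) 0 x].
have mZ k r : mset_coord (Z k r).
  apply: mset_coordI; last exact: mset_coord_ev_ge.
  by apply: mset_coordI; [exact: mset_coord_XB|exact: mset_coord_exit_set].
(* One half of the symmetric difference is empty by [RTS]. A point in the other half has
   [1 <= ev (wd k r) 0 x] for every leaf, so it suffices that its curve fails for some leaf. *)
have sub k : (S k `&` Y k `\` RT) `|` (RT `\` (S k `&` Y k)) `<=`
    [set x | exists2 r, r \in enum 'I_l & Z k r x].
  move=> x [[[[Xx Sx] _] nRT]|[/RTS SY nSY]]; last by case: nSY.
  have [phi [phi0 cphi dphi] alt] := admissible_or_separated f dgs dgT bgs bgT T0 x.
  apply: contrapT => nZ; apply: nRT.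
  have stay r : (forall t, 0 <= t <= T -> XB gs (B r) (phi t)) /\ XB gsT (B r) (phi T).
    have [//|[d d0 sd]] := alt (B r) (cB r) (Xset_XB Xx).
    case: nZ; exists r; first by rewrite mem_enum.
    by split; [split => //; exact: separated_exit_set sd|exact: Sx].
  (* Every block lies in the past of some leaf, so the statements per leaf yield all equations and
     all constraints of the full system. *)
  have cover j : exists r, j \in B r.
    have [a /lfP[r <-] ja] := connect_leaf acf j; exists r.
    by rewrite inE.
  split => //; exists phi; split; [split => //|split].
  - move=> t tT i; have [r ir] := cover (blk i).
    rewrite (ev_no_time 0 t (phi t) (ft i)); apply: (dphi t i tT (B r) (cB r)).
      by rewrite inE.
    by have [h _] := stay r; apply: h; case/andP: tT => ? ?; rewrite !ltW.
  - by move=> t tT j _; have [r jr] := cover j; have [h _] := stay r; exact: h jr.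
  - by move=> j _; have [r jr] := cover j; have [_ h] := stay r; exact: h jr.
apply: cvg_ereal0 => [k|e e0]; first exact: Leb_ge0.
(* Dividing by l + 1 instead of l covers the case of no leaf as well. *)
have l1 : 0 < l%:R + 1 :> R by apply: ltr_wpDl.
have [k0 Hk0] : exists k0 : 'I_l -> nat, forall r k, (k0 r <= k)%N ->
    (Leb (Z k r) <= (e / (l%:R + 1))%:E)%E.
  suff /choice[k0 Hk0] r : exists k0, forall k, (k0 <= k)%N ->
    (Leb (Z k r) <= (e / (l%:R + 1))%:E)%E by exists k0.
  apply: (@decoupled_convergence _ _ _ blk f gs gsT T dgs dgT bgs bgT T0 (B r) (wd^~ r)).
  - exact: cB.
  - by move=> k; exists (vd k r); exact: optd.
  - exact: divr_gt0.
exists (\max_r k0 r) => k kk.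
apply: le_trans (le_Leb (@sub k)) _; apply: le_trans (Leb_union_seq _ (mZ k)) _.
apply: (@le_trans _ _ (\sum_(r <- enum 'I_l) (e / (l%:R + 1))%:E)%E).
  apply: lee_sum => r _; apply: Hk0; apply: leq_trans kk; exact: leq_bigmax.
rewrite sumEFin lee_fin big_const_seq count_predT size_enum_ord iter_addr addr0.
rewrite -[leLHS]mulr_natr -[leRHS](divfK (lt0r_neq0 l1)).
by apply: ler_wpM2l; [exact: ltW (divr_gt0 e0 l1)|rewrite lerDl].
Qed.
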